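(* Let $n\ge 1$. (i) If for every integer $m\ge1$ one has $L_K\le L_{\Delta^{n+m}}$ for every convex body $K\subset\mathbb{R}^{n+m}$, then $\widehat{L}_f\le \widehat{L}_{f_0}=e^{-1}$ for every integrable log-concave function $f:\mathbb{R}^n\to[0,+\infty)$ with $\int f>0$, where $f_0(x)=e^{-\sum_{i=1}^n x_i}\chi_{[-1,+\infty)^n}(x)$. (ii) If $\widehat{L}_f\le e^{-1}$ for every integrable log-concave function $f:\mathbb{R}^{n+1}\to[0,+\infty)$ with $\int f>0$, then $$L_K\le L_{\Delta^n}=\frac{(n!)^{1/n}}{(n+1)^{(n+1)/(2n)}\sqrt{n+2}}$$ for every convex body $K\subset\mathbb{R}^n$.
   Context: A convex body is a compact convex set with nonempty interior, and $\Delta^d$ is a regular simplex in $\mathbb{R}^d$ with barycenter at the origin. For a convex body $K\subset\mathbb{R}^d$, $$\mathrm{bar}(K)=\frac{1}{\mathrm{vol}(K)}\int_K x\,dx,\quad \mathrm{Cov}(K)=\frac{1}{\mathrm{vol}(K)}\int_K xx^T\,dx-\mathrm{bar}(K)\mathrm{bar}(K)^T,\quad L_K=\frac{(\det\mathrm{Cov}(K))^{1/(2d)}}{\mathrm{vol}(K)^{1/d}};$$ for the simplex, $L_{\Delta^d}=\frac{(d!)^{1/d}}{(d+1)^{(d+1)/(2d)}\sqrt{d+2}}$. A function $f:\mathbb{R}^d\to[0,+\infty)$ is log-concave if $f=e^{-\varphi}$ with $\varphi:\mathbb{R}^d\to\mathbb{R}\cup\{+\infty\}$ convex. $\chi_A$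 denotes the characteristic function of $A$. For integrable log-concave $f:\mathbb{R}^d\to[0,+\infty)$ with $\int f>0$, $$\mathrm{bar}(f)=\frac{\int xf(x)\,dx}{\int f},\quad \mathrm{Cov}(f)=\frac{\int xx^Tf(x)\,dx}{\int f}-\mathrm{bar}(f)\mathrm{bar}(f)^T,\quad h(f)=-\frac{\int f\log f}{\int f}$$ (with $0\log0=0$), and $$\widehat{L}_f=\left(\frac{e^{-h(f)}}{\int f}\right)^{1/d}\bigl(\det\mathrm{Cov}(f)\bigr)^{1/(2d)}.$$ *)

(* Defs.v *)
From HB Require Import structures.
From mathcomp Require Import all_boot all_order all_algebra.
From mathcomp Require Import all_classical all_reals all_analysis.

Set Implicit Arguments.
Unset Strict Implicit.
Unset Printing Implicit Defensive.

Import Order.TTheory GRing.Theory Num.Theory.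
Import numFieldNormedType.Exports.

Local Open Scope classical_set_scope.
Local Open Scope ring_scope.

Definition row_display : measure_display.
Proof. exact: default_measure_display. Qed.

(* R^n is 'rV[R]_n. Its base sigma-algebra is generated by the coordinates,
   i.e. it is the Borel sigma-algebra. *)
Section measurable_row.
Context {R : realType}.
Variable n : nat.

Definition coord_row (i : 'I_n) (x : 'rV[R]_n) : R := x 0 i.

Let row_set0 : g_sigma_preimage coord_row set0.
Proof. exact: sigma_algebra0. Qed.

Let row_setC A : g_sigma_preimage coord_row A ->
  g_sigma_preimage coord_row (~` A).
Proof. exact: sigma_algebraC. Qed.

Let row_bigcup (F : _^nat) : (forall i, g_sigma_preimage coord_row (F i)) ->
  g_sigma_preimage coord_row (\bigcup_i (F i)).
Proof. exact: sigma_algebra_bigcup. Qed.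

HB.instance Definition _ := @isMeasurable.Build row_display
  'rV[R]_n (g_sigma_preimage coord_row) row_set0 row_setC row_bigcup.

Lemma measurable_coord_row (i : 'I_n) : measurable_fun setT (coord_row i).
Proof.
move=> _ Y mY; rewrite setTI; apply: sub_sigma_algebra => /=.
rewrite -bigcup_seq/=; exists i => /=; first by rewrite mem_index_enum.
by exists Y => //; rewrite setTI.
Qed.

Lemma measurable_fun_rowP d (T : measurableType d) (f : T -> 'rV[R]_n) :
  (forall i, measurable_fun setT (coord_row i \o f)) -> measurable_fun setT f.
Proof.
move=> mf.
have h : g_sigma_preimage (fun i => coord_row i \o f) `<=` measurable.
  apply: smallest_sub; first exact: sigma_algebra_measurable.
  rewrite -bigcup_seq; apply: bigcup_sub => i _ A [B mB <-].
  exact: mf.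
by move=> _ A mA; apply: h; rewrite g_sigma_preimage_comp; exists A.
Qed.

End measurable_row.

Section lebesgue_row.
Context {R : realType}.

Definition cons_row n (xv : R * 'rV[R]_n) : 'rV[R]_n.+1 :=
  row_mx (const_mx xv.1 : 'rV[R]_1) xv.2.

Definition uncons_row n (v : 'rV[R]_n.+1) : R * 'rV[R]_n :=
  (v 0 ord0, @rsubmx R 1 1 n v).

Lemma cons_rowK n : cancel (@cons_row n) (@uncons_row n).
Proof.
move=> [x v]; rewrite /uncons_row/cons_row/= row_mxKr; congr pair.
have e : ord0 = lshift n (ord0 : 'I_1) :> 'I_(1 + n) by exact: val_inj.
by rewrite -[LHS]/(row_mx (const_mx x : 'rV_1) v 0 (ord0 : 'I_(1 + n))) e
  row_mxEl mxE.
Qed.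

Lemma uncons_rowK n : cancel (@uncons_row n) (@cons_row n).
Proof.
move=> v; have e : const_mx (v 0 ord0) = @lsubmx R 1 1 n v.
  by apply/rowP => i; rewrite !mxE (ord1 i); congr (v _ _); exact: val_inj.
by rewrite /cons_row/uncons_row/= e; exact: (@hsubmxK _ 1 1 n).
Qed.

Lemma measurable_cons_row n : measurable_fun setT (@cons_row n).
Proof.
apply: measurable_fun_rowP => i; have [j ->|j ->] := split_ordP (i : 'I_(1 + n)).
  rewrite (_ : _ \o _ = fst); first exact: measurable_fst.
  by apply/funext => -[x v] /=; rewrite [LHS]row_mxEl mxE.
rewrite (_ : _ \o _ = coord_row j \o snd).
  by apply: measurableT_comp => //; exact: measurable_coord_row.
by apply/funext => -[x v] /=; exact: row_mxEr.
Qed.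

Lemma measurable_uncons_row n : measurable_fun setT (@uncons_row n).
Proof.
apply/measurable_fun_pair => /=; first exact: measurable_coord_row.
apply: measurable_fun_rowP => i.
rewrite (_ : _ \o _ = coord_row (rshift 1 i : 'I_n.+1)).
  exact: measurable_coord_row.
by apply/funext => v; rewrite /coord_row/= mxE.
Qed.

Section lebesgue_cons.
Variables (n : nat) (mu : {sigma_finite_measure set 'rV[R]_n -> \bar R}).

Definition lebesgue_cons : set 'rV[R]_n.+1 -> \bar R :=
  pushforward (lebesgue_measure \x mu)%E (@cons_row n).

Let lebesgue_cons0 : lebesgue_cons set0 = 0%E.
Proof. by rewrite /lebesgue_cons /pushforward preimage_set0 measure0. Qed.

Let lebesgue_cons_ge0 A : (0 <= lebesgue_cons A)%E.
Proof. by rewrite /lebesgue_cons /pushforward measure_ge0. Qed.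

Let lebesgue_cons_sigma_additive : semi_sigma_additive lebesgue_cons.
Proof.
have mcons A : measurable A -> measurable (@cons_row n @^-1` A).
  by move=> mA; rewrite -[X in measurable X]setTI; exact: measurable_cons_row.
move=> F mF tF mUF; rewrite /lebesgue_cons /pushforward preimage_bigcup.
apply: measure_semi_sigma_additive.
- by move=> k; exact: mcons.
- apply/trivIsetP => /= i j _ _ ij; rewrite -preimage_setI.
  by move/trivIsetP : tF => /(_ _ _ _ _ ij) ->//; rewrite preimage_set0.
- by rewrite -preimage_bigcup; exact: mcons.
Qed.

HB.instance Definition _ := isMeasure.Build _ _ _ lebesgue_cons
  lebesgue_cons0 lebesgue_cons_ge0 lebesgue_cons_sigma_additive.

Let lebesgue_cons_sigma_finite : sigma_finite setT lebesgue_cons.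
Proof.
have /sigma_finiteP[F [TF ndF Foo]] := sigma_finiteT (@lebesgue_measure R).
have /sigma_finiteP[G [TG ndG Goo]] := sigma_finiteT mu.
have consK (A : set (R * 'rV[R]_n)) :
    @cons_row n @^-1` (@uncons_row n @^-1` A) = A.
  by rewrite -comp_preimage; apply/seteqP; split => xv /=; rewrite cons_rowK.
exists (fun k => @uncons_row n @^-1` (F k `*` G k)).
  rewrite -preimage_bigcup -[LHS](preimage_setT (@uncons_row n)).
  congr (_ @^-1` _); rewrite -setXTT TF TG predeqE => -[x y]; split.
    move=> [/= [i _ Fix] [j _ Gjy]]; exists (maxn i j) => //; split.
    - by move: x Fix; exact/subsetPset/ndF/leq_maxl.
    - by move: y Gjy; exact/subsetPset/ndG/leq_maxr.
  by move=> [i _ []/= ? ?]; split; exists i.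
move=> k; have [mF Fk] := Foo k; have [mG Gk] := Goo k; split.
  rewrite -[X in measurable X]setTI; apply: measurable_uncons_row => //.
  exact: measurableX.
rewrite /lebesgue_cons /pushforward consK product_measure1E//.
by rewrite lte_mul_pinfty// ge0_fin_numE.
Qed.

HB.instance Definition _ := Measure_isSigmaFinite.Build _ _ _ lebesgue_cons
  lebesgue_cons_sigma_finite.

End lebesgue_cons.

Fixpoint borel_lebesgue n : {sigma_finite_measure set 'rV[R]_n -> \bar R} :=
  match n with
  | 0 => \d_(0 : 'rV[R]_0)
  | m.+1 => lebesgue_cons (borel_lebesgue m)
  end.

(* Lebesgue measure on R^n, on the sigma-algebra of Lebesgue-measurable sets. *)
Definition lebesgue n := @completed_measure_extension _ _ _ (borel_lebesgue n).

HB.instance Definition _ n := Measure.on (@lebesgue n).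

End lebesgue_row.
Arguments borel_lebesgue : clear implicits.
Arguments lebesgue : clear implicits.

Section isotropic_constants.
Context {R : realType}.

Definition mxintegral d (D : set 'rV[R]_d) p q (F : 'rV[R]_d -> 'M[R]_(p, q)) :
  'M[R]_(p, q) := \matrix_(i, j) (\int[lebesgue R d]_(x in D) F x i j).

Definition vol d (K : set 'rV[R]_d) : R := fine (lebesgue R d K).

Definition convex_body d (K : set 'rV[R]_d) : Prop :=
  [/\ compact K, convex_set K & K° !=set0].

(* Points are row vectors, so that x x^T is written x^T *m x. *)
Definition bar_body d (K : set 'rV[R]_d) : 'rV[R]_d :=
  (vol K)^-1 *: mxintegral K id.

Definition Cov_body d (K : set 'rV[R]_d) : 'M[R]_d :=
  (vol K)^-1 *: mxintegral K (fun x => x^T *m x) -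
  (bar_body K)^T *m bar_body K.

Definition L_body d (K : set 'rV[R]_d) : R :=
  (\det (Cov_body K)) `^ (2 * d%:R)^-1 / (vol K) `^ (d%:R)^-1.

(* The supremum norm is the library norm on 'rV[R]_d, hence the explicit
   Euclidean distance. *)
Definition euclidean_dist d (x y : 'rV[R]_d) : R :=
  Num.sqrt (\sum_(i < d) (x 0 i - y 0 i) ^+ 2).

Definition simplex d (v : 'I_d.+1 -> 'rV[R]_d) : set 'rV[R]_d :=
  [set x | exists t : 'I_d.+1 -> R,
    [/\ forall i, 0 <= t i, \sum_i t i = 1 & x = \sum_i t i *: v i]].

Definition regular_simplex d (S : set 'rV[R]_d) : Prop :=
  exists v : 'I_d.+1 -> 'rV[R]_d, S = simplex v /\
    exists2 l : R, 0 < l & forall i j, i != j -> euclidean_dist (v i) (v j) = l.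

Definition convex_ereal d (phi : 'rV[R]_d -> \bar R) : Prop :=
  forall (x y : 'rV[R]_d) (t : R), 0 <= t <= 1 ->
    (phi (t *: x + (1 - t) *: y)%R <= t%:E * phi x + (1 - t)%:E * phi y)%E.

Definition log_concave d (f : 'rV[R]_d -> R) : Prop :=
  exists phi : 'rV[R]_d -> \bar R,
    [/\ forall x, (-oo < phi x)%E, convex_ereal phi &
        forall x, (f x)%:E = expeR (- phi x)%E].

Definition integral_fun d (f : 'rV[R]_d -> R) : R := \int[lebesgue R d]_x f x.

Definition integrable_log_concave d (f : 'rV[R]_d -> R) : Prop :=
  [/\ log_concave f, (lebesgue R d).-integrable setT (EFin \o f) &
      0 < integral_fun f].

Definition bar_fun d (f : 'rV[R]_d -> R) : 'rV[R]_d :=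
  (integral_fun f)^-1 *: mxintegral setT (fun x => f x *: x).

Definition Cov_fun d (f : 'rV[R]_d -> R) : 'M[R]_d :=
  (integral_fun f)^-1 *: mxintegral setT (fun x => f x *: (x^T *m x)) -
  (bar_fun f)^T *m bar_fun f.

(* 0 log 0 = 0 holds since ln 0 = 0. *)
Definition entropy d (f : 'rV[R]_d -> R) : R :=
  - (\int[lebesgue R d]_x (f x * ln (f x))) / integral_fun f.

Definition Lhat d (f : 'rV[R]_d -> R) : R :=
  (expR (- entropy f) / integral_fun f) `^ (d%:R)^-1 *
  (\det (Cov_fun f)) `^ (2 * d%:R)^-1.

Definition f0 d (x : 'rV[R]_d) : R :=
  expR (- \sum_(i < d) x 0 i) * \1_[set y : 'rV[R]_d | forall i, -1 <= y 0 i] x.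

End isotropic_constants.

(* Main.v *)
(* (i) Put over every point [x] with [f x > e^-m] the fibre [(1 + ln (f x) / m) T], where [T] is a
   simplex of dimension [m] with barycenter 0. This gives a convex set in dimension [n + m] whose
   moments factor into those of [T] and those of the powers of [1 + ln f / m], because the fibres are
   homothetic and centred. Since [(1 + ln f / m) ^ m] tends to [f], and its perturbation in the
   [m + 2]-nd power produces the factor [e^(2 \int f ln f / \int f)], the inequality for the closure
   of this set tends, as [m] grows, to the functional inequality for [f].
   (ii) Apply the functional inequality to [e^-s] restricted to the cone of the points [(s, x)]
   with [s > 0] and [x] in [s K]. *)
Require Import Defs.
From mathcomp Require Import all_boot all_order all_algebra.
From mathcomp Require Import all_classical all_reals all_analysis.
From mathcomp Require Import measurable_realfun.
From mathcomp Require Import ring lra zify.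

Set Implicit Arguments.
Unset Strict Implicit.
Unset Printing Implicit Defensive.

Import Order.TTheory GRing.Theory Num.Theory.
Import numFieldNormedType.Exports.

Local Open Scope classical_set_scope.
Local Open Scope ring_scope.

(** In dimension [d] the [2 d]-th power of either constant is [\det M / M 0 0 ^+ d.+3], times
    [e^(-2 h(f))] for a density [f], where [M] collects the moments of [(1, x)]. This ratio is
    affine invariant, so all nondegenerate simplices share one value, and both constructions become
    block determinants. The constant [e^-1] in (i) arises because passing from dimension [m] to
    [n + m] multiplies the ratio of the simplex by at most [e^(-2 n (m + 1) / (m + 3))], which tends
    to [e^(-2 n)]. In (ii) there is no limit: the entropy of the cone density is [n + 1], which
    cancels the constant exactly. Two obstacles shape (i). A log-concave function is only Lebesgue
    measurable, while Tonelli is applied to Borel functions; it is replaced by a Borel function that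
    equals it off the boundaries of countably many convex superlevel sets, and such boundaries are
    null. The limit also needs a majorant: comparison with midpoints yields exponential decay, hence
    a finite integral of [f (1 + |ln f|)^3] against a quadratic weight, and every error is at most a
    constant times this integral divided by [m]. *)

(** * Changes of variables, from nonnegative to signed functions *)

Section transport.
Context d1 d2 (X : measurableType d1) (Y : measurableType d2) (R : realType).
Variables (m1 : {measure set X -> \bar R}) (m2 : {measure set Y -> \bar R}).
Variables (T : X -> Y) (c : R).
Hypotheses (mT : measurable_fun setT T) (c0 : 0 < c).
Hypothesis ge0_transport : forall F : Y -> \bar R, measurable_fun setT F ->
  (forall y, 0 <= F y)%E ->
  (c%:E * \int[m1]_x F (T x) = \int[m2]_y F y)%E.

(** Tonelli gives a change of variables for nonnegative functions; this section extends it to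
    integrable ones. It serves three maps: the identity from the completed to the Borel
    sigma-algebra, invertible affine maps with [c] the absolute value of the determinant, and
    [row_mx] on a product. *)
Lemma transport_integrable (F : Y -> R) : measurable_fun setT F ->
  m2.-integrable setT (EFin \o F) <-> m1.-integrable setT (EFin \o (F \o T)).
Proof.
move=> mF.
have mFT : measurable_fun setT (F \o T) by exact: measurableT_comp.
have H : (c%:E * \int[m1]_x `|(F (T x))%:E| = \int[m2]_y `|(F y)%:E|)%E.
  apply: (@ge0_transport (fun y => `|(F y)%:E|%E)) => //.
  by apply: measurableT_comp => //; apply/measurable_EFinP.
split=> /integrableP[_ lt]; apply/integrableP; split.
- exact/measurable_EFinP.
- rewrite ltNge leye_eq; apply/negP => /eqP e.
  by move: lt; rewrite -H /= e gt0_muley ?lte_fin.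
- exact/measurable_EFinP.
- by rewrite -H lte_mul_pinfty// ?lee_fin ?ltW.
Qed.

Lemma transport_integral (F : Y -> R) : measurable_fun setT F ->
  m2.-integrable setT (EFin \o F) ->
  c * (\int[m1]_x F (T x)) = \int[m2]_y F y.
Proof.
move=> mF iF; have iFT := (transport_integrable mF).1 iF.
rewrite /Rintegral.
have mE : measurable_fun setT (EFin \o F) by exact/measurable_EFinP.
rewrite [in RHS]integralE [in LHS]integralE.
rewrite -(ge0_transport (F := (EFin \o F)^\+%E))//; last exact/measurable_funepos.
rewrite -(ge0_transport (F := (EFin \o F)^\-%E))//; last exact/measurable_funeneg.
have := integrable_pos_fin_num measurableT iFT.
have := integrable_neg_fin_num measurableT iFT.
move=> f1 f2.
rewrite -[LHS]/(fine c%:E * _) -fineM//; last by rewrite fin_numB f1 f2.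
rewrite muleBr; [|by []|by rewrite fin_num_adde_defl// fin_numN].
congr (fine (_ * _ - _ * _)%E); apply: eq_integral => x _.
  by rewrite !funeposE.
by rewrite !funenegE.
Qed.

End transport.

(** * Lebesgue measure on row vectors *)

Section row_measure.
Context {R : realType}.
Local Notation mu := (borel_lebesgue R).

Lemma borel_sub_lebesgue n (A : set 'rV[R]_n) : measurable A ->
  measurable (A : set (caratheodory_type ((mu n)^*)%mu)).
Proof.
by move=> mA; apply: sub_caratheodory; apply: sub_sigma_algebra; exact: mA.
Qed.

Lemma lebesgueE n (A : set 'rV[R]_n) : measurable A -> lebesgue R n A = mu n A.
Proof.
by move=> mA; rewrite /lebesgue /completed_measure_extension /= measurable_mu_extE.
Qed.

(** The identity is measurable from the completed sigma-algebra to the Borel one and carries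
    [lebesgue] to [borel_lebesgue], so a Borel integrand does not see the completion. *)
Lemma ge0_integral_lebesgue n (F : 'rV[R]_n -> \bar R) : measurable_fun setT F ->
  (forall x, 0 <= F x)%E -> (\int[lebesgue R n]_x F x = \int[mu n]_x F x)%E.
Proof.
move=> mF F0.
have mid : measurable_fun setT
    (id : caratheodory_type ((mu n)^*)%mu -> 'rV[R]_n).
  by move=> _ A mA; rewrite setTI; exact: borel_sub_lebesgue.
have := @ge0_integral_pushforward _ _ _ _ R _ mid (lebesgue R n) setT F
  measurableT mF (fun x _ => F0 x).
rewrite preimage_setT => /esym h; rewrite [LHS]h.
by apply: eq_measure_integral => A mA _; exact: lebesgueE.
Qed.

Lemma ge0_integral_row1 n (F : 'rV[R]_n.+1 -> \bar R) : measurable_fun setT F ->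
  (forall x, 0 <= F x)%E ->
  (\int[mu n.+1]_x F x =
   \int[@lebesgue_measure R]_s \int[mu n]_v F (cons_row (s, v)))%E.
Proof.
move=> mF F0.
have mFc : measurable_fun setT (F \o @cons_row R n).
  by apply: measurableT_comp => //; exact: measurable_cons_row.
rewrite -[LHS]/(\int[pushforward _ _]_x _)%E.
rewrite [LHS]ge0_integral_pushforward//; last exact: measurable_cons_row.
rewrite preimage_setT.
apply: (@fubini_tonelli1 _ _ _ _ _ (@lebesgue_measure R) (mu n) (F \o @cons_row R n)) => //.
by move=> x; exact: F0.
Qed.

Lemma ge0_integral_row2 n (F : 'rV[R]_n.+1 -> \bar R) : measurable_fun setT F ->
  (forall x, 0 <= F x)%E ->
  (\int[mu n.+1]_x F x =
   \int[mu n]_v \int[@lebesgue_measure R]_s F (cons_row (s, v)))%E.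
Proof.
move=> mF F0; rewrite ge0_integral_row1//.
apply: (@fubini_tonelli _ _ _ _ _ (@lebesgue_measure R) (mu n) (F \o @cons_row R n)) => //; last by move=> x; exact: F0.
by apply: measurableT_comp => //; exact: measurable_cons_row.
Qed.


(** The rescaled image of Lebesgue measure agrees with it on half-open intervals, which determine
    it. For [a < 0] the preimage of []x, y]] is closed at the other end, which leaves its length
    unchanged. *)
Lemma ge0_integral_affine1 (F : R -> \bar R) (a b : R) : a != 0 ->
  measurable_fun setT F -> (forall x, 0 <= F x)%E ->
  (`|a|%:E * \int[@lebesgue_measure R]_x F (a * x + b)%R =
   \int[@lebesgue_measure R]_x F x)%E.
Proof.
move=> a0 mF F0.
have mT : measurable_fun setT (fun x : R => a * x + b).
  by apply: measurable_funD => //; exact: measurable_funM.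
have mTM : measurable_fun setT (fun x : measurableTypeR R => a * x + b : measurableTypeR R).
  exact: mT.
pose k : {nonneg R} := NngNum (normr_ge0 a).
transitivity (\int[mscale k (@lebesgue_measure R)]_x F (a * x + b)%R)%E.
  by rewrite ge0_integral_mscale//=; exact: measurableT_comp.
transitivity (\int[pushforward (mscale k (@lebesgue_measure R)) 
   (fun x : measurableTypeR R => (a * x + b)%R : measurableTypeR R)]_x F x)%E.
  by rewrite ge0_integral_pushforward.
apply: eq_measure_integral => A mA _; apply/esym.
apply: lebesgue_measure_unique => //= _ [[x y]] _ <-.
rewrite /pushforward /mscale /=.
have [ap|an|a00] := ltgtP 0 a; last by rewrite -a00 eqxx in a0.
- have -> : (fun x0 : R => a * x0 + b) @^-1` `]x, y] = `](x - b) / a, (y - b) / a]%classic.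
    apply/seteqP; split => z /=; rewrite !in_itv/= ltr_pdivrMr// ler_pdivlMr//.
      by rewrite ltrBlDr lerBrDr mulrC.
    by rewrite ltrBlDr lerBrDr mulrC.
  rewrite !lebesgue_measure_itv/= !lte_fin ltr_pM2r ?invr_gt0// ltrD2r.
  case: ifPn => _; last by rewrite mule0.
  rewrite -!EFinD -EFinM; congr EFin.
  by rewrite gtr0_norm//; field.
- have -> : (fun x0 : R => a * x0 + b) @^-1` `]x, y] = `[(y - b) / a, (x - b) / a[%classic.
    apply/seteqP; split => z /=; rewrite !in_itv/= ltr_ndivlMr// ler_ndivrMr//.
      by rewrite ltrBlDr lerBrDr mulrC andbC.
    by rewrite ltrBlDr lerBrDr mulrC andbC.
  rewrite !lebesgue_measure_itv/= !lte_fin ltr_nM2r ?invr_lt0// ltrD2r.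
  case: ifPn => _; last by rewrite mule0.
  rewrite -!EFinD -EFinM; congr EFin.
  by rewrite ltr0_norm//; field.
Qed.

Lemma measurable_affine n p (A : 'M[R]_(n, p)) (b : 'rV[R]_p) :
  measurable_fun setT (fun x : 'rV[R]_n => x *m A + b).
Proof.
apply: measurable_fun_rowP => i.
rewrite (_ : _ \o _ = (fun x => \sum_j coord_row j x * A j i + b 0 i)); last first.
  by apply/funext => x /=; rewrite /coord_row !mxE.
apply: measurable_funD => //; apply: measurable_sum => j.
by apply: measurable_funM => //; exact: measurable_coord_row.
Qed.

Lemma measurable_mulmx n p (A : 'M[R]_(n, p)) :
  measurable_fun setT (fun x : 'rV[R]_n => x *m A).
Proof.
by have := measurable_affine A 0; under eq_fun do rewrite addr0.
Qed.

Lemma measurable_shift n (b : 'rV[R]_n) :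
  measurable_fun setT (fun x : 'rV[R]_n => x + b).
Proof.
by have := measurable_affine 1%:M b; under eq_fun do rewrite mulmx1.
Qed.

Lemma cons_rowE n (s : R) (v : 'rV[R]_n) :
  cons_row (s, v) = row_mx (s%:M : 'M[R]_1) v :> 'rV[R]_(1 + n).
Proof.
by rewrite /cons_row/=; congr row_mx; apply/rowP => i; rewrite !mxE (ord1 i) mulr1n.
Qed.

Lemma cons_rowD n (s t : R) (v w : 'rV[R]_n) :
  cons_row (s, v) + cons_row (t, w) = cons_row (s + t, v + w).
Proof.
rewrite !cons_rowE; apply: etrans (@add_row_mx R 1 1 n s%:M v t%:M w) _.
by rewrite -raddfD.
Qed.

Lemma measurable_cons_section n (F : 'rV[R]_n.+1 -> \bar R) s : measurable_fun setT F ->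
  measurable_fun setT (fun v => F (cons_row (s, v))).
Proof.
move=> mF; apply: (measurableT_comp mF).
by apply: (measurableT_comp (@measurable_cons_row R n)); exact: measurable_pair1.
Qed.

Lemma measurable_cons_section2 n (F : 'rV[R]_n.+1 -> \bar R) v : measurable_fun setT F ->
  measurable_fun setT (fun s => F (cons_row (s, v))).
Proof.
move=> mF; apply: (measurableT_comp mF).
by apply: (measurableT_comp (@measurable_cons_row R n)); exact: measurable_pair2.
Qed.

Lemma measurable_integral_row n (F : 'rV[R]_n.+1 -> \bar R) : measurable_fun setT F ->
  (forall x, 0 <= F x)%E ->
  measurable_fun setT (fun s => \int[mu n]_v F (cons_row (s, v)))%E.
Proof.
move=> mF F0; apply: (@measurable_fun_fubini_tonelli_F _ _ _ _ _ (mu n)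
  (F \o @cons_row R n)) => //; last by move=> x; exact: F0.
by apply: measurableT_comp => //; exact: measurable_cons_row.
Qed.

Lemma ge0_integral_shift n (F : 'rV[R]_n -> \bar R) (b : 'rV[R]_n) :
  measurable_fun setT F -> (forall x, 0 <= F x)%E ->
  (\int[mu n]_x F (x + b)%R = \int[mu n]_x F x)%E.
Proof.
elim: n F b => [|n IH] F b mF F0.
  by apply: eq_integral => x _; rewrite [b]thinmx0 addr0.
have mFb : measurable_fun setT (fun x : 'rV[R]_n.+1 => F (x + b)).
  by apply: (measurableT_comp mF); exact: measurable_shift.
rewrite !ge0_integral_row1//.
rewrite -[RHS](@ge0_integral_affine1 _ 1 (b 0 0) (oner_neq0 _))//; last 2 first.
- exact: measurable_integral_row.
- by move=> s; exact: integral_ge0.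
rewrite normr1 mul1e; apply: eq_integral => s _.
rewrite -[RHS](IH _ (@rsubmx R 1 1 n b))//; last exact: measurable_cons_section.
apply: eq_integral => v _; congr F.
by rewrite -[b in LHS]uncons_rowK cons_rowD mul1r.
Qed.

(** The change of variables for a single matrix, isolated as a property because it is stable under
    products. *)
Definition mx_scales n (A : 'M[R]_n) := forall F : 'rV[R]_n -> \bar R,
  measurable_fun setT F -> (forall x, 0 <= F x)%E ->
  (`|\det A|%:E * \int[mu n]_x F (x *m A) = \int[mu n]_x F x)%E.

Lemma mx_scalesM n (A B : 'M[R]_n) : mx_scales A -> mx_scales B ->
  mx_scales (A *m B).
Proof.
move=> sA sB F mF F0; rewrite -[RHS]sB// -[in RHS](sA (fun x => F (x *m B)))//; last first.
  by apply: (measurableT_comp mF); exact: measurable_mulmx.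
rewrite det_mulmx normrM EFinM -muleA muleCA.
by congr (_ * (_ * _))%E; apply: eq_integral => x _; rewrite mulmxA.
Qed.

(** With the first coordinate [s] outermost, the inner variable undergoes [D] and a shift by
    [s *: b], after which [s] is scaled by [a]. *)
Lemma mx_scales_upper n (a : R) (b : 'rV[R]_n) (D : 'M[R]_n) : a != 0 ->
  mx_scales D -> mx_scales (block_mx (a%:M : 'M[R]_1) b 0 D : 'M[R]_(1 + n)).
Proof.
move=> a0 sD F mF F0; rewrite det_ublock det_scalar1 normrM.
rewrite !(@ge0_integral_row1 n)//; last first.
  by apply: (measurableT_comp mF); exact: (@measurable_mulmx (1 + n) (1 + n)).
rewrite -[RHS](@ge0_integral_affine1 _ a 0 a0)//; last 2 first.
- exact: measurable_integral_row.
- by move=> s; exact: integral_ge0.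
rewrite EFinM -muleA; congr (_ * _)%E; rewrite -ge0_integralZl//; last 2 first.
- apply: (@measurable_integral_row n (fun x : 'rV[R]_(1 + n) => F (x *m _))) => //.
  by apply: (measurableT_comp mF); exact: (@measurable_mulmx (1 + n) (1 + n)).
- by move=> s _; exact: integral_ge0.
apply: eq_integral => s _; rewrite addr0.
have mFs : measurable_fun setT (fun v => F (cons_row (a * s, v))).
  exact: measurable_cons_section.
rewrite -[RHS](ge0_integral_shift (s *: b))// -[RHS]sD//; last first.
  by apply: (measurableT_comp mFs); exact: measurable_shift.
congr (_ * _)%E; apply: eq_integral => v _; congr F.
rewrite !cons_rowE mul_row_block mulmx0 addr0 -scalar_mxM mulrC; congr row_mx.
by rewrite mul_scalar_mx addrC.
Qed.

(** With the first coordinate innermost, the shear merely translates it by [v *m c], which is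
    constant in the inner integral. *)
Lemma mx_scales_lower n (c : 'cV[R]_n) :
  mx_scales (block_mx (1%:M : 'M[R]_1) 0 c 1%:M : 'M[R]_(1 + n)).
Proof.
move=> F mF F0; rewrite det_lblock !det1 mulr1 normr1 mul1e.
rewrite !(@ge0_integral_row2 n)//; last first.
  by apply: (measurableT_comp mF); exact: (@measurable_mulmx (1 + n) (1 + n)).
apply: eq_integral => v _.
rewrite -[RHS](@ge0_integral_affine1 _ 1 ((v *m c) 0 0) (oner_neq0 _))//; last first.
  exact: measurable_cons_section2.
rewrite normr1 mul1e; apply: eq_integral => s _; congr F.
rewrite !cons_rowE mul_row_block mulmx0 add0r !mulmx1 mul1r; congr row_mx.
by rewrite raddfD/= -mx11_scalar.
Qed.

Lemma mx_scales1 n : mx_scales (1%:M : 'M[R]_n).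
Proof.
move=> F mF F0; rewrite det1 normr1 mul1e.
by apply: eq_integral => x _; rewrite mulmx1.
Qed.

(* Gaussian elimination: a unit matrix with nonzero corner is the product of the
   two kinds of block-triangular matrices above, and a shear of the first kind
   makes the corner nonzero. *)
Lemma mx_scales_unit n (A : 'M[R]_n) : A \in unitmx -> mx_scales A.
Proof.
elim: n A => [|n IH] A uA.
  by rewrite [A]flatmx0 -(flatmx0 1%:M); exact: mx_scales1.
suff corner (B : 'M[R]_(1 + n)) : B 0 0 != 0 -> B \in unitmx -> mx_scales B.
  have [A0|A0] := eqVneq (A 0 0) 0; last exact: corner.
  have [i Ai] : exists i : 'I_n, A (rshift 1 i : 'I_(1 + n)) 0 != 0.
    apply/not_existsP => nA; move: uA; rewrite unitmxE unitfE.
    rewrite (expand_det_col _ 0) big1 ?eqxx// => j _.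
    have [k ->|k ->] := split_ordP (j : 'I_(1 + n)).
      rewrite (ord1 k) (_ : lshift n 0 = 0) ?A0 ?mul0r//; exact: val_inj.
    by have /negP := nA k; rewrite negbK => /eqP ->; rewrite mul0r.
  pose E (s : R) : 'M[R]_(1 + n) :=
    block_mx (1%:M : 'M[R]_1) (s *: delta_mx 0 i) 0 1%:M.
  have EE : E (-1) *m E 1 = 1%:M.
    rewrite mulmx_block !mulmx0 !mul0mx !mulmx1 !mul1mx !addr0 add0r scale1r.
    by rewrite scaleN1r subrr -scalar_mx_block.
  have sE : mx_scales (E (-1)).
    by apply: mx_scales_upper; [rewrite oner_eq0|exact: mx_scales1].
  have uE : E 1 \in unitmx.
    by case/mulmx1_unit: EE.
  rewrite -[A]mul1mx -EE -mulmxA; apply: mx_scalesM => //.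
  apply: corner; last by rewrite unitmx_mul uE.
  rewrite mxE.
  have -> : \sum_j E 1 0 j * A j 0 = A 0 0 + A (rshift 1 i : 'I_(1 + n)) 0.
    have := @big_split_ord R 0 +%R 1 n xpredT (fun j => E 1 0 j * A j 0).
    move=> /= ->; rewrite big_ord1 (bigD1 i)//= big1 ?addr0.
      have -> : (0 : 'I_(1 + n)) = lshift n 0 by exact: val_inj.
      rewrite /E scale1r [X in X * _ + _](@block_mxEul _ 1 n 1 n).
      rewrite [X in _ + X * _](@block_mxEur _ 1 n 1 n) !mxE !eqxx/=.
      by rewrite !mulr1n !mul1r.
    move=> j ji; have -> : (0 : 'I_(1 + n)) = lshift n 0 by exact: val_inj.
    by rewrite [X in X * _](@block_mxEur _ 1 n 1 n) scale1r !mxE eqxx (negbTE ji) mul0r.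
  by rewrite A0 add0r.
move=> B0 uB.
pose a := B 0 0.
pose b : 'rV[R]_n := ursubmx B; pose c : 'cV[R]_n := a^-1 *: dlsubmx B.
pose D : 'M[R]_n := drsubmx B - c *m b.
have BE : B = block_mx (1%:M : 'M[R]_1) 0 c 1%:M *m block_mx (a%:M : 'M[R]_1) b 0 D.
  rewrite mulmx_block !mul0mx !mulmx0 !mul1mx !addr0 mul_mx_scalar.
  rewrite /D addrCA subrr addr0 /c scalerA mulfV// scale1r -[LHS]submxK.
  congr block_mx; apply/matrixP => i j; rewrite (ord1 i) (ord1 j) !mxE mulr1n.
  by congr (B _ _); exact: val_inj.
rewrite BE; apply: mx_scalesM; first exact: mx_scales_lower.
apply: mx_scales_upper => //; apply: IH.
move: uB; rewrite BE unitmx_mul => /andP[_].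
by rewrite !unitmxE det_ublock unitrM => /andP[].
Qed.

Lemma ge0_integral_affine n (A : 'M[R]_n) (b : 'rV[R]_n) (F : 'rV[R]_n -> \bar R) :
  A \in unitmx -> measurable_fun setT F -> (forall x, 0 <= F x)%E ->
  (`|\det A|%:E * \int[mu n]_x F (x *m A + b)%R = \int[mu n]_x F x)%E.
Proof.
move=> uA mF F0; rewrite -[RHS](ge0_integral_shift b)//.
rewrite -[RHS](mx_scales_unit uA (F := fun x => F (x + b)))//.
by apply: (measurableT_comp mF); exact: measurable_shift.
Qed.

End row_measure.

(** * Gamma integrals *)

Section gamma.
Context {R : realType}.
Local Notation leb := (@lebesgue_measure R).

(** The antiderivative of [s ^+ k * expR (- s)] that repeated integration by parts produces; it
    vanishes at infinity. *)
Fixpoint gamma_primitive k (s : R) : R :=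
  if k is k'.+1 then k%:R * gamma_primitive k' s - s ^+ k * expR (- s)
  else - expR (- s).

Lemma is_derive_gamma_primitive k (s : R) :
  is_derive s 1 (gamma_primitive k) (s ^+ k * expR (- s)).
Proof.
have dN : is_derive s 1 (fun s : R => expR (- s)) (- expR (- s)).
  have := @is_derive1_comp R expR -%R s _ _ (is_derive_expR (- s)) (is_deriveNid s 1).
  by rewrite mulrN1.
elim: k => [|k IH].
  by apply: is_derive_eq; rewrite opprK expr0 mul1r.
have dX : is_derive s 1 (fun s : R => s ^+ k.+1) (k.+1%:R * s ^+ k).
  rewrite (_ : (fun s => _) = (id : R -> R) ^+ k.+1); last by rewrite exprfctE.
  by apply: is_derive_eq; rewrite /GRing.scale/= mulr1.
rewrite (_ : gamma_primitive k.+1 = (k.+1%:R *: gamma_primitive k) -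
   ((fun s : R => s ^+ k.+1) * (fun s : R => expR (- s)))); last first.
  by apply/funext => t.
apply: is_derive_eq.
rewrite /GRing.scale/=; ring.
Qed.

(** The exponential dominates the term of degree [k.+1] of its series, one power more than has to be
    beaten. *)
Lemma cvg_expr_expRN k : s ^+ k * expR (- s) @[s --> +oo%R] --> (0 : R).
Proof.
apply/cvgrPdist_le => /= e e0; near=> s.
have s0 : 0 < s by near: s; apply: nbhs_pinfty_gt; rewrite num_real.
rewrite sub0r normrN ger0_norm; last by rewrite mulr_ge0 ?expR_ge0// exprn_ge0 ?ltW.
rewrite expRN ler_pdivrMr ?expR_gt0//.
have f0 : 0 < k.+1`!%:R :> R by rewrite ltr0n fact_gt0.
apply: (@le_trans _ _ (e * (s ^+ k.+1 / k.+1`!%:R))); last first.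
  rewrite ler_pM2l// (le_trans _ (expR_ge1Dxn k (ltW s0)))//.
  by rewrite ler_wpDl.
have -> : e * (s ^+ k.+1 / k.+1`!%:R) = (s * e / k.+1`!%:R) * s ^+ k.
  by rewrite exprS; ring.
apply: ler_peMl; first by rewrite exprn_ge0 ?ltW.
rewrite ler_pdivlMr// mul1r -ler_pdivrMr//.
Unshelve. all: by end_near. Qed.

Lemma cvg_gamma_primitive k : gamma_primitive k s @[s --> +oo%R] --> (0 : R).
Proof.
elim: k => [|k IH].
  by rewrite -[0]oppr0; apply: cvgN; exact: cvgr_expR.
rewrite [X in _ --> X](_ : _ = k.+1%:R * 0 - 0); last by rewrite mulr0 subr0.
by apply: cvgB; [apply: cvgMr|exact: (cvg_expr_expRN k.+1)].
Qed.

Lemma gamma_primitive0 k : gamma_primitive k 0 = - k`!%:R.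
Proof.
elim: k => [|k IH] /=; first by rewrite oppr0 expR0.
by rewrite IH expr0n/= mul0r subr0 mulrN factS natrM.
Qed.

Lemma integral_gamma k (a : R) : 0 <= a ->
  (\int[leb]_(s in `[a, +oo[) (s ^+ k * expR (- s))%:E =
   (- gamma_primitive k a)%:E)%E.
Proof.
move=> a0.
have cF (s : R) : {for s, continuous (fun s : R => s ^+ k * expR (- s))}.
  apply: continuousM; first exact: exprn_continuous.
  apply: continuous_comp; first exact: opp_continuous.
  exact: continuous_expR.
have dF (s : R) : derivable (gamma_primitive k) s 1.
  by have [] := is_derive_gamma_primitive k s.
rewrite (@ge0_continuous_FTC2y R _ (gamma_primitive k) a 0) ?sub0e//.
- move=> s sa; rewrite mulr_ge0 ?expR_ge0// exprn_ge0//; exact: le_trans sa.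
- by apply: continuous_subspaceT => s; exact: cF.
- exact: cvg_gamma_primitive.
- by apply: cvg_at_right_filter; apply: differentiable_continuous; exact/derivable1_diffP.
- by move=> s _; rewrite derive1E; apply: derive_val; exact: is_derive_gamma_primitive.
Qed.

Lemma ge0_integral_indic (D : set R) (f : R -> R) : measurable D ->
  (\int[leb]_(s in D) (f s)%:E = \int[leb]_s (\1_D s * f s)%:E)%E.
Proof.
move=> mD; rewrite integral_mkcond; apply: eq_integral => s _.
by rewrite patchE indicE; case: ifPn => _; rewrite ?mul1r ?mul0r.
Qed.

Lemma integral_gamma_c k :
  (\int[leb]_s (\1_(`[0, +oo[%classic) s * (s ^+ k * expR (- s)))%:E = (k`!%:R)%:E)%E.
Proof.
by rewrite -ge0_integral_indic// integral_gamma// gamma_primitive0 opprK.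
Qed.

Lemma integral_gamma_o k :
  (\int[leb]_s (\1_(`]0, +oo[%classic) s * (s ^+ k * expR (- s)))%:E = (k`!%:R)%:E)%E.
Proof.
rewrite -ge0_integral_indic// integral_itv_obnd_cbnd ?integral_gamma//.
  by rewrite gamma_primitive0 opprK.
apply/measurable_funTS/measurable_EFinP; apply: measurable_funM => //.
by apply: measurableT_comp.
Qed.

(** In Dirichlet's integral [t] is the coordinate sum of a point, that is, the least height at which
    the scaled simplex contains the point. *)
Lemma integral_expRN_ge (t : R) : 0 <= t ->
  (\int[leb]_s (\1_(`]0, +oo[%classic) s * (\1_(`[t, +oo[%classic) s * expR (- s)))%:E = (expR (- t))%:E)%E.
Proof.
move=> t0; have := @integral_gamma 0 t t0; rewrite /= opprK => <-.
rewrite -ge0_integral_indic// integral_itv_obnd_cbnd; last first.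
  apply/measurable_funTS/measurable_EFinP; apply: measurable_funM => //.
  by apply: measurableT_comp.
rewrite ge0_integral_indic// [RHS]ge0_integral_indic//; apply: eq_integral => s _.
rewrite expr0 mul1r !indicE !mem_setE !in_itv/= !andbT.
case: (leP t s) => ts; rewrite ?mul0r ?mulr0// (le_trans t0 ts) !mul1r//.
Qed.

End gamma.

Section lebesgue_transport.
Context {R : realType}.
Local Notation mu := (borel_lebesgue R).

Lemma measurable_fun_lebesgue n d (T : measurableType d) (F : 'rV[R]_n -> T) :
  measurable_fun setT F ->
  measurable_fun setT (F : caratheodory_type ((mu n)^*)%mu -> T).
Proof.
move=> mF _ A mA; rewrite setTI; apply: borel_sub_lebesgue.
by rewrite -[X in measurable X]setTI; exact: mF.
Qed.

Lemma measurable_id_lebesgue n : measurable_fun setT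
    (id : caratheodory_type ((mu n)^*)%mu -> 'rV[R]_n).
Proof. exact: (measurable_fun_lebesgue (F := id)). Qed.

Lemma integrable_lebesgue n (F : 'rV[R]_n -> R) : measurable_fun setT F ->
  (mu n).-integrable setT (EFin \o F) <->
  (lebesgue R n).-integrable setT (EFin \o F).
Proof.
move=> mF; apply: (@transport_integrable _ _ _ _ R (lebesgue R n) (mu n) id 1);
  [exact: measurable_id_lebesgue|exact: ltr01| |exact: mF].
by move=> G mG G0; rewrite mul1e ge0_integral_lebesgue.
Qed.

Lemma Rintegral_lebesgue n (F : 'rV[R]_n -> R) : measurable_fun setT F ->
  (mu n).-integrable setT (EFin \o F) ->
  \int[lebesgue R n]_x F x = \int[mu n]_x F x.
Proof.
move=> mF iF; rewrite -[LHS]mul1r.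
apply: (@transport_integral _ _ _ _ R (lebesgue R n) (mu n) id 1);
  [exact: measurable_id_lebesgue|exact: ltr01| |exact: mF|exact: iF].
by move=> G mG G0; rewrite mul1e ge0_integral_lebesgue.
Qed.

Lemma affine_integrable n (A : 'M[R]_n) (b : 'rV[R]_n) (F : 'rV[R]_n -> R) :
  A \in unitmx -> measurable_fun setT F ->
  (mu n).-integrable setT (EFin \o F) <->
  (mu n).-integrable setT (EFin \o (fun x => F (x *m A + b))).
Proof.
move=> uA mF; apply: (@transport_integrable _ _ _ _ R (mu n) (mu n)
  (fun x => x *m A + b) `|\det A|) => //.
- exact: measurable_affine.
- by rewrite normr_gt0 -unitfE -unitmxE.
- by move=> G mG G0; rewrite ge0_integral_affine.
Qed.

Lemma affine_integral n (A : 'M[R]_n) (b : 'rV[R]_n) (F : 'rV[R]_n -> R) :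
  A \in unitmx -> measurable_fun setT F ->
  (mu n).-integrable setT (EFin \o F) ->
  `|\det A| * \int[mu n]_x F (x *m A + b) = \int[mu n]_x F x.
Proof.
move=> uA mF iF; apply: (@transport_integral _ _ _ _ R (mu n) (mu n)
  (fun x => x *m A + b) `|\det A|) => //.
- exact: measurable_affine.
- by rewrite normr_gt0 -unitfE -unitmxE.
- by move=> G mG G0; rewrite ge0_integral_affine.
Qed.

Lemma ge0_integral_scale n (F : 'rV[R]_n -> \bar R) (c : R) : 0 < c ->
  measurable_fun setT F -> (forall x, 0 <= F x)%E ->
  ((c ^+ n)%:E * \int[mu n]_x F (c *: x)%R = \int[mu n]_x F x)%E.
Proof.
move=> c0 mF F0; have uc : (c%:M : 'M[R]_n) \in unitmx.
  by rewrite unitmxE det_scalar unitrX// unitfE gt_eqF.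
rewrite -[RHS](ge0_integral_affine 0 uc)// det_scalar ger0_norm ?exprn_ge0 ?ltW//.
by congr (_ * _)%E; apply: eq_integral => x _; rewrite addr0 mul_mx_scalar.
Qed.

Lemma measurable_row_mx n m :
  measurable_fun setT (fun z : 'rV[R]_n * 'rV[R]_m => row_mx z.1 z.2).
Proof.
apply: measurable_fun_rowP => i; have [j ->|j ->] := split_ordP i.
  rewrite (_ : _ \o _ = coord_row j \o fst).
    by apply: measurableT_comp => //; exact: measurable_coord_row.
  by apply/funext => -[x y]; exact: row_mxEl.
rewrite (_ : _ \o _ = coord_row j \o snd).
  by apply: measurableT_comp => //; exact: measurable_coord_row.
by apply/funext => -[x y]; exact: row_mxEr.
Qed.

Lemma cons_row0 n (s : R) (v : 'rV[R]_n) : cons_row (s, v) 0 0 = s.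
Proof. by have /= [] := congr1 (fun p => p.1) (cons_rowK (s, v)). Qed.

Lemma cons_rowS n (s : R) (v : 'rV[R]_n) i : cons_row (s, v) 0 (lift ord0 i) = v 0 i.
Proof.
rewrite (_ : lift ord0 i = rshift 1 i); last exact: val_inj.
exact: (@row_mxEr R 1 1 n).
Qed.

Lemma cons_row_mx n m (s : R) (x : 'rV[R]_n) (y : 'rV[R]_m) :
  cons_row (s, row_mx x y) = row_mx (cons_row (s, x)) y :> 'rV[R]_(n.+1 + m).
Proof.
apply/rowP => i; have [j ->|j ->] := split_ordP i.
  rewrite [RHS]row_mxEl; have [k ->|->] := unliftP 0 j.
    rewrite (_ : lshift m (lift 0 k) = lift 0 (lshift m k)); last exact: val_inj.
    by rewrite !cons_rowS row_mxEl.
  by rewrite (_ : lshift m 0 = 0) ?cons_row0//; exact: val_inj.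
rewrite [RHS]row_mxEr (_ : rshift n.+1 j = lift 0 (rshift n j)); last exact: val_inj.
by rewrite cons_rowS row_mxEr.
Qed.

Lemma ge0_integral_row_mx n m (F : 'rV[R]_(n + m) -> \bar R) :
  measurable_fun setT F -> (forall x, 0 <= F x)%E ->
  (\int[mu (n + m)]_z F z = \int[mu n]_x \int[mu m]_y F (row_mx x y))%E.
Proof.
elim: n F => [|n IH] F mF F0.
  rewrite [RHS](@integral_dirac _ _ (0 : 'rV[R]_0))//; last first.
    apply: (@measurable_fun_fubini_tonelli_F _ _ _ _ _ (mu m)
      (fun z => F (row_mx z.1 z.2))) => //.
    by apply: (measurableT_comp mF); exact: measurable_row_mx.
  rewrite diracT mul1e; apply: eq_integral => y _; congr F.
  apply/rowP => i; rewrite (_ : i = rshift 0 i) ?row_mxEr; last exact: val_inj.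
  by congr (y _ _); exact: val_inj.
rewrite (@ge0_integral_row1 _ (n + m)%N)//.
rewrite ge0_integral_row1//; last 2 first.
- apply: (@measurable_fun_fubini_tonelli_F _ _ _ _ _ (mu m)
    (fun z => F (row_mx z.1 z.2))) => //.
  by apply: (measurableT_comp mF); exact: measurable_row_mx.
- by move=> x; exact: integral_ge0.
apply: eq_integral => s _; rewrite IH//; last exact: (@measurable_cons_section _ (n + m)).
apply: eq_integral => x _; apply: eq_integral => y _.
by rewrite cons_row_mx.
Qed.

Lemma Rintegral_row_mx n m (F : 'rV[R]_(n + m) -> R) (G : 'rV[R]_n -> R) :
  measurable_fun setT F -> (mu (n + m)).-integrable setT (EFin \o F) ->
  (forall x, (\int[mu m]_y (F (row_mx x y))%:E = (G x)%:E)%E) ->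
  \int[mu (n + m)]_z F z = \int[mu n]_x G x.
Proof.
move=> mF iF FG.
have tr (H : 'rV[R]_(n + m) -> \bar R) : measurable_fun setT H ->
    (forall z, 0 <= H z)%E ->
    (1%:E * \int[(mu n \x mu m)%E]_z H (row_mx z.1 z.2) = \int[mu (n + m)]_z H z)%E.
  move=> mH H0; rewrite mul1e ge0_integral_row_mx//.
  apply: (@fubini_tonelli1 _ _ _ _ _ (mu n) (mu m) (fun z => H (row_mx z.1 z.2))).
    by apply: (measurableT_comp mH); exact: measurable_row_mx.
  by move=> z; exact: H0.
rewrite -(transport_integral (@measurable_row_mx n m) ltr01 tr mF iF) mul1r.
congr fine; rewrite -integral12_prod_meas1.
  by apply: eq_integral => x _; exact: FG.
exact: (transport_integrable (@measurable_row_mx n m) ltr01 tr mF).1 iF.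
Qed.

Lemma rsubmx_cons_row n (s : R) (v : 'rV[R]_n) : @rsubmx R 1 1 n (cons_row (s, v)) = v.
Proof. exact: (congr1 (fun p => p.2) (cons_rowK (s, v))). Qed.

Lemma ge0_integral_prod n (u : 'I_n -> R -> R) :
  (forall i, measurable_fun setT (u i)) -> (forall i s, 0 <= u i s) ->
  (\int[mu n]_x (\prod_i u i (x 0 i))%:E =
   \big[mule/1]_i \int[@lebesgue_measure R]_s (u i s)%:E)%E.
Proof.
have mp k (v : 'I_k -> R -> R) : (forall i, measurable_fun setT (v i)) ->
    measurable_fun setT (fun x : 'rV[R]_k => (\prod_i v i (x 0 i))%:E).
  move=> mv; apply/measurable_EFinP; apply: measurable_prod => i _.
  by apply: measurableT_comp => //; exact: measurable_coord_row.
elim: n u => [|n IH] u mu0 u0.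
  rewrite big_ord0 [LHS](@integral_dirac _ _ (0 : 'rV[R]_0))//; last exact: mp.
  by rewrite diracT mul1e big_ord0.
rewrite ge0_integral_row1//; [|exact: mp|by move=> x; rewrite lee_fin prodr_ge0].
rewrite big_ord_recl -(IH (fun i => u (lift ord0 i)))//.
rewrite -ge0_integralZr//; last 3 first.
- by apply/measurable_EFinP; exact: mu0.
- by move=> s _; rewrite lee_fin.
- by apply: integral_ge0 => x _; rewrite lee_fin prodr_ge0.
apply: eq_integral => s _.
under eq_integral => v _.
  rewrite big_ord_recl cons_row0 EFinM.
  under eq_bigr do rewrite cons_rowS.
  over.
rewrite ge0_integralZl ?lee_fin//; first exact: (mp n (fun i => u (lift ord0 i))).
by move=> x _; rewrite lee_fin prodr_ge0.
Qed.

End lebesgue_transport.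

Section has_integral.
Context d (X : measurableType d) (R : realType).
Variable m : {measure set X -> \bar R}.

(** Integrability and value are kept together, so that linear combinations of integrals can be
    evaluated without separate integrability conditions. *)
Definition has_integral (F : X -> R) (v : R) :=
  m.-integrable setT (EFin \o F) /\ \int[m]_x F x = v.

Lemma has_integral_measurable (F : X -> R) v : has_integral F v ->
  measurable_fun setT F.
Proof. by case=> /measurable_int /measurable_EFinP. Qed.

Lemma has_integral_ereal (F : X -> R) v : has_integral F v ->
  (\int[m]_x (F x)%:E = v%:E)%E.
Proof. by case=> iF <-; rewrite fineK// integrable_fin_num. Qed.

Lemma has_integralD (F G : X -> R) u v : has_integral F u -> has_integral G v ->
  has_integral (fun x => F x + G x) (u + v).
Proof.
move=> [iF <-] [iG <-]; split; last by rewrite RintegralD.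
exact: (integrableD measurableT iF iG).
Qed.

Lemma has_integralZ (F : X -> R) c v : has_integral F v ->
  has_integral (fun x => c * F x) (c * v).
Proof.
move=> [iF <-]; split; last by rewrite RintegralZl.
exact: (integrableZl measurableT c iF).
Qed.

Lemma has_integralB (F G : X -> R) u v : has_integral F u -> has_integral G v ->
  has_integral (fun x => F x - G x) (u - v).
Proof.
move=> hF /(has_integralZ (-1)) hG; have := has_integralD hF hG.
by rewrite mulN1r; under eq_fun do rewrite mulN1r.
Qed.

Lemma has_integral0 : has_integral (fun=> 0) 0.
Proof.
split; first exact: integrable0.
by rewrite /Rintegral integral0.
Qed.

Lemma has_integral_sum (I : Type) (r : seq I) (F : I -> X -> R) v :
  (forall i, has_integral (F i) (v i)) ->
  has_integral (fun x => \sum_(i <- r) F i x) (\sum_(i <- r) v i).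
Proof.
move=> hF; elim: r => [|i r IH].
  under eq_fun do rewrite big_nil; rewrite big_nil; exact: has_integral0.
under eq_fun do rewrite big_cons; rewrite big_cons.
exact: has_integralD.
Qed.

Lemma has_integral_ge0 (F : X -> R) v : has_integral F v ->
  (forall x, 0 <= F x) -> 0 <= v.
Proof. by move=> [iF <-] F0; exact: Rintegral_ge0. Qed.

Lemma ge0_has_integral (F : X -> R) v : measurable_fun setT F ->
  (forall x, 0 <= F x) -> (\int[m]_x (F x)%:E = v%:E)%E -> has_integral F v.
Proof.
move=> mF F0 Fv; split; last by rewrite /Rintegral Fv.
apply/integrableP; split; first exact/measurable_EFinP.
rewrite (_ : (fun x => _) = EFin \o F); last first.
  by apply/funext => x /=; rewrite ger0_norm.
by rewrite [X in (X < _)%E]Fv ltry.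
Qed.

Lemma integrable_has_integral (F : X -> R) : m.-integrable setT (EFin \o F) ->
  has_integral F (\int[m]_x F x).
Proof. by []. Qed.

End has_integral.

(** * Determinants of positive semidefinite, rank-one perturbed and block matrices *)

Section det_psd.
Context {R : realType}.

Lemma mx11_ge0_psd n (v : 'rV[R]_n) : 0 <= (v *m v^T) 0 0.
Proof. by rewrite mxE sumr_ge0// => i _; rewrite mxE -expr2 sqr_ge0. Qed.

Lemma mx11_gt0_psd n (v : 'rV[R]_n) : v != 0 -> 0 < (v *m v^T) 0 0.
Proof.
move=> v0; rewrite lt_def mx11_ge0_psd andbT; apply: contra v0.
rewrite mxE psumr_eq0; last by move=> i _; rewrite mxE -expr2 sqr_ge0.
move=> /allP h; apply/eqP/rowP => i; rewrite mxE.
by have := h i (mem_index_enum _); rewrite mxE -expr2 sqrf_eq0 => /eqP.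
Qed.

(* The determinant of (1 - s) 1 + s M has no zero for 0 <= s < 1, and is 1 at
   s = 0. *)
Lemma det_psd_ge0 n (M : 'M[R]_n) : (forall v : 'rV[R]_n, 0 <= (v *m M *m v^T) 0 0) ->
  0 <= \det M.
Proof.
move=> psd; rewrite leNgt; apply/negP => M0.
pose P : 'M[{poly R}]_n := (1 - 'X)%:M + 'X *: map_mx polyC M.
have PE s : (\det P).[s] = \det ((1 - s)%:M + s *: M).
  rewrite -[LHS]/(horner_eval s (\det P)) -det_map_mx; congr (\det _).
  apply/matrixP => i j; rewrite !mxE /= /horner_eval hornerD hornerM hornerX hornerC.
  by rewrite hornerMn hornerD hornerN hornerC hornerX.
have := @poly_ivt R (- \det P) 0 1 ler01.
rewrite !hornerN !PE subr0 subrr scale0r addr0 det1 scale1r raddf0 add0r.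
rewrite oppr_le0 ler01 oppr_ge0 ltW// => /(_ isT)[s s01].
rewrite rootN /root PE => /eqP ds.
have s1 : s != 1.
  by apply/eqP => s1; move: M0; rewrite -ds s1 subrr raddf0 add0r scale1r ltxx.
have /det0P[v v0 vs] := introT eqP ds.
have h : (1 - s) * (v *m v^T) 0 0 + s * (v *m M *m v^T) 0 0 = 0.
  move/(congr1 (fun A => (A *m v^T) 0 0)): vs.
  rewrite mul0mx mulmxDr mulmxDl mul_mx_scalar -scalemxAr -!scalemxAl.
  by rewrite [LHS]mxE [X in X + _]mxE [X in _ + X]mxE [RHS]mxE.
have := mx11_gt0_psd v0; have := psd v; move: s01 s1; rewrite neq_lt.
by move=> /andP[? ?] /orP[?|?] ? ?; nra.
Qed.

(** The matrix determinant lemma: the block matrix [B] has a lower-upper and an upper-lower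
    factorization, whose determinants are the two sides. *)
Lemma det_1_add_mul n (r : 'rV[R]_n) (c : 'cV[R]_n) :
  \det (1%:M + c *m r) = 1 + (r *m c) 0 0.
Proof.
pose B : 'M[R]_(1 + n) := block_mx 1%:M (- r) c 1%:M.
have e1 : B = block_mx (1%:M : 'M[R]_1) 0 c 1%:M *m block_mx 1%:M (- r) 0 (1%:M + c *m r).
  by rewrite mulmx_block !mulmx0 !mul0mx !mul1mx !mulmx1 !addr0 mulmxN addrCA addNr addr0.
have e2 : B = block_mx (1%:M + r *m c) (- r) 0 1%:M *m block_mx (1%:M : 'M[R]_1) 0 c 1%:M.
  by rewrite mulmx_block !mulmx0 !mul0mx !mul1mx !mulmx1 !add0r mulNmx addrK.
have := congr1 determinant e1; rewrite {1}e2 !det_mulmx !det_lblock !det_ublock.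
rewrite !det1 !mulr1 !mul1r => <-.
by rewrite det_mx11 !mxE eqxx.
Qed.

(** The Schur complement is normalized by [a] so that, for a moment matrix of mass [a], the last
    factor is the determinant of the covariance. *)
Lemma det_block_schur n (a : R) (b : 'rV[R]_n) (D : 'M[R]_n) : a != 0 ->
  \det (block_mx (a%:M : 'M[R]_1) b b^T D) =
  a ^+ n.+1 * \det (a^-1 *: D - (a^-1 *: b)^T *m (a^-1 *: b)).
Proof.
move=> a0.
have -> : block_mx (a%:M : 'M[R]_1) b b^T D =
    block_mx (1%:M : 'M[R]_1) 0 (a^-1 *: b^T) 1%:M *m
    block_mx a%:M b 0 (a *: (a^-1 *: D - (a^-1 *: b)^T *m (a^-1 *: b))).
  rewrite mulmx_block !mulmx0 !mul0mx !mul1mx !addr0 mul_mx_scalar scalerA mulfV// scale1r.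
  congr block_mx; rewrite scalerBr scalerA mulfV// scale1r.
  have -> : a *: ((a^-1 *: b)^T *m (a^-1 *: b)) = a^-1 *: b^T *m b; last first.
    by rewrite addrC subrK.
  by rewrite -scalemxAr scalerA mulfV// scale1r [(_ *: b)^T]linearZ.
by rewrite det_mulmx det_lblock det_ublock !det1 !mul1r det_scalar1 detZ mulrA exprS.
Qed.

End det_psd.

(** * Moment matrices *)

Section moment_matrix.
Context {R : realType}.
Local Notation mu := (borel_lebesgue R).

(* [x] is replaced by the row [(1, x)], so that mass, barycenter and second moments of [w] form one
   matrix [M], with [\det Cov = \det M / M 0 0 ^+ n.+1]. *)
Definition homog n (x : 'rV[R]_n) : 'rV[R]_n.+1 := cons_row (1, x).

Definition has_momx n (w : 'rV[R]_n -> R) (M : 'M[R]_n.+1) :=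
  measurable_fun setT w /\ forall i j,
  has_integral (mu n) (fun x => w x * (homog x 0 i * homog x 0 j)) (M i j).

Lemma measurable_homog n i : measurable_fun setT (fun x : 'rV[R]_n => homog x 0 i).
Proof.
have [k ->|->] := unliftP 0 i.
  under eq_fun do rewrite /homog cons_rowS; exact: measurable_coord_row.
by under eq_fun do rewrite /homog cons_row0; exact: measurable_cst.
Qed.

(** Moments of products of two affine functions of [x]. Taking [a = b] shows that [M] is positive
    semidefinite; taking columns of a matrix gives the behaviour under affine maps. *)
Lemma has_momx_bilinear n (w : 'rV[R]_n -> R) M (a b : 'cV[R]_n.+1) :
  has_momx w M ->
  has_integral (mu n) (fun x => w x * ((homog x *m a) 0 0 * (homog x *m b) 0 0))
    ((a^T *m M *m b) 0 0).
Proof.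
move=> [_ hw].
rewrite (_ : (fun x => _) = (fun x => \sum_j \sum_i (a i 0 * b j 0) *
   (w x * (homog x 0 i * homog x 0 j)))); last first.
  apply/funext => x; rewrite !mxE big_distrlr/= exchange_big/= big_distrr/=.
  apply: eq_bigr => j _; rewrite big_distrr/=; apply: eq_bigr => i _; ring.
rewrite (_ : (a^T *m M *m b) 0 0 = \sum_j \sum_i (a i 0 * b j 0) * M i j); last first.
  rewrite !mxE; apply: eq_bigr => j _; rewrite !mxE big_distrl/=.
  by apply: eq_bigr => i _; rewrite mxE; ring.
by apply: has_integral_sum => j; apply: has_integral_sum => i; exact: has_integralZ.
Qed.

Lemma has_momx_psd n (w : 'rV[R]_n -> R) M : has_momx w M -> (forall x, 0 <= w x) ->
  0 <= \det M.
Proof.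
move=> hw w0; apply: det_psd_ge0 => v.
have := has_momx_bilinear v^T v^T hw; rewrite trmxK => /has_integral_ge0; apply.
by move=> x; rewrite mulr_ge0// -expr2 sqr_ge0.
Qed.

Lemma has_momx_mass n (w : 'rV[R]_n -> R) M : has_momx w M ->
  has_integral (mu n) w (M 0 0).
Proof.
move=> [_ /(_ 0 0)]; rewrite /homog; under eq_fun do rewrite cons_row0 !mulr1.
by [].
Qed.

Lemma has_momxZ n (w : 'rV[R]_n -> R) M c : has_momx w M ->
  has_momx (fun x => c * w x) (c *: M).
Proof.
move=> [mw hw]; split; first exact: measurable_funM.
move=> i j; rewrite mxE; under eq_fun do rewrite -mulrA; exact: has_integralZ.
Qed.

Lemma homog_affine n (A : 'M[R]_n) (b x : 'rV[R]_n) :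
  homog (x *m A + b) = homog x *m block_mx (1%:M : 'M[R]_1) b 0 A.
Proof.
rewrite /homog !cons_rowE; rewrite [RHS](mul_row_block (1%:M : 'M[R]_1) x 1%:M b 0 A).
by rewrite !mulmx0 !mul1mx addr0 addrC.
Qed.

Lemma affine_has_integral n (A : 'M[R]_n) (b : 'rV[R]_n) (F : 'rV[R]_n -> R) v :
  A \in unitmx -> measurable_fun setT F ->
  has_integral (mu n) (fun x => F (x *m A + b)) v ->
  has_integral (mu n) F (`|\det A| * v).
Proof.
move=> uA mF [iF <-]; have iF' := (affine_integrable b uA mF).2 iF.
by split=> //; rewrite (affine_integral b uA).
Qed.

(** In the coordinates [(1, x)] an affine map is linear, so it acts on the moment matrix by
    congruence, up to the Jacobian. *)
Lemma has_momx_affine n (A : 'M[R]_n) (b : 'rV[R]_n) (w1 w2 : 'rV[R]_n -> R) M :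
  A \in unitmx -> measurable_fun setT w2 -> has_momx w1 M ->
  (forall x, w2 (x *m A + b) = w1 x) ->
  has_momx w2 (`|\det A| *: ((block_mx (1%:M : 'M[R]_1) b 0 A)^T *m M *m
     (block_mx (1%:M : 'M[R]_1) b 0 A))).
Proof.
move=> uA mw2 hw1 w12; split=> // i j; rewrite mxE; apply: (affine_has_integral (b := b)) => //.
  by apply: measurable_funM => //; apply: measurable_funM; exact: measurable_homog.
pose B : 'M[R]_n.+1 := block_mx (1%:M : 'M[R]_1) b 0 A.
have := has_momx_bilinear (col i B) (col j B) hw1.
rewrite (_ : _ 0 0 = (B^T *m M *m B) i j); last first.
  rewrite !mxE; apply: eq_bigr => l _; rewrite !mxE; congr (_ * _).
  by apply: eq_bigr => k _; rewrite !mxE.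
congr has_integral; apply/funext => x.
have colE k : (homog x *m col k B) 0 0 = (homog x *m B) 0 k.
  by rewrite [LHS]mxE [RHS]mxE; apply: eq_bigr => l _; rewrite [col k B l 0]mxE.
by rewrite w12 homog_affine !colE.
Qed.

(** The determinant is multiplied by the power [n.+3] of [|\det A|] and the mass by its first power,
    which makes [\det M / M 0 0 ^+ n.+3] affine invariant. *)
Lemma det_momx_affine n (A : 'M[R]_n) (b : 'rV[R]_n) (M : 'M[R]_n.+1) :
  \det (`|\det A| *: ((block_mx (1%:M : 'M[R]_1) b 0 A)^T *m M *m
     (block_mx (1%:M : 'M[R]_1) b 0 A))) = `|\det A| ^+ n.+1 * (\det A ^+ 2 * \det M).
Proof.
rewrite detZ; congr (_ * _).
rewrite !det_mulmx det_tr (@det_ublock _ 1 n) det1 mul1r; ring.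
Qed.

Lemma mass_momx_affine n (A : 'M[R]_n) (b : 'rV[R]_n) (w1 w2 : 'rV[R]_n -> R) M M' :
  A \in unitmx -> has_momx w1 M -> has_momx w2 M' ->
  (forall x, w2 (x *m A + b) = w1 x) -> M' 0 0 = `|\det A| * M 0 0.
Proof.
move=> uA hw1 hw2 w12; have [_ <-] := has_momx_mass hw2.
have := has_momx_mass hw1; rewrite -(_ : (fun x => w2 (x *m A + b)) = w1); last exact/funext.
by move=> /affine_has_integral => /(_ uA hw2.1)[_ ->].
Qed.

End moment_matrix.

(** * Integrals over cones and Dirichlet's formula *)

Section cone.
Context {R : realType}.
Local Notation mu := (borel_lebesgue R).

Lemma indic_ge0 (T : Type) (A : set T) x : 0 <= \1_A x :> R.
Proof. by rewrite indicE ler0n. Qed.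

Definition cone n (K : set 'rV[R]_n) (z : 'rV[R]_n.+1) : R :=
  \1_(`]0, +oo[%classic) (z 0 0) * expR (- z 0 0) * \1_K ((z 0 0)^-1 *: @rsubmx R 1 1 n z).

Lemma cone_cons_row n (K : set 'rV[R]_n) s x :
  cone K (cons_row (s, x)) = \1_(`]0, +oo[%classic) s * expR (- s) * \1_K (s^-1 *: x).
Proof. by rewrite /cone cons_row0 rsubmx_cons_row. Qed.

Lemma measurable_sectionT d1 d2 (T1 : measurableType d1) (T2 : measurableType d2)
  (f : T1 -> T2) A : measurable_fun setT f -> measurable A -> measurable (f @^-1` A).
Proof. by move=> mf mA; rewrite -[X in measurable X]setTI; exact: mf. Qed.

Lemma measurable_indic_comp d1 d2 (T1 : measurableType d1) (T2 : measurableType d2)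
  (f : T1 -> T2) (A : set T2) : measurable_fun setT f -> measurable A ->
  measurable_fun setT (fun x => \1_A (f x) : R).
Proof.
move=> mf mA; rewrite (_ : (fun x => _) = \1_(f @^-1` A)); last first.
  by apply/funext => x; rewrite !indicE; congr (_%:R); apply/asbool_equiv_eq.
by apply: measurable_indic; exact: measurable_sectionT.
Qed.

Lemma measurable_coord n (i : 'I_n) : measurable_fun setT (fun x : 'rV[R]_n => x 0 i).
Proof. exact: measurable_coord_row. Qed.

Lemma measurable_rsubmx n : measurable_fun setT (fun z : 'rV[R]_n.+1 => @rsubmx R 1 1 n z).
Proof.
apply: measurable_fun_rowP => i.
rewrite (_ : _ \o _ = coord_row (rshift 1 i : 'I_n.+1)); first exact: measurable_coord_row.
by apply/funext => z; rewrite /= /coord_row mxE.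
Qed.

Lemma measurable_scale_row d (T : measurableType d) n (c : T -> R) (x : T -> 'rV[R]_n) :
  measurable_fun setT c -> measurable_fun setT x ->
  measurable_fun setT (fun t => c t *: x t).
Proof.
move=> mc mx; apply: measurable_fun_rowP => i.
rewrite (_ : _ \o _ = (fun t => c t * coord_row i (x t))); last first.
  by apply/funext => t; rewrite /= /coord_row mxE.
apply: measurable_funM => //; apply: (measurableT_comp _ mx).
exact: measurable_coord_row.
Qed.

(** The inverse is discontinuous at 0, so it is split into the sign and a power of the absolute
    value, both measurable. *)
Lemma measurable_inv : measurable_fun setT (@GRing.inv R).
Proof.
have -> : @GRing.inv R = fun x => Num.sg x * `|x| `^ (-1).
  apply/funext => x; have [->|x0] := eqVneq x 0.
    by rewrite sgr0 mul0r invr0.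
  rewrite powR_inv1// {1}(numEsg x) invfM; congr (_ * _).
  by case: sgrP => _; rewrite ?invr0 ?invr1 ?invrN1.
apply: measurable_funM.
  rewrite (_ : Num.sg = fun x : R => \1_(`]0, +oo[%classic) x - \1_(`]-oo, 0[%classic) x).
    by apply: measurable_funB => //; apply: measurable_indic.
  apply/funext => x; rewrite !indicE !mem_setE !in_itv/= andbT.
  by case: sgrP => x0; rewrite ?ltxx ?subrr ?x0 ?(lt_gtF x0) ?subr0 ?sub0r.
by apply: (@measurableT_comp _ _ _ _ _ _ (fun y : R => y `^ (-1))) => //; exact: measurable_powR.
Qed.

Lemma measurable_cone n (K : set 'rV[R]_n) : measurable K -> measurable_fun setT (cone K).
Proof.
move=> mK; have m0 := @measurable_coord n.+1 0.
apply: measurable_funM; first apply: measurable_funM.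
- by apply: measurable_indic_comp.
- by apply: measurableT_comp => //; apply: measurableT_comp.
- apply: measurable_indic_comp => //; apply: measurable_scale_row.
    by apply: (measurableT_comp measurable_inv).
  exact: measurable_rsubmx.
Qed.

Lemma cone_ge0 n (K : set 'rV[R]_n) z : 0 <= cone K z.
Proof. by rewrite /cone !mulr_ge0// ?expR_ge0// indicE ler0n. Qed.

(* The slice of the cone at height s is s K, whence the factor s^(n + k). *)
Lemma ge0_integral_cone n (K : set 'rV[R]_n) (P : 'rV[R]_n -> R) j k :
  measurable K -> measurable_fun setT P -> (forall x, 0 <= P x) ->
  (forall s x, 0 < s -> P (s *: x) = s ^+ k * P x) ->
  (\int[mu n.+1]_z (cone K z * (z 0 0 ^+ j * P (@rsubmx R 1 1 n z)))%:E =
   ((n + j + k)`!%:R)%:E * \int[mu n]_x (\1_K x * P x)%:E)%E.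
Proof.
move=> mK mP P0 hP.
have mF : measurable_fun setT (fun z : 'rV[R]_n.+1 => z 0 0 ^+ j * P (@rsubmx R 1 1 n z)).
  apply: measurable_funM; first by apply: measurable_funX; exact: measurable_coord.
  by apply: (measurableT_comp mP); exact: measurable_rsubmx.
have mG : measurable_fun setT (fun z => (cone K z * (z 0 0 ^+ j * P (@rsubmx R 1 1 n z)))%:E).
  by apply/measurable_EFinP; apply: measurable_funM => //; exact: measurable_cone.
have mKP : measurable_fun setT (fun x => (\1_K x * P x)%:E).
  by apply/measurable_EFinP; apply: measurable_funM.
rewrite ge0_integral_row1//; last first.
  move=> z; rewrite lee_fin /cone indicE mem_setE in_itv/= andbT.
  case: ltP => z0; last by rewrite !mul0r.
  by rewrite mul1r !mulr_ge0 ?expR_ge0 ?indic_ge0 ?exprn_ge0// ltW.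
have I0 : (0 <= \int[mu n]_x (\1_K x * P x)%:E)%E.
  by apply: integral_ge0 => x _; rewrite lee_fin mulr_ge0// indicE ler0n.
have H s : (\int[mu n]_x (cone K (cons_row (s, x)) *
      (cons_row (s, x) 0 0 ^+ j * P (@rsubmx R 1 1 n (cons_row (s, x)))))%:E =
    (\1_(`]0, +oo[%classic) s * (s ^+ (n + j + k) * expR (- s)))%:E *
     \int[mu n]_x (\1_K x * P x)%:E)%E.
  under eq_integral do rewrite cone_cons_row cons_row0 rsubmx_cons_row.
  rewrite indicE mem_setE in_itv/= andbT; have [s0|s0] := ltP 0 s; last first.
    rewrite /= mulr0n !mul0r mul0e integral0_eq// => x _.
    by rewrite !mul0r.
  rewrite -(ge0_integral_scale s0); last 2 first.
  - apply/measurable_EFinP; apply: measurable_funM; last exact: measurable_funM.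
    apply: measurable_funM => //; apply: measurable_indic_comp => //.
    exact: measurable_scale_row.
  - move=> x; rewrite lee_fin mul1r !mulr_ge0 ?expR_ge0 ?exprn_ge0 ?indicE ?ler0n//.
    exact: ltW.
  under eq_integral => x _.
    rewrite scalerA mulVf ?gt_eqF// scale1r hP// mul1r.
    rewrite (_ : _ * _ * _ = (s ^+ j * s ^+ k * expR (- s)) * (\1_K x * P x)); last by ring.
    rewrite EFinM.
    over.
  rewrite ge0_integralZl//; last 2 first.
  - by move=> x _; rewrite lee_fin mulr_ge0// indicE ler0n.
  - by rewrite lee_fin !mulr_ge0 ?expR_ge0 ?exprn_ge0// ltW.
  rewrite muleA -EFinM; congr (_%:E * _)%E.
  by rewrite mul1r !exprD; ring.
under eq_integral do rewrite H.
rewrite ge0_integralZr//.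
- by rewrite integral_gamma_o.
- apply/measurable_EFinP; apply: measurable_funM => //; apply: measurable_funM => //.
  by apply: measurableT_comp.
- move=> s _; rewrite lee_fin indicE mem_setE in_itv/= andbT.
  by case: ltP => s0; rewrite ?mul0r// mul1r mulr_ge0 ?expR_ge0// exprn_ge0// ltW.
Qed.

Lemma has_integral_funrpos d (X : measurableType d) (m : {measure set X -> \bar R})
    (F : X -> R) : m.-integrable setT (EFin \o F) ->
  m.-integrable setT (EFin \o (fun x => Num.max (F x) 0)).
Proof.
move=> iF; have mF : measurable_fun setT F by apply/measurable_EFinP; exact: measurable_int iF.
apply: le_integrable iF => //.
  by apply/measurable_EFinP; exact: measurable_maxr.
move=> x _; rewrite lee_fin ger0_norm; last by rewrite le_max lexx orbT.
by rewrite ge_max ler_norm normr_ge0.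
Qed.

(** Taking the maximum with 0 commutes with positive factors, so the positive and negative parts of
    [P] are again homogeneous of degree [k], and the nonnegative case applies to each. *)
Lemma has_integral_cone n (K : set 'rV[R]_n) (P : 'rV[R]_n -> R) j k v :
  measurable K -> measurable_fun setT P ->
  (forall s x, 0 < s -> P (s *: x) = s ^+ k * P x) ->
  has_integral (mu n) (fun x => \1_K x * P x) v ->
  has_integral (mu n.+1) (fun z => cone K z * (z 0 0 ^+ j * P (@rsubmx R 1 1 n z)))
    ((n + j + k)`!%:R * v).
Proof.
move=> mK mP hP.
have ge0 (Q : 'rV[R]_n -> R) u : measurable_fun setT Q -> (forall x, 0 <= Q x) ->
    (forall s x, 0 < s -> Q (s *: x) = s ^+ k * Q x) ->
    has_integral (mu n) (fun x => \1_K x * Q x) u ->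
    has_integral (mu n.+1) (fun z => cone K z * (z 0 0 ^+ j * Q (@rsubmx R 1 1 n z)))
    ((n + j + k)`!%:R * u).
  move=> mQ Q0 hQ hu; apply: ge0_has_integral.
  - apply: measurable_funM; first exact: measurable_cone.
    apply: measurable_funM; first by apply: measurable_funX; exact: measurable_coord.
    by apply: (measurableT_comp mQ); exact: measurable_rsubmx.
  - move=> z; rewrite /cone indicE mem_setE in_itv/= andbT.
    case: ltP => z0; last by rewrite !mul0r.
    by rewrite mul1r !mulr_ge0 ?expR_ge0 ?indic_ge0 ?exprn_ge0// ltW.
  - by rewrite (ge0_integral_cone j mK mQ Q0 hQ) (has_integral_ereal hu) -EFinM.
pose Pp x := Num.max (P x) 0; pose Pn x := Num.max (- P x) 0.
have PE x : P x = Pp x - Pn x.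
  rewrite /Pp /Pn; case: (leP (P x) 0) => Px; case: (leP (- P x) 0) => Px'; lra.
have hmax (Q : 'rV[R]_n -> R) : (forall s x, 0 < s -> Q (s *: x) = s ^+ k * Q x) ->
    forall s x, 0 < s -> Num.max (Q (s *: x)) 0 = s ^+ k * Num.max (Q x) 0.
  by move=> hQ s x s0; rewrite hQ// maxr_pMr ?mulr0// exprn_ge0// ltW.
have indmax x (a : R) : \1_K x * Num.max a 0 = Num.max (\1_K x * a) 0.
  by rewrite maxr_pMr ?mulr0// indicE ler0n.
move=> [iP <-].
have iPp : (mu n).-integrable setT (EFin \o (fun x => \1_K x * Pp x)).
  by have := has_integral_funrpos iP; under eq_fun do rewrite -indmax.
have iPn : (mu n).-integrable setT (EFin \o (fun x => \1_K x * Pn x)).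
  have iN : (mu n).-integrable setT (EFin \o (fun x => \1_K x * - P x)).
    rewrite (_ : EFin \o _ = -%E \o (EFin \o (fun x => \1_K x * P x))).
      exact: integrableN.
    by apply/funext => x /=; rewrite mulrN EFinN.
  by have := has_integral_funrpos iN; under eq_fun do rewrite -indmax.
have := has_integralB (ge0 _ _ _ _ _ (integrable_has_integral iPp))
  (ge0 _ _ _ _ _ (integrable_has_integral iPn)).
have mN : measurable_fun setT (fun x => - P x) by exact: measurable_funN.
have -> : (n + j + k)`!%:R * \int[mu n]_x (\1_K x * Pp x) -
   (n + j + k)`!%:R * \int[mu n]_x (\1_K x * Pn x) =
   (n + j + k)`!%:R * \int[mu n]_x (\1_K x * P x).
  rewrite -mulrBr -RintegralB//; congr (_ * _); apply: eq_Rintegral => x _.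
  by rewrite -mulrBr -PE.
under eq_fun do rewrite -!mulrBr -PE.
apply.
- exact: measurable_maxr.
- by move=> x; rewrite le_max lexx orbT.
- exact: hmax.
- exact: measurable_maxr.
- by move=> x; rewrite le_max lexx orbT.
- by apply: (hmax (fun x => - P x)) => s x s0; rewrite hP// mulrN.
Qed.

End cone.

Section std_simplex.
Context {R : realType}.
Local Notation mu := (borel_lebesgue R).

Definition std_simplex n : set 'rV[R]_n :=
  [set x | (forall i, 0 <= x 0 i) /\ \sum_i x 0 i <= 1].

Arguments std_simplex n _ : clear implicits.

Lemma measurable_sum_coord n : measurable_fun setT (fun x : 'rV[R]_n => \sum_i x 0 i).
Proof. by apply: measurable_sum => i; exact: measurable_coord. Qed.

Lemma std_simplex_indic n (x : 'rV[R]_n) :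
  \1_(std_simplex n) x = \1_[set y : 'rV[R]_n | \sum_i y 0 i <= 1] x *
     \prod_i \1_(`[0, +oo[%classic) (x 0 i) :> R.
Proof.
have [/= Sx|Sx] := pselect (std_simplex n x).
  rewrite !indicE !mem_set//; last by case: Sx.
  rewrite mul1r big1// => i _; rewrite indicE mem_setE in_itv/= andbT.
  by case: Sx => ->.
rewrite [LHS]indicE memNset//; apply/esym/eqP; rewrite mulf_eq0.
have [sx|sx] := leP (\sum_i x 0 i) 1; last first.
  by apply/orP; left; rewrite indicE memNset//= leNgt sx.
have /existsNP[i xi] : ~ forall i, 0 <= x 0 i by move=> x0; apply: Sx.
apply/orP; right; apply/prodf_eq0; exists i => //.
by rewrite indicE mem_setE in_itv/= andbT (negbTE (introN idP xi)).
Qed.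

Lemma measurable_sum_le1 n : measurable [set x : 'rV[R]_n | \sum_i x 0 i <= 1].
Proof.
have -> : [set x : 'rV[R]_n | \sum_i x 0 i <= 1] =
    (fun x : 'rV[R]_n => \sum_i x 0 i) @^-1` `]-oo, 1]%classic.
  by apply/seteqP; split => x /=; rewrite in_itv.
by apply: measurable_sectionT => //; exact: measurable_sum_coord.
Qed.

Lemma measurable_std_simplex n : measurable (std_simplex n).
Proof.
apply/(measurable_indicP R); rewrite (_ : \1__ = (fun x => \1_[set y : 'rV[R]_n | \sum_i y 0 i <= 1] x *
     \prod_i \1_(`[0, +oo[%classic) (x 0 i))); last by apply/funext => x; exact: std_simplex_indic.
apply: measurable_funM; first by apply: measurable_indic; exact: measurable_sum_le1.
by apply: measurable_prod => i _; apply: measurable_indic_comp => //; exact: measurable_coord.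
Qed.

(* Dirichlet's integral: integrate e^-s P(x) over the cone on the simplex in
   both orders. *)
Lemma dirichlet n (a : 'I_n -> nat) :
  has_integral (mu n) (fun x => \1_(std_simplex n) x * \prod_i x 0 i ^+ a i)
    ((\prod_i (a i)`!%:R) / (n + \sum_i a i)`!%:R).
Proof.
(* The orthant is invariant under scaling, so its indicator is put into the homogeneous function
   [P]; the set keeps only the bound on the coordinate sum. *)
pose H : set 'rV[R]_n := [set x | \sum_i x 0 i <= 1].
pose u i (s : R) : R := \1_(`[0, +oo[%classic) s * s ^+ a i.
have mu_ i : measurable_fun setT (u i) by apply: measurable_funM => //; exact: measurable_indic.
have u0 i s : 0 <= u i s.
  rewrite /u indicE mem_setE in_itv/= andbT; case: (leP 0 s) => s0; rewrite ?mul0r//.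
  by rewrite mul1r exprn_ge0.
pose P (x : 'rV[R]_n) := \prod_i u i (x 0 i).
have mP : measurable_fun setT P.
  by apply: measurable_prod => i _; apply: (measurableT_comp (mu_ i)); exact: measurable_coord.
have P0 x : 0 <= P x by rewrite prodr_ge0.
have hP s x : 0 < s -> P (s *: x) = s ^+ (\sum_i a i) * P x.
  move=> s0; rewrite /P -prodrXr -big_split/=; apply: eq_bigr => i _.
  rewrite /u mxE exprMn !indicE !mem_setE !in_itv/= !andbT pmulr_rge0//; ring.
have -> : (fun x => \1_(std_simplex n) x * \prod_i x 0 i ^+ a i) = fun x => \1_H x * P x.
  by apply/funext => x; rewrite std_simplex_indic -mulrA -big_split.
have mH : measurable H by exact: measurable_sum_le1.
apply: ge0_has_integral.
- by apply: measurable_funM => //; exact: measurable_indic.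
- by move=> x; rewrite mulr_ge0// indicE ler0n.
have f0 : 0 < (n + \sum_i a i)`!%:R :> R by rewrite ltr0n fact_gt0.
have : (\int[mu n.+1]_z (cone H z * P (@rsubmx R 1 1 n z))%:E =
   ((n + \sum_i a i)`!%:R)%:E * \int[mu n]_x (\1_H x * P x)%:E)%E.
  have := @ge0_integral_cone R n H P 0 _ mH mP P0 hP; rewrite addn0 => <-.
  by apply: eq_integral => z _; rewrite expr0 mul1r.
rewrite ge0_integral_row2; last 2 first.
- apply/measurable_EFinP; apply: measurable_funM; first exact: measurable_cone.
  by apply: (measurableT_comp mP); exact: measurable_rsubmx.
- by move=> z; rewrite lee_fin mulr_ge0// cone_ge0.
(* For [x] in the orthant, [s^-1 *: x] lies in [H] exactly when [s] is at least the coordinate sum;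
   integrating over these [s] leaves the exponential of minus that sum, which is a product over the
   coordinates. *)
have E x : (\int[lebesgue_measure]_s (cone H (cons_row (s, x)) *
     P (@rsubmx R 1 1 n (cons_row (s, x))))%:E =
     (\prod_i (\1_(`[0, +oo[%classic) (x 0 i) * (x 0 i ^+ a i * expR (- x 0 i))))%:E)%E.
  have [x0|/existsNP[i xi]] := pselect (forall i, 0 <= x 0 i); last first.
    have ui : \1_(`[0, +oo[%classic) (x 0 i) = 0 :> R.
      by rewrite indicE mem_setE in_itv/= andbT (negbTE (introN idP xi)).
    rewrite (bigD1 i)//= ui !mul0r integral0_eq// => s _.
    by rewrite rsubmx_cons_row /P (bigD1 i)//= /u ui !mul0r mulr0.
  have S0 : 0 <= \sum_i x 0 i by exact: sumr_ge0.
  have -> : (\prod_i (\1_(`[0, +oo[%classic) (x 0 i) * (x 0 i ^+ a i * expR (- x 0 i)))) =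
      expR (- \sum_i x 0 i) * P x :> R.
    rewrite -sumrN expR_sum -big_split/=; apply: eq_bigr => i _; rewrite /u; ring.
  rewrite EFinM -(integral_expRN_ge S0) -ge0_integralZr ?lee_fin//; last first.
    apply/measurable_EFinP; apply: measurable_funM => //; apply: measurable_funM => //.
    by apply: measurableT_comp.
  apply: eq_integral => s _; rewrite -EFinM; congr EFin.
  rewrite cone_cons_row rsubmx_cons_row; congr (_ * _).
  rewrite !indicE mem_setE in_itv/= andbT; case: ltP => s0; rewrite ?mul0r// !mul1r mulrC.
  have -> : (s^-1 *: x \in H) = (\sum_i x 0 i <= s).
    have -> : (\sum_i x 0 i <= s) = (\sum_i (s^-1 *: x) 0 i <= 1).
      under [in RHS]eq_bigr do rewrite mxE.
      by rewrite -mulr_sumr mulrC ler_pdivrMr ?mul1r.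
    by apply/idP/idP => [/set_mem|h]; last exact: mem_set.
  by rewrite mem_setE in_itv/= andbT.
move=> D0; have : (\int[mu n]_x (\prod_i (\1_(`[0%R, +oo[%classic) (x 0 i) * (x 0 i ^+ a i * expR (- x 0 i))))%:E =
   ((n + \sum_i a i)`!%:R)%:E * \int[mu n]_x (\1_H x * P x)%:E)%E.
  by rewrite -D0; apply: eq_integral => x _; rewrite E.
rewrite (@ge0_integral_prod R n (fun i s => \1_(`[0, +oo[%classic) s * (s ^+ a i * expR (- s)))); last 2 first.
- move=> i; apply: measurable_funM; first exact: measurable_indic.
  by apply: measurable_funM => //; apply: measurableT_comp.
- move=> i s; rewrite mulrA mulr_ge0 ?expR_ge0//; exact: u0.
rewrite (eq_bigr (fun i => (a i)`!%:R%:E)); last by move=> i _; rewrite integral_gamma_c.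
rewrite prodEFin => /(congr1 (fun y => ((n + \sum_i a i)`!%:R^-1)%:E * y)%E).
rewrite muleA -!EFinM mulVf ?gt_eqF// mul1e => <-.
by rewrite mulrC.
Qed.

End std_simplex.
Arguments std_simplex {R} n _.

(** * Cubes, Borel sets and bounded sets of row vectors *)

Section row_topology.
Context {R : realType}.
Local Notation mu := (borel_lebesgue R).

(** For [r >= 0] this is a closed ball of the supremum norm and also a product of intervals, so it
    describes the topology and has an explicit measure. *)
Definition cube n (c : 'rV[R]_n) (r : R) : set 'rV[R]_n :=
  [set x | forall i, `|x 0 i - c 0 i| <= r].

Lemma row_ballP n (c : 'rV[R]_n) r x : 0 < r ->
  ball c r x <-> forall i, `|c 0 i - x 0 i| < r.
Proof.
move=> r0; split=> [[_ +] i|h]; first by move=> /(_ 0 i).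
by split=> // i j; rewrite (ord1 i); exact: h.
Qed.

Lemma cube_sub_ball n (c : 'rV[R]_n) r e : 0 <= r < e -> cube c r `<=` ball c e.
Proof.
move=> /andP[r0 re] x xc; apply/row_ballP; first exact: le_lt_trans re.
by move=> i; rewrite distrC (le_lt_trans (xc i)).
Qed.

Lemma ball_sub_cube n (c : 'rV[R]_n) r : 0 < r -> ball c r `<=` cube c r.
Proof. by move=> r0 x /(row_ballP _ _ r0) xc i; rewrite distrC ltW. Qed.

Lemma interior_cube n (K : set 'rV[R]_n) p : K° p ->
  exists2 r, 0 < r & cube p r `<=` K.
Proof.
move=> /nbhs_ballP[e /= e0 eK]; exists (e / 2); first by rewrite divr_gt0.
apply: subset_trans eK; apply: cube_sub_ball.
by rewrite divr_ge0 ?ltW//= ltr_pdivrMr// ltr_pMr// ltr1n.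
Qed.

Lemma cube_interior n (K : set 'rV[R]_n) p r : 0 < r -> cube p r `<=` K -> K° p.
Proof.
move=> r0 rK; apply/nbhs_ballP; exists r => //=.
by apply: subset_trans rK; exact: ball_sub_cube.
Qed.

Lemma ler_coord_norm n (x : 'rV[R]_n) i : `|x 0 i| <= `|x|.
Proof. by rewrite [leRHS]/Num.norm/= mx_normrE; apply/bigmax_geP; right; exists (0, i). Qed.

Lemma row_norm_le n (x : 'rV[R]_n) r : 0 <= r -> (forall i, `|x 0 i| <= r) -> `|x| <= r.
Proof.
move=> r0 h; rewrite [leLHS]/Num.norm/= mx_normrE; apply/bigmax_leP; split=> //= -[i j] _ /=.
by rewrite (ord1 i).
Qed.

Lemma bounded_cube n (K : set 'rV[R]_n) : bounded_set K ->
  exists2 B, 0 < B & K `<=` cube 0 B.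
Proof.
move=> [M [Mr KM]]; exists (`|M| + 1); first by rewrite ltr_wpDl.
move=> x Kx i; rewrite mxE subr0 (le_trans (ler_coord_norm _ _))//.
by apply: KM => //; rewrite (le_lt_trans (ler_norm M))// ltrDl.
Qed.

Lemma cube_bounded n (K : set 'rV[R]_n) B : K `<=` cube 0 B -> bounded_set K.
Proof.
move=> KB; exists `|B|; split; first by rewrite num_real.
move=> r rB x /KB xB; apply: row_norm_le => [|i]; first exact: le_trans (ltW rB).
by have := xB i; rewrite mxE subr0 => /le_trans -> //; rewrite (le_trans (ler_norm B))// ltW.
Qed.

Lemma indic_cube n (c : 'rV[R]_n) r x :
  \1_(cube c r) x = \prod_i \1_(`[c 0 i - r, c 0 i + r]%classic) (x 0 i) :> R.
Proof.
have [xc|xc] := pselect (cube c r x).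
  rewrite indicE mem_set// big1// => i _; rewrite indicE mem_set//=.
  by rewrite in_itv/= -ler_distl distrC distrC.
rewrite indicE memNset//; have /existsNP[i xi] := xc.
rewrite (bigD1 i)//= indicE memNset ?mul0r//= in_itv/= -ler_distl.
by move=> h; apply: xi.
Qed.

Lemma measurable_cube n (c : 'rV[R]_n) r : measurable (cube c r).
Proof.
apply/(measurable_indicP R); rewrite (_ : \1_(cube c r) = (fun x : 'rV[R]_n =>
    \prod_i \1_(`[c 0 i - r, c 0 i + r]%classic) (x 0 i) : R)); last first.
  by apply/funext => x; exact: indic_cube.
apply: measurable_prod => i _; apply: measurable_indic_comp => //.
exact: measurable_coord.
Qed.

Lemma cube_measure n (c : 'rV[R]_n) r : 0 <= r ->
  mu n (cube c r) = ((2 * r) ^+ n)%:E.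
Proof.
move=> r0; rewrite -[cube c r]setIT -integral_indic//; last exact: measurable_cube.
under eq_integral do rewrite indic_cube.
rewrite (@ge0_integral_prod R n (fun i => \1_(`[c 0 i - r, c 0 i + r]%classic)))//.
rewrite (eq_bigr (fun=> (2 * r)%:E)).
  by rewrite prodEFin prodr_const card_ord.
move=> i _; rewrite integral_indic//= setIT lebesgue_measure_itv/= lte_fin.
case: ifPn => [_|]; first by rewrite -EFinD; congr EFin; ring.
rewrite -leNgt => h; congr EFin; lra.
Qed.

(** The sigma-algebra is generated by coordinates, not by open sets. An open set is the union of the
    countably many cubes inside it with rational centre and radius [k.+1%:R^-1]. *)
Lemma open_row_measurable n (A : set 'rV[R]_n) : open A -> measurable A.
Proof.
move=> oA; pose ratv (q : 'rV[rat]_n) : 'rV[R]_n := \row_i ratr (q 0 i).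
pose F (u : 'rV[rat]_n * nat) : set 'rV[R]_n :=
  [set x | cube (ratv u.1) u.2.+1%:R^-1 x /\ cube (ratv u.1) u.2.+1%:R^-1 `<=` A].
have -> : A = \bigcup_u F u.
  apply/seteqP; split=> [x Ax|x [u _ []]]; last by move=> xu; apply.
  have /nbhs_ballP[e /= e0 eA] : nbhs x A by exact: open_nbhs_nbhs.
  pose k := Num.trunc (3 / e).
  have ke : 3 / e < k.+1%:R by exact: truncnS_gt.
  have k0 : 0 < k.+1%:R^-1 :> R by rewrite invr_gt0.
  have ke' : 2 * k.+1%:R^-1 < e.
    by rewrite ltr_pdivrMr// mulrC; move: ke; rewrite ltr_pdivrMr//; lra.
  have q_ i : exists q : rat, `|x 0 i - ratr q| <= k.+1%:R^-1.
    have : x 0 i - k.+1%:R^-1 < x 0 i + k.+1%:R^-1 by rewrite ltrD2l (lt_trans _ k0)// oppr_lt0.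
    move=> /rat_in_itvoo[q]; rewrite in_itv/= => /andP[q1 q2]; exists q.
    by rewrite ler_distlC; apply/andP; split; exact: ltW.
  have [q hq] := choice q_.
  exists (\row_i q i, k) => //; split=> /= [i|y yq]; first by rewrite /ratv !mxE.
  apply: eA; apply: (@cube_sub_ball _ _ (2 * k.+1%:R^-1)).
    by rewrite ke' andbT mulr_ge0// ltW.
  move=> i; have := yq i; have := hq i; rewrite /ratv !mxE => h1 h2.
  rewrite (le_trans (ler_distD (ratr (q i)) _ _))// mulr_natl mulr2n lerD//.
  by rewrite distrC.
apply: countable_bigcupT_measurable; first exact: countableP.
move=> u; rewrite /F; have [h|h] := pselect (cube (ratv u.1) u.2.+1%:R^-1 `<=` A).
  rewrite (_ : [set x | _] = cube (ratv u.1) u.2.+1%:R^-1); first exact: measurable_cube.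
  by apply/seteqP; split => x //= [].
rewrite (_ : [set x | _] = set0); first exact: measurable0.
by apply/seteqP; split => x //= [].
Qed.

Lemma closed_row_measurable n (A : set 'rV[R]_n) : closed A -> measurable A.
Proof.
by move=> cA; rewrite -[A]setCK; apply: measurableC; apply: open_row_measurable; exact: closed_openC.
Qed.

Lemma compact_row_closed n (A : set 'rV[R]_n) : compact A -> closed A.
Proof. by move=> cA; apply: compact_closed => //; exact: norm_hausdorff. Qed.

Lemma compact_row_measurable n (A : set 'rV[R]_n) : compact A -> measurable A.
Proof. by move=> cA; apply: closed_row_measurable; exact: compact_row_closed. Qed.

Lemma bounded_measure_lty n (K : set 'rV[R]_n) B : measurable K -> K `<=` cube 0 B ->
  (mu n K < +oo)%E.
Proof.
move=> mK KB; have KB' : K `<=` cube 0 `|B|.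
  by move=> x /KB h i; rewrite (le_trans (h i))// ler_norm.
apply: le_lt_trans (_ : mu n (cube 0 `|B|) < _)%E; last by rewrite cube_measure// ltry.
by apply: le_measure; rewrite ?inE//; exact: measurable_cube.
Qed.

Lemma bounded_has_integral n (K : set 'rV[R]_n) (p : 'rV[R]_n -> R) B C :
  measurable K -> K `<=` cube 0 B -> measurable_fun setT p ->
  (forall x, K x -> `|p x| <= C) ->
  has_integral (mu n) (fun x => \1_K x * p x) (\int[mu n]_x (\1_K x * p x)).
Proof.
move=> mK KB mp pC; apply: integrable_has_integral.
have iK : (mu n).-integrable setT (EFin \o (fun x => `|C| * \1_K x)).
  have iK0 : (mu n).-integrable setT (EFin \o (\1_K : _ -> R)).
    apply: (@ge0_has_integral _ _ _ _ _ (fine (mu n K)) _ _ _).1.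
    - exact: measurable_indic.
    - exact: indic_ge0.
    - rewrite integral_indic// setIT fineK// ge0_fin_numE//.
      exact: bounded_measure_lty KB.
  exact: (has_integralZ `|C| (integrable_has_integral iK0)).1.
apply: le_integrable iK => //.
  by apply/measurable_EFinP; apply: measurable_funM => //; exact: measurable_indic.
move=> x _; rewrite lee_fin !normrM normr_id mulrC.
rewrite indicE; case: (boolP (x \in K)) => [/set_mem Kx|_]; last by rewrite normr0 !mulr0.
by rewrite ler_wpM2r// (le_trans (pC _ Kx))// ler_norm.
Qed.

Lemma homog_cube n (x : 'rV[R]_n) B i : cube 0 B x -> `|homog x 0 i| <= `|B| + 1.
Proof.
move=> xB; rewrite /homog; have [k ->|->] := unliftP 0 i.
  rewrite cons_rowS; have := xB k; rewrite mxE subr0 => /le_trans -> //.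
  by rewrite (le_trans (ler_norm B))// lerDl.
by rewrite cons_row0 normr1 lerDr.
Qed.

Lemma bounded_has_momx n (K : set 'rV[R]_n) B : measurable K -> K `<=` cube 0 B ->
  exists M, has_momx (\1_K : _ -> R) M.
Proof.
move=> mK KB; exists (\matrix_(i, j) \int[mu n]_x (\1_K x * (homog x 0 i * homog x 0 j))).
split; first exact: measurable_indic.
move=> i j; rewrite mxE; apply: (@bounded_has_integral _ _ _ B ((`|B| + 1) * (`|B| + 1))) => //.
  by apply: measurable_funM; exact: measurable_homog.
by move=> x /KB xB; rewrite normrM ler_pM// homog_cube.
Qed.

Lemma has_momx_massE n (K : set 'rV[R]_n) M : measurable K -> has_momx (\1_K : _ -> R) M ->
  mu n K = (M 0 0)%:E.
Proof.
by move=> mK /has_momx_mass/has_integral_ereal; rewrite integral_indic// setIT.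
Qed.

Lemma has_momx_mass_gt0 n (K : set 'rV[R]_n) M : measurable K -> K° !=set0 ->
  has_momx (\1_K : _ -> R) M -> 0 < M 0 0.
Proof.
move=> mK [p /interior_cube[r r0 rK]] hM.
rewrite -lte_fin -(has_momx_massE mK hM).
apply: lt_le_trans (_ : mu n (cube p r) <= _)%E.
  by rewrite cube_measure ?ltW// lte_fin exprn_gt0// mulr_gt0.
by apply: le_measure; rewrite ?inE//; exact: measurable_cube.
Qed.

End row_topology.

(** * Covariance and isotropic constants through moment matrices *)

Section covariance.
Context {R : realType}.
Local Notation mu := (borel_lebesgue R).

Definition momx_cov n (M : 'M[R]_n.+1) : 'M[R]_n :=
  (M 0 0)^-1 *: (\matrix_(i, j) M (lift 0 i) (lift 0 j)) -
  ((M 0 0)^-1 *: (\row_j M 0 (lift 0 j)))^T *m ((M 0 0)^-1 *: (\row_j M 0 (lift 0 j))).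

Lemma has_momx_sym n (w : 'rV[R]_n -> R) M i j : has_momx w M -> M i j = M j i.
Proof.
move=> [_ hw]; rewrite -(hw i j).2 -(hw j i).2.
by apply: eq_Rintegral => x _; congr (_ * _); exact: mulrC.
Qed.

Lemma momx_block n (M : 'M[R]_n.+1) : (forall i j, M i j = M j i) ->
  M = block_mx ((M 0 0)%:M : 'M[R]_1) (\row_j M 0 (lift 0 j)) (\row_j M 0 (lift 0 j))^T
    (\matrix_(i, j) M (lift 0 i) (lift 0 j)) :> 'M[R]_(1 + n).
Proof.
move=> sM; apply/matrixP => i j.
have l0 (k : 'I_1) : lshift n k = 0 by rewrite (ord1 k); exact: val_inj.
have r0 (k : 'I_n) : rshift 1 k = lift 0 k by exact: val_inj.
have [k ->|k ->] := split_ordP (i : 'I_(1 + n));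
  have [l ->|l ->] := split_ordP (j : 'I_(1 + n)).
- by rewrite block_mxEul !l0 (ord1 k) (ord1 l) mxE eqxx mulr1n.
- by rewrite block_mxEur !l0 r0 mxE.
- by rewrite block_mxEdl !l0 r0 !mxE sM.
- by rewrite block_mxEdr !r0 !mxE.
Qed.

Lemma det_momx_cov n (w : 'rV[R]_n -> R) M : has_momx w M -> M 0 0 != 0 ->
  \det (momx_cov M) = \det M / M 0 0 ^+ n.+1.
Proof.
move=> hw M0; have sM i j := has_momx_sym i j hw.
rewrite [X in \det X / _](momx_block sM) det_block_schur// mulrAC divff ?mul1r//.
by rewrite expf_neq0.
Qed.

(** The passage from an integrand that is only Lebesgue measurable to a Borel one, for which
    iterated integrals are available. *)
Lemma Rintegral_lebesgue_ae n (F H : 'rV[R]_n -> R) N v :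
  measurable N -> mu n N = 0%E -> (forall x, ~ N x -> F x = H x) ->
  measurable_fun setT (F : caratheodory_type ((mu n)^*)%mu -> R) ->
  has_integral (mu n) H v -> \int[lebesgue R n]_x F x = v.
Proof.
move=> mN N0 FH mF hH; have mH := has_integral_measurable hH.
have [iH <-] := hH; rewrite -Rintegral_lebesgue//; congr fine.
apply: ae_eq_integral; first exact: measurableT.
- exact/measurable_EFinP.
- exact/measurable_EFinP/measurable_fun_lebesgue.
- exists N; split; first exact: borel_sub_lebesgue.
    by rewrite [LHS]lebesgueE.
  by move=> x /= /not_implyP[_ h]; apply: contrapT => Nx; apply: h; rewrite /= FH.
Qed.

Section ae_density.
Variables (n : nat) (f h : 'rV[R]_n -> R) (N : set 'rV[R]_n) (M : 'M[R]_n.+1).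
Hypotheses (mN : measurable N) (N0 : mu n N = 0%E) (fh : forall x, ~ N x -> f x = h x).
Hypothesis mf : measurable_fun setT (f : caratheodory_type ((mu n)^*)%mu -> R).
Hypothesis hM : has_momx h M.

Let mfp (p : 'rV[R]_n -> R) : measurable_fun setT p ->
  measurable_fun setT ((fun x => f x * p x) : caratheodory_type ((mu n)^*)%mu -> R).
Proof. by move=> mp; apply: measurable_funM => //; exact: measurable_fun_lebesgue. Qed.

Lemma ae_density_integral (p : 'rV[R]_n -> R) v : measurable_fun setT p ->
  has_integral (mu n) (fun x => h x * p x) v ->
  \int[lebesgue R n]_x (f x * p x) = v.
Proof.
move=> mp; apply: Rintegral_lebesgue_ae mN N0 _ _ => [x Nx|]; last exact: mfp.
by rewrite fh.
Qed.

Lemma integral_funE : integral_fun f = M 0 0.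
Proof.
rewrite /integral_fun; apply: Rintegral_lebesgue_ae mN N0 fh mf _.
exact: has_momx_mass.
Qed.

Lemma bar_funE : bar_fun f = (M 0 0)^-1 *: (\row_j M 0 (lift 0 j)).
Proof.
rewrite /bar_fun integral_funE; congr (_ *: _); apply/rowP => j; rewrite !mxE.
under eq_Rintegral do rewrite mxE.
apply: ae_density_integral; first exact: measurable_coord.
have := hM.2 0 (lift 0 j); congr has_integral; apply/funext => x.
by rewrite /homog cons_row0 cons_rowS mul1r.
Qed.

Lemma Cov_funE : Cov_fun f = momx_cov M.
Proof.
rewrite /Cov_fun bar_funE integral_funE; congr (_ *: _ - _).
apply/matrixP => i j; rewrite !mxE.
under eq_Rintegral do rewrite !mxE big_ord1 mxE.
apply: ae_density_integral.
  by apply: measurable_funM; exact: measurable_coord.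
have := hM.2 (lift 0 i) (lift 0 j); congr has_integral; apply/funext => x.
by rewrite /homog !cons_rowS.
Qed.

(** Both factors are brought under the exponent [(2 * n%:R)^-1]. Of the power [n.+3] of the mass,
    [n.+1] comes from the determinant of the covariance and 2 from squaring the entropy factor. *)
Lemma LhatE : 0 < M 0 0 -> (forall x, 0 <= h x) ->
  Lhat f = (expR (- (2 * entropy f)) * \det M / M 0 0 ^+ n.+3) `^ (2 * n%:R)^-1.
Proof.
move=> M0 h0; rewrite /Lhat integral_funE Cov_funE (det_momx_cov hM) ?gt_eqF//.
have dM : 0 <= \det M / M 0 0 ^+ n.+1.
  by rewrite divr_ge0//; [exact: has_momx_psd hM h0|rewrite exprn_ge0// ltW].
have -> : (n%:R : R)^-1 = 2 * (2 * n%:R)^-1 by rewrite invfM mulrA divff ?mul1r.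
rewrite powRrM -powRM ?powR_ge0//.
congr (_ `^ _); rewrite (powR_mulrn 2); last by rewrite divr_ge0 ?expR_ge0// ltW.
have -> : expR (- (2 * entropy f)) = expR (- entropy f) ^+ 2.
  by rewrite -expRM_natl mulrN.
rewrite (_ : M 0 0 ^+ n.+3 = M 0 0 ^+ n.+1 * M 0 0 ^+ 2); last by rewrite -exprD addn2.
rewrite invfM expr_div_n -!mulrA; congr (_ * _).
by congr (_ * _); rewrite mulrCA; congr (_ * _); exact: mulrC.
Qed.

End ae_density.

Lemma measurable_fun_indic_lebesgue n (K : set 'rV[R]_n) : measurable K ->
  measurable_fun setT (\1_K : caratheodory_type ((mu n)^*)%mu -> R).
Proof. by move=> mK; apply: measurable_fun_lebesgue; exact: measurable_indic. Qed.

Lemma Rintegral_indic n (K : set 'rV[R]_n) (p : 'rV[R]_n -> R) :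
  \int[lebesgue R n]_(x in K) p x = \int[lebesgue R n]_x (\1_K x * p x).
Proof.
rewrite Rintegral_mkcond; apply: eq_Rintegral => x _.
by rewrite patchE indicE; case: ifPn; rewrite ?mul1r ?mul0r.
Qed.

(** The barycenter and covariance of [K] are those of the density [\1_K], taken with an empty
    exceptional set; the squared volume accounts for the exponent [n.+3] instead of [n.+1]. *)
Lemma L_bodyE n (K : set 'rV[R]_n) M : measurable K -> has_momx (\1_K : _ -> R) M ->
  0 < M 0 0 -> L_body K = (\det M / M 0 0 ^+ n.+3) `^ (2 * n%:R)^-1.
Proof.
move=> mK hM M0.
have mK' := measurable_fun_indic_lebesgue mK.
have z0 : mu n set0 = 0%E by exact: measure0.
have volK : vol K = M 0 0 by rewrite /vol lebesgueE// (has_momx_massE mK hM).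
have barK : bar_body K = (M 0 0)^-1 *: (\row_j M 0 (lift 0 j)).
  rewrite -(bar_funE measurable0 z0 _ mK' hM)// /bar_body volK /bar_fun.
  rewrite (integral_funE measurable0 z0 _ mK' hM)//; congr (_ *: _).
  apply/matrixP => i j; rewrite !mxE Rintegral_indic.
  by apply: eq_Rintegral => x _; rewrite [RHS]mxE (ord1 i).
have covK : Cov_body K = momx_cov M.
  rewrite -(Cov_funE measurable0 z0 _ mK' hM)// /Cov_body volK barK.
  rewrite -(bar_funE measurable0 z0 _ mK' hM)// /Cov_fun.
  rewrite (integral_funE measurable0 z0 _ mK' hM)//; congr (_ *: _ - _).
  apply/matrixP => i j; rewrite !mxE Rintegral_indic.
  by apply: eq_Rintegral => x _; rewrite [RHS]mxE.
rewrite /L_body volK covK (det_momx_cov hM) ?gt_eqF//.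
have dM : 0 <= \det M / M 0 0 ^+ n.+1.
  rewrite divr_ge0//; last by rewrite exprn_ge0// ltW.
  by apply: has_momx_psd hM _ => x; exact: indic_ge0.
have -> : (n%:R : R)^-1 = 2 * (2 * n%:R)^-1 by rewrite invfM mulrA divff ?mul1r.
rewrite powRrM (powR_mulrn 2) ?ltW//.
have -> : \det M / M 0 0 ^+ n.+1 = (\det M / M 0 0 ^+ n.+3) * M 0 0 ^+ 2.
  rewrite (_ : M 0 0 ^+ n.+3 = M 0 0 ^+ n.+1 * M 0 0 ^+ 2); last by rewrite -exprD addn2.
  rewrite invfM -!mulrA mulVf ?mulr1//.
  by rewrite expf_neq0// gt_eqF.
rewrite powRM; [|by move: dM; rewrite !pmulr_lge0 ?invr_gt0 ?exprn_gt0|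
  by rewrite exprn_ge0// ltW].
by rewrite mulfK// gt_eqF// powR_gt0// exprn_gt0.
Qed.

End covariance.

Section convexity.
Context {R : realType}.

Lemma convex_rowP n (K : set 'rV[R]_n) : convex_set K <->
  forall x y t, 0 <= t <= 1 -> K x -> K y -> K (t *: x + (1 - t) *: y).
Proof.
split=> [cK x y t t01 Kx Ky|h x y k].
  pose k : {i01 R} := Itv01 (andP t01).1 (andP t01).2.
  by have := cK x y k (mem_set Kx) (mem_set Ky) => /set_mem; rewrite /conv/=.
move=> /set_mem Kx /set_mem Ky; apply/mem_set; rewrite /conv/=.
by apply: h => //; apply/andP; split.
Qed.

End convexity.

(** * The simplex, the exponential density and the cone density *)

Section simplex.
Context {R : realType}.
Local Notation mu := (borel_lebesgue R).

(* The [2 n]-th power of the isotropic constant of the simplex. *)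
Definition simplex_constant n : R := n`!%:R ^+ 2 / (n.+1%:R ^+ n.+1 * n.+2%:R ^+ n).

(** Dirichlet's formula for monomials of degree at most 2: the numerator is 2 exactly for the
    squares of coordinates, and the denominator is the factorial of [n] plus the degree. *)
Definition std_simplex_momx n : 'M[R]_n.+1 :=
  \matrix_(i, j) (((i == j) && (i != 0)).+1%:R / (n + (i != 0) + (j != 0))`!%:R).

Lemma lift0F n (k : 'I_n) : (lift 0 k == 0 :> 'I_n.+1) = false.
Proof. by rewrite eq_sym eq_liftF. Qed.

Lemma indic_eq (T U : Type) (A : set T) (B : set U) x y : (A x <-> B y) ->
  \1_A x = \1_B y :> R.
Proof.
move=> AB; rewrite !indicE; congr (_%:R); congr nat_of_bool.
by apply/idP/idP => /set_mem h; apply/mem_set; apply/AB.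
Qed.

Lemma homog_monomial n (x : 'rV[R]_n) i :
  homog x 0 i = \prod_k x 0 k ^+ (i == lift 0 k).
Proof.
rewrite /homog; have [k ->|->] := unliftP 0 i.
  rewrite cons_rowS (bigD1 k)//= eqxx expr1 big1 ?mulr1// => l lk.
  by rewrite (inj_eq lift_inj) eq_sym (negbTE lk).
by rewrite cons_row0 big1// => k _; rewrite eq_liftF.
Qed.

Lemma sum_delta_lift n (i : 'I_n.+1) : (\sum_(k < n) (i == lift 0%R k) = (i != 0%R))%N.
Proof.
have [k ->|->] := unliftP 0 i.
  rewrite (bigD1 k)//= eqxx big1 => [|l lk]; first by rewrite ?lift0F.
  by rewrite (inj_eq lift_inj) eq_sym (negbTE lk).
by rewrite big1 ?eqxx// => k _; rewrite eq_liftF.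
Qed.

Lemma prod_fact_delta n (i j : 'I_n.+1) :
  \prod_(k < n) ((i == lift 0 k) + (j == lift 0 k))`!%:R =
  ((i == j) && (i != 0)).+1%:R :> R.
Proof.
have [k ->|->] := unliftP 0 i; last first.
  rewrite eqxx andbF big1// => k _; rewrite eq_liftF add0n.
  by case: (j == _).
rewrite (bigD1 k)// eqxx lift0F andbT big1 ?mulr1.
  by rewrite [LHS]mulr1 (eq_sym j); case: (_ == j).
move=> l lk; rewrite (inj_eq lift_inj) eq_sym (negbTE lk) add0n.
by case: (j == _).
Qed.

Lemma homog_monomial2 n (x : 'rV[R]_n) i j : homog x 0 i * homog x 0 j =
  \prod_k x 0 k ^+ ((i == lift 0 k) + (j == lift 0 k)).
Proof.
rewrite !homog_monomial -big_split/=; apply: eq_bigr => k _.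
by rewrite exprD.
Qed.

Lemma std_simplex_has_momx n :
  has_momx (\1_(std_simplex n) : _ -> R) (std_simplex_momx n).
Proof.
split; first by apply: measurable_indic; exact: measurable_std_simplex.
move=> i j; have := @dirichlet R n (fun k => ((i == lift 0%R k) + (j == lift 0%R k))%N).
rewrite prod_fact_delta big_split/= !sum_delta_lift addnA mxE.
by under [X in _ -> has_integral _ X _]eq_fun do rewrite homog_monomial2.
Qed.

Lemma std_simplex_momx00 n : std_simplex_momx n 0 0 = (n`!%:R)^-1.
Proof. by rewrite mxE eqxx !addn0 div1r. Qed.

(** Up to the factor [1 / ((n + 1) (n + 2))] the covariance is the identity minus [1 / (n + 1)]
    times the all-ones matrix, a rank-one perturbation of determinant [1 / (n + 1)]. *)
Lemma det_std_simplex_momx n : \det (std_simplex_momx n) =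
  std_simplex_momx n 0 0 ^+ n.+3 * simplex_constant n.
Proof.
have f0 : n`!%:R != 0 :> R by rewrite pnatr_eq0 -lt0n fact_gt0.
have sM i j : std_simplex_momx n i j = std_simplex_momx n j i.
  by have := has_momx_sym i j (std_simplex_has_momx n).
rewrite [in LHS](momx_block sM) det_block_schur; last by rewrite std_simplex_momx00 invr_neq0.
pose c : 'cV[R]_n := const_mx (- n.+1%:R^-1); pose r : 'rV[R]_n := const_mx 1.
have -> : (std_simplex_momx n 0 0)^-1 *:
     (\matrix_(i, j) std_simplex_momx n (lift 0 i) (lift 0 j)) -
   ((std_simplex_momx n 0 0)^-1 *: (\row_j std_simplex_momx n 0 (lift 0 j)))^T *m
   ((std_simplex_momx n 0 0)^-1 *: (\row_j std_simplex_momx n 0 (lift 0 j))) =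
   (n.+1%:R * n.+2%:R)^-1 *: (1%:M + c *m r).
  apply/matrixP => i j.
  rewrite !mxE !big_ord1 !mxE (inj_eq lift_inj) !lift0F !eqxx.
  rewrite !eq_liftF /= !andbT !addn0 !addn1 !factS !natrM.
  have n1 : n.+1%:R != 0 :> R by rewrite pnatr_eq0.
  have n2 : n.+2%:R != 0 :> R by rewrite pnatr_eq0.
  have -> : n.+2%:R = n.+1%:R + 1 :> R by rewrite -natr1.
  have n1' : 1 + n%:R != 0 :> R by rewrite nat1r.
  have n2' : 1 + n%:R + 1 != 0 :> R by rewrite nat1r natr1.
  case: (i == j) => /=; field; rewrite ?f0 ?n1' ?n2'//.
rewrite detZ det_1_add_mul [(r *m c) 0 0]mxE.
rewrite (eq_bigr (fun=> - n.+1%:R^-1)); last by move=> i _; rewrite !mxE mul1r.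
rewrite sumr_const card_ord std_simplex_momx00 /simplex_constant.
have -> : n.+3 = (n.+1 + 2)%N by rewrite addn2.
rewrite exprD -mulrA; congr (_ * _).
rewrite [in RHS]exprVn [RHS]mulrA mulVf ?expf_neq0// mul1r exprVn exprMn [n.+1%:R ^+ n.+1]exprS.
have -> : 1 + - (n.+1%:R : R)^-1 *+ n = n.+1%:R^-1.
  rewrite -[_ *+ n]mulr_natr mulNr -natr1; field.
  by rewrite natr1 pnatr_eq0.
by rewrite -invfM; congr (_^-1); rewrite mulrC mulrA.
Qed.

Definition edge_mx n (v : 'I_n.+1 -> 'rV[R]_n) : 'M[R]_n :=
  \matrix_(i, j) (v (lift 0 i) 0 j - v 0 0 j).

(** By polarization, equal distances determine the Gram matrix of the edges at [v 0]: it is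
    [l ^+ 2 / 2] times the sum of the identity and the all-ones matrix, whose determinant is
    nonzero. *)
Lemma regular_edge_mx_unit n (v : 'I_n.+1 -> 'rV[R]_n) (l : R) : 0 < l ->
  (forall i j, i != j -> euclidean_dist (v i) (v j) = l) -> edge_mx v \in unitmx.
Proof.
move=> l0 hl; pose c : 'cV[R]_n := const_mx 1; pose r : 'rV[R]_n := const_mx 1.
have dist i j : i != j -> \sum_k (v i 0 k - v j 0 k) ^+ 2 = l ^+ 2.
  move=> /hl <-; rewrite /euclidean_dist sqr_sqrtr// sumr_ge0// => k _.
  exact: sqr_ge0.
have gram : edge_mx v *m (edge_mx v)^T = (l ^+ 2 / 2) *: (1%:M + c *m r).
  apply/matrixP => i j; rewrite !mxE big_ord1 !mxE mulr1.
  have -> : \sum_k edge_mx v i k * (edge_mx v)^T k j =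
     (\sum_k (v (lift 0 i) 0 k - v 0 0 k) ^+ 2 + \sum_k (v (lift 0 j) 0 k - v 0 0 k) ^+ 2
      - \sum_k (v (lift 0 i) 0 k - v (lift 0 j) 0 k) ^+ 2) / 2.
    rewrite -big_split/= -sumrB mulr_suml; apply: eq_bigr => k _; rewrite !mxE.
    by field.
  rewrite (dist (lift 0 i) 0) ?lift0F// (dist (lift 0 j) 0) ?lift0F//; have [->|ij] := eqVneq i j.
    rewrite big1 ?subr0 => [|k _]; last by rewrite subrr expr0n.
    by rewrite /=; field.
  by rewrite dist ?(inj_eq lift_inj)//=; field.
have : \det (edge_mx v *m (edge_mx v)^T) != 0.
  rewrite gram detZ det_1_add_mul mxE (eq_bigr (fun=> 1)); last first.
    by move=> k _; rewrite !mxE mulr1.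
  rewrite sumr_const card_ord mulf_neq0 ?expf_neq0 ?mulf_neq0 ?invr_eq0 ?pnatr_eq0 ?gt_eqF//.
rewrite det_mulmx mulf_eq0 negb_or => /andP[h _].
by rewrite unitmxE unitfE.
Qed.

Lemma simplex_affine n (v : 'I_n.+1 -> 'rV[R]_n) x : edge_mx v \in unitmx ->
  simplex v (x *m edge_mx v + v 0) <-> std_simplex n x.
Proof.
move=> uA.
have E (t : 'I_n.+1 -> R) : \sum_i t i = 1 ->
    \sum_i t i *: v i = (\row_k t (lift 0 k)) *m edge_mx v + v 0.
  have recl (V : nmodType) (F : 'I_n.+1 -> V) :
    \sum_i F i = F 0 + \sum_(k < n) F (lift 0 k) by exact: big_ord_recl.
  rewrite !recl => t1; apply/rowP => j; rewrite !mxE summxE.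
  under eq_bigr do rewrite mxE.
  under [in RHS]eq_bigr do rewrite !mxE mulrBr.
  rewrite sumrB -mulr_suml -(addrK (\sum_(i < n) t (lift 0 i)) (t 0)) t1; ring.
split=> [[t [t0 t1]]|[x0 x1]].
  rewrite E// => /addIr /(can_inj (mulmxK uA)) ->; split=> [i|]; first by rewrite mxE.
  under eq_bigr do rewrite mxE.
  by rewrite -t1 big_ord_recl lerDr.
pose t i := if unlift (0 : 'I_n.+1) i is Some k then x 0 k else 1 - \sum_k x 0 k.
have tl k : t (lift 0 k) = x 0 k by rewrite /t liftK.
have tz : t 0 = 1 - \sum_k x 0 k by rewrite /t unlift_none.
have s1 : \sum_i t i = 1.
  rewrite big_ord_recl (eq_bigr (fun k => x 0 k)); last by move=> k _; exact: tl.
  by rewrite -[t ord0]/(t 0) tz subrK.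
exists t; split=> //.
  by move=> i; case: (unliftP 0 i) => [k ->|->]; rewrite ?tl// tz subr_ge0.
rewrite E//; congr (_ *m _ + _); apply/rowP => k.
by rewrite mxE tl.
Qed.

Lemma measurable_simplex n (v : 'I_n.+1 -> 'rV[R]_n) : edge_mx v \in unitmx ->
  measurable (simplex v).
Proof.
move=> uA; rewrite (_ : simplex v =
    (fun y => y *m invmx (edge_mx v) + - v 0 *m invmx (edge_mx v)) @^-1` std_simplex n).
  by apply: measurable_sectionT; [exact: measurable_affine|exact: measurable_std_simplex].
apply/seteqP; split=> y /=; rewrite -(simplex_affine _ uA) -mulmxDl mulmxKV// subrK//.
Qed.

Lemma simplex_has_momx n (v : 'I_n.+1 -> 'rV[R]_n) : edge_mx v \in unitmx ->
  has_momx (\1_(simplex v) : _ -> R)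
   (`|\det (edge_mx v)| *: ((block_mx (1%:M : 'M[R]_1) (v 0) 0 (edge_mx v))^T *m
     std_simplex_momx n *m (block_mx (1%:M : 'M[R]_1) (v 0) 0 (edge_mx v)))).
Proof.
move=> uA; apply: has_momx_affine (std_simplex_has_momx n) _ => //.
  by apply: measurable_indic; exact: measurable_simplex.
by move=> x; apply: indic_eq; exact: simplex_affine.
Qed.

(** The simplex is an invertible affine image of [std_simplex n], and the ratio of moments is affine
    invariant. *)
Lemma regular_simplex_momx n (S : set 'rV[R]_n) : regular_simplex S ->
  exists2 M, [/\ measurable S, has_momx (\1_S : _ -> R) M & 0 < M 0 0] &
    \det M = M 0 0 ^+ n.+3 * simplex_constant n.
Proof.
move=> [v [-> [l l0 hl]]]; have uA := regular_edge_mx_unit l0 hl.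
have hM := simplex_has_momx uA; have mS := measurable_simplex uA.
have d0 : 0 < `|\det (edge_mx v)| by rewrite normr_gt0 -unitfE -unitmxE.
have m00 := mass_momx_affine uA (std_simplex_has_momx n) hM
  (fun x => indic_eq (simplex_affine x uA)).
eexists; first split; [exact: mS|exact: hM| |].
  by rewrite m00 ?std_simplex_momx00 ?mulr_gt0 ?invr_gt0 ?ltr0n ?fact_gt0.
rewrite det_momx_affine det_std_simplex_momx m00.
rewrite exprMn mulrA mulrA; congr (_ * _).
rewrite -[\det _ ^+ 2]real_normK ?num_real// -exprD addn2//.
Qed.

Lemma L_regular_simplex n (S : set 'rV[R]_n) : regular_simplex S ->
  L_body S = simplex_constant n `^ (2 * n%:R)^-1.
Proof.
move=> /regular_simplex_momx[M [mS hM M0] dM].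
rewrite (L_bodyE mS hM M0) dM mulrAC divff ?mul1r//.
by rewrite expf_neq0// gt_eqF.
Qed.

Lemma simplex_constantE n : (1 <= n)%N -> simplex_constant n `^ (2 * n%:R)^-1 =
  n`!%:R `^ (n%:R)^-1 / (n.+1%:R `^ (n.+1%:R / (2 * n%:R)) * Num.sqrt n.+2%:R).
Proof.
move=> n1; have n0 : n%:R != 0 :> R by rewrite pnatr_eq0 -lt0n.
have E : (n%:R : R)^-1 = 2 * (2 * n%:R)^-1 by rewrite invfM mulrA divff ?mul1r.
rewrite /simplex_constant; set e := (2 * n%:R)^-1.
have p0 : 0 < (n.+1%:R ^+ n.+1 * n.+2%:R ^+ n : R) by rewrite mulr_gt0 ?exprn_gt0 ?ltr0n.
rewrite powRM; [|by rewrite exprn_ge0|by rewrite invr_ge0 ltW].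
rewrite E powRrM (powR_mulrn 2)//; congr (_ * _).
rewrite powRrM powR_mulrn// -powR12_sqrt//.
have -> : (2^-1 : R) = n%:R * e by rewrite /e invfM mulrCA mulfV ?mulr1.
rewrite powRrM powR_mulrn// -powRM ?exprn_ge0//.
by rewrite -[in LHS]powR_inv1 ?(ltW p0)// -powRrM mulN1r powRN.
Qed.

Lemma simplex_constant_gt0 n : 0 < simplex_constant n.
Proof.
by rewrite divr_gt0 ?mulr_gt0 ?exprn_gt0 ?ltr0n// fact_gt0.
Qed.

End simplex.

Section exponential_density.
Context {R : realType}.
Local Notation mu := (borel_lebesgue R).

Definition exp_density n (x : 'rV[R]_n) : R :=
  \prod_i (\1_(`[0, +oo[%classic) (x 0 i) * expR (- x 0 i)).

Definition exp_momx n : 'M[R]_n.+1 := \matrix_(i, j) ((i == j) && (i != 0)).+1%:R.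

Lemma exp_density_has_momx n : has_momx (@exp_density n) (exp_momx n).
Proof.
have m1 : measurable_fun setT (fun s : R => \1_(`[0, +oo[%classic) s * expR (- s)).
  by apply: measurable_funM; [exact: measurable_indic|exact: measurableT_comp].
have mE : measurable_fun setT (@exp_density n).
  apply: measurable_prod => i _; apply: (measurableT_comp m1).
  exact: measurable_coord.
split=> // i j; rewrite mxE.
pose a k := ((i == lift 0%R k) + (j == lift 0%R k))%N.
pose u (k : 'I_n) (s : R) : R := \1_(`[0, +oo[%classic) s * (s ^+ a k * expR (- s)).
have -> : (fun x => exp_density x * (homog x 0 i * homog x 0 j)) =
    (fun x => \prod_k u k (x 0 k)).
  apply/funext => x; rewrite homog_monomial2 -big_split/=; apply: eq_bigr => k _.
  by rewrite -[RHS]/(_ * (x 0 k ^+ a k * _)) [in RHS](mulrC (x 0 k ^+ a k)) mulrA.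
have mu_ k : measurable_fun setT (u k).
  apply: measurable_funM; first exact: measurable_indic.
  by apply: measurable_funM => //; exact: measurableT_comp.
have u0 k s : 0 <= u k s.
  rewrite /u indicE mem_setE in_itv/= andbT; case: (leP 0 s) => s0; rewrite ?mul0r//.
  by rewrite mul1r mulr_ge0 ?expR_ge0// exprn_ge0.
apply: ge0_has_integral.
- by apply: measurable_prod => k _; apply: (measurableT_comp (mu_ k)); exact: measurable_coord.
- by move=> x; exact: prodr_ge0.
- rewrite ge0_integral_prod// (eq_bigr (fun k => (a k)`!%:R%:E)); last first.
    by move=> k _; rewrite integral_gamma_c.
  by rewrite prodEFin prod_fact_delta.
Qed.

Lemma det_exp_momx n : \det (exp_momx n) = 1.
Proof.
have sM i j : exp_momx n i j = exp_momx n j i.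
  by have := has_momx_sym i j (exp_density_has_momx n).
have e00 : exp_momx n 0 0 = 1 by rewrite mxE eqxx.
rewrite (momx_block sM) e00 det_block_schur ?oner_eq0// expr1n mul1r invr1 !scale1r.
rewrite -[RHS](det1 R n); congr (\det _); apply/matrixP => i j.
rewrite !mxE big_ord1 !mxE (inj_eq lift_inj) lift0F andbT !eq_liftF /= mulr1.
by case: (i == j) => /=; rewrite ?subrr // -natr1 addrK.
Qed.

(** [f0] is [expR n%:R] times the exponential density of the orthant, translated by -1 in each
    coordinate. The shape, with its factor [\det 1], is the one produced by [has_momx_affine]. *)
Definition f0_momx n : 'M[R]_n.+1 :=
  let B := block_mx (1%:M : 'M[R]_1) (const_mx (-1)) 0 1%:M in
  `|\det (1%:M : 'M[R]_n)| *: (B^T *m (expR n%:R *: exp_momx n) *m B).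

Lemma f0_shift n (x : 'rV[R]_n) : f0 (x *m 1%:M + const_mx (-1)) = expR n%:R * exp_density x.
Proof.
rewrite /f0 /exp_density mulmx1 big_split/= -expR_sum mulrCA [in RHS]mulrC; congr (_ * _); last first.
  have [h|h] := pselect (forall i, 0 <= x 0 i).
    rewrite indicE mem_set/= => [|i]; last by rewrite !mxE lerDr.
    by rewrite big1// => i _; rewrite indicE mem_setE in_itv/= h.
  rewrite indicE memNset/= => [|h']; last by apply: h => i; have := h' i; rewrite !mxE lerDr.
  have /existsNP[i xi] := h; rewrite (bigD1 i)//= indicE mem_setE in_itv/= andbT.
  by rewrite (negbTE (introN idP xi)) mul0r.
rewrite -expRD; congr expR; under eq_bigr do rewrite !mxE.
by rewrite big_split/= sumr_const card_ord sumrN opprD addrC mulNrn opprK.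
Qed.

Lemma measurable_f0 n : measurable_fun setT (@f0 R n).
Proof.
have -> : @f0 R n = fun y => expR n%:R * exp_density (y *m 1%:M + const_mx 1).
  apply/funext => y; rewrite -f0_shift !mulmx1 -addrA; congr f0.
  by apply/rowP => i; rewrite !mxE subrr addr0.
apply: measurable_funM => //; apply: (measurableT_comp (exp_density_has_momx n).1).
exact: measurable_affine.
Qed.

Lemma f0_has_momx n : has_momx (@f0 R n) (f0_momx n).
Proof.
apply: has_momx_affine (has_momxZ _ (exp_density_has_momx n)) _.
- exact: unitmx1.
- exact: measurable_f0.
- exact: f0_shift.
Qed.

Lemma f0_ge0 n (x : 'rV[R]_n) : 0 <= f0 x.
Proof. by rewrite mulr_ge0 ?expR_ge0// indic_ge0. Qed.

Lemma f0_momx00 n : f0_momx n 0 0 = expR n%:R.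
Proof.
rewrite (mass_momx_affine (unitmx1 _ _) (has_momxZ _ (exp_density_has_momx n))
  (f0_has_momx n) (@f0_shift n)).
by rewrite det1 normr1 mul1r !mxE eqxx /= mulr1.
Qed.

(** An exponential variable has mean 1, which the translation removes. As [ln f0] is minus the
    coordinate sum on the support, this also makes the entropy of [f0] vanish. *)
Lemma f0_momx0_lift n k : f0_momx n 0 (lift 0 k) = 0.
Proof.
have [_ h] := f0_has_momx n; have {h}[_ <-] := h 0 (lift 0 k).
have [_ h] := exp_density_has_momx n.
have h1 := has_integralB (has_integralZ (expR n%:R) (h 0 (lift 0 k))) (has_integralZ (expR n%:R) (h 0 0)).
have [_ ->] : has_integral (mu n) (fun x => f0 x * (homog x 0 0 * homog x 0 (lift 0 k)))
   (`|\det (1%:M : 'M[R]_n)| * 0).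
  apply: (affine_has_integral (b := const_mx (-1)) (unitmx1 _ _)).
    apply: measurable_funM; first exact: measurable_f0.
    by apply: measurable_funM; exact: measurable_homog.
  move: h1; rewrite !mxE !eqxx !andbF /= subrr.
  congr has_integral; apply/funext => x.
  by rewrite f0_shift /homog !cons_row0 !cons_rowS mulmx1 !mxE; ring.
by rewrite mulr0.
Qed.

Lemma det_f0_momx n : \det (f0_momx n) = expR n%:R ^+ n.+1.
Proof. by rewrite det_momx_affine det1 normr1 !expr1n !mul1r detZ det_exp_momx mulr1. Qed.

Lemma ln_f0 n (x : 'rV[R]_n) : f0 x * ln (f0 x) = - (f0 x * \sum_i x 0 i).
Proof.
rewrite /f0 indicE; case: (_ \in _); last by rewrite !mulr0 !mul0r oppr0.
by rewrite mulr1 expRK mulrN.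
Qed.

Lemma entropy_f0 n : entropy (@f0 R n) = 0.
Proof.
have [mf h] := f0_has_momx n.
rewrite /entropy; have -> : \int[lebesgue R n]_x (f0 x * ln (f0 x)) = 0; last by rewrite oppr0 mul0r.
under eq_Rintegral do rewrite ln_f0.
have hs : has_integral (mu n) (fun x => - (f0 x * \sum_i x 0 i)) 0.
  have := has_integralZ (-1) (has_integral_sum (index_enum 'I_n) (fun k => h 0 (lift 0 k))).
  rewrite big1 ?mulr0 => [|k _]; last exact: f0_momx0_lift.
  congr has_integral; apply/funext => x; rewrite mulN1r mulr_sumr; congr (- _).
  by apply: eq_bigr => k _; rewrite /homog cons_row0 cons_rowS mul1r.
rewrite Rintegral_lebesgue; [exact: hs.2|exact: has_integral_measurable hs|exact: hs.1].
Qed.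

Lemma Lhat_f0 n : (1 <= n)%N -> Lhat (@f0 R n) = expR (-1).
Proof.
move=> n1; have hM := f0_has_momx n.
have mf := measurable_fun_lebesgue (@measurable_f0 n).
rewrite (LhatE measurable0 (measure0 _) _ mf hM)//; last 2 first.
- by rewrite f0_momx00 expR_gt0.
- exact: f0_ge0.
rewrite entropy_f0 mulr0 oppr0 expR0 mul1r det_f0_momx f0_momx00.
have -> : expR n%:R ^+ n.+1 / expR n%:R ^+ n.+3 = expR (- (2 * n%:R)) :> R.
  rewrite -!expRM_natl -expRN -expRD; congr expR.
  by rewrite -[n.+3]addn2 natrD; ring.
have n0 : (2 * n%:R : R) != 0 by rewrite mulf_neq0// pnatr_eq0 -lt0n.
by rewrite -expRM mulNr divff.
Qed.

End exponential_density.

Section cone_density.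
Context {R : realType}.
Local Notation mu := (borel_lebesgue R).

(* The moments of [cone K] are those of [K] times [\int s ^ k e^-s ds]. *)
Definition cone_momx n (M : 'M[R]_n.+1) : 'M[R]_n.+2 :=
  block_mx ((n`!%:R * M 0 0)%:M : 'M[R]_1) (n.+1`!%:R *: row 0 M)
    (n.+1`!%:R *: col 0 M) (n.+2`!%:R *: M) : 'M[R]_(1 + n.+1).

Lemma cone_momxE n (M : 'M[R]_n.+1) :
  [/\ cone_momx M 0 0 = n`!%:R * M 0 0,
      forall j, cone_momx M 0 (lift 0 j) = n.+1`!%:R * M 0 j,
      forall i, cone_momx M (lift 0 i) 0 = n.+1`!%:R * M i 0 &
      forall i j, cone_momx M (lift 0 i) (lift 0 j) = n.+2`!%:R * M i j].
Proof.
have l0 (k : 'I_1) : 0 = lshift n.+1 k by rewrite (ord1 k); exact: val_inj.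
have r0 (k : 'I_n.+1) : lift 0 k = rshift 1 k by exact: val_inj.
split=> [|j|i|i j]; rewrite /cone_momx ?r0 ?(l0 0).
- by rewrite (@block_mxEul R 1 n.+1 1 n.+1) !mxE eqxx.
- by rewrite (@block_mxEur R 1 n.+1 1 n.+1) !mxE.
- by rewrite (@block_mxEdl R 1 n.+1 1 n.+1) !mxE.
- by rewrite (@block_mxEdr R 1 n.+1 1 n.+1) !mxE.
Qed.

(* Subtracting 1/(n+2) times the second row from the first one clears all of the
   first row but its corner. *)
Lemma det_cone_momx n (M : 'M[R]_n.+1) :
  \det (cone_momx M) = n`!%:R * M 0 0 / n.+2%:R * (n.+2`!%:R ^+ n.+1 * \det M).
Proof.
pose U : 'M[R]_(1 + n.+1) := block_mx (1%:M : 'M[R]_1) (- n.+2%:R^-1 *: delta_mx 0 0) 0 1%:M.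
have n2 : n.+2%:R != 0 :> R by rewrite pnatr_eq0.
have UC : U *m cone_momx M = block_mx ((n`!%:R * M 0 0 / n.+2%:R)%:M : 'M[R]_1) 0
    (n.+1`!%:R *: col 0 M) (n.+2`!%:R *: M).
  rewrite /U /cone_momx [LHS](@mulmx_block R 1 n.+1 1 n.+1 1 n.+1) !mul0mx !mul1mx !add0r.
  rewrite -!scalemxAl -!scalemxAr -!rowE !scaleNr.
  have -> : (n`!%:R * M 0 0)%:M - n.+2%:R^-1 *: (n.+1`!%:R *: row 0 (col 0 M)) =
      (n`!%:R * M 0 0 / n.+2%:R)%:M :> 'M[R]_1.
    apply/matrixP => i j; rewrite (ord1 i) (ord1 j) !mxE eqxx !mulr1n factS natrM.
    by rewrite -natr1 in n2 *; field; rewrite -?natr1.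
  have -> : n.+1`!%:R *: row 0 M - n.+2%:R^-1 *: (n.+2`!%:R *: row 0 M) = 0.
    by rewrite scalerA [in n.+2`!%:R]factS natrM mulKf// subrr.
  by [].
have dU : \det U = 1 by rewrite det_ublock !det1 mulr1.
have e : \det (U *m cone_momx M) = \det U * \det (cone_momx M) by exact: det_mulmx.
by move: e; rewrite dU mul1r => <-; rewrite UC det_lblock det_scalar1 detZ.
Qed.

Lemma homog_cone n (z : 'rV[R]_n.+1) i :
  z 0 i = z 0 0 ^+ (i == 0) * homog (@rsubmx R 1 1 n z) 0 i.
Proof.
rewrite -{1}(uncons_rowK z) /uncons_row /homog.
have [k ->|->] := unliftP 0 i.
  by rewrite !cons_rowS lift0F mul1r.
by rewrite !cons_row0 eqxx expr1 mulr1.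
Qed.

Lemma homog_scale n (x : 'rV[R]_n) s i : homog (s *: x) 0 i = s ^+ (i != 0) * homog x 0 i.
Proof.
rewrite /homog; have [k ->|->] := unliftP 0 i.
  by rewrite !cons_rowS lift0F mxE.
by rewrite !cons_row0 eqxx mulr1.
Qed.

(** On the cone [(s, x)] is [s] times [(1, x / s)], so each lifted index contributes one power of
    [s], whether it denotes the height or a coordinate of [x]. Hence the factorial depends only on
    the number of lifted indices. *)
Lemma cone_has_momx n (K : set 'rV[R]_n) M : measurable K ->
  has_momx (\1_K : _ -> R) M -> has_momx (cone K) (cone_momx M).
Proof.
move=> mK [_ hM]; split; first exact: measurable_cone.
have [e00 e0l el0 ell] := cone_momxE M.
have H i j a : has_integral (mu n.+1) (fun z => cone K z * (z 0 0 ^+ a *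
      (homog (@rsubmx R 1 1 n z) 0 i * homog (@rsubmx R 1 1 n z) 0 j)))
    ((n + a + ((i != 0) + (j != 0)))`!%:R * M i j).
  apply: has_integral_cone (hM i j) => //.
    by apply: measurable_funM; exact: measurable_homog.
  by move=> s x s0; rewrite !homog_scale exprD; ring.
have e1 z : homog z 0 0 = 1 :> R by rewrite /homog cons_row0.
have el z (i : 'I_n.+1) : homog z 0 (lift 0 i) =
    z 0 0 ^+ (i == 0) * homog (@rsubmx R 1 1 n z) 0 i :> R.
  by rewrite {1}/homog cons_rowS; exact: homog_cone.
have bb (i : 'I_n.+1) : ((i == 0%R) + (i != 0%R) = 1)%N by case: (i == 0).
move=> i j; have [k ->|->] := unliftP 0 i; have [l ->|->] := unliftP 0 j.
- have := H k l ((k == 0%R) + (l == 0%R))%N; rewrite ell.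
  rewrite (_ : (n + _ + _ = n.+2)%N); last by rewrite -addnA addnACA !bb addn2.
  congr has_integral; apply/funext => z; rewrite !el exprD; ring.
- have := H k 0 (k == 0 : nat); rewrite el0 eqxx addn0.
  rewrite (_ : (n + _ + _ = n.+1)%N); last by rewrite -addnA bb addn1.
  congr has_integral; apply/funext => z; rewrite el !e1; ring.
- have := H 0 l (l == 0 : nat); rewrite e0l eqxx add0n.
  rewrite (_ : (n + _ + _ = n.+1)%N); last by rewrite -addnA bb addn1.
  congr has_integral; apply/funext => z; rewrite el !e1; ring.
- have := H 0 0 0%N; rewrite e00 eqxx !addn0.
  congr has_integral; apply/funext => z; rewrite !e1; ring.
Qed.

Lemma ln_cone n (K : set 'rV[R]_n) z : cone K z * ln (cone K z) = - (cone K z * z 0 0).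
Proof.
rewrite /cone !indicE; case: (_ \in _); last by rewrite !mul0r oppr0.
case: (_ \in _); last by rewrite !mulr0 !mul0r oppr0.
by rewrite mul1r mulr1 expRK mulrN.
Qed.

(** Division of the averaged point by the averaged height gives a convex combination of the two
    normalized points, with weights proportional to [t * s1] and [(1 - t) * s2]. It serves both the
    cone over [K] and the fibres of the body over a density. *)
Lemma convex_cone_ray n (K : set 'rV[R]_n) (s1 s2 t : R) (x1 x2 : 'rV[R]_n) :
  convex_set K -> 0 <= t <= 1 -> 0 < s1 -> 0 < s2 ->
  K (s1^-1 *: x1) -> K (s2^-1 *: x2) ->
  K ((t * s1 + (1 - t) * s2)^-1 *: (t *: x1 + (1 - t) *: x2)).
Proof.
move=> /convex_rowP cK /andP[t0 t1] s10 s20 K1 K2.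
set s := t * s1 + (1 - t) * s2.
have s0 : 0 < s.
  rewrite /s; have [->|tn] := eqVneq t 0; first by rewrite mul0r add0r subr0 mul1r.
  by rewrite ltr_wpDr ?mulr_ge0 ?subr_ge0 ?(ltW s20)// mulr_gt0// lt_def tn.
have -> : s^-1 *: (t *: x1 + (1 - t) *: x2) =
    (t * s1 / s) *: (s1^-1 *: x1) + (1 - t * s1 / s) *: (s2^-1 *: x2).
  rewrite scalerDr !scalerA; congr (_ *: _ + _ *: _).
    by field; rewrite !gt_eqF.
  have -> : 1 - t * s1 / s = (1 - t) * s2 / s.
    by rewrite -[1 in LHS](divff (lt0r_neq0 s0)) -mulrBl /s addrAC subrr add0r.
  by field; rewrite !gt_eqF.
apply: cK => //; apply/andP; split; first by rewrite divr_ge0 ?mulr_ge0// ltW.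
by rewrite ler_pdivrMr// mul1r /s lerDl mulr_ge0 ?subr_ge0// ltW.
Qed.

Lemma cone_log_concave n (K : set 'rV[R]_n) : convex_set K -> log_concave (cone K).
Proof.
move=> cK.
pose D : set 'rV[R]_n.+1 := [set z : 'rV[R]_n.+1 | 0 < z 0 0 /\ K ((z 0 0)^-1 *: @rsubmx R 1 1 n z)].
pose phi z := if z \in D then (z 0 0)%:E else +oo%E.
exists phi; split.
- by move=> z; rewrite /phi; case: ifP => _; rewrite ?ltNyr.
- move=> x y t t01; have [t0 t1] := andP t01.
  (* For [0 < t < 1] an infinite value of [phi] makes the right-hand side infinite; the endpoints
     are treated apart because of the convention that 0 times infinity is 0. *)
  have [->|tn0] := eqVneq t 0; first by rewrite scale0r add0r subr0 scale1r mul0e add0e mul1e.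
  have [->|tn1] := eqVneq t 1; first by rewrite scale1r subrr scale0r addr0 mul1e mul0e adde0.
  have tp : 0 < t by rewrite lt_def tn0.
  have tp' : 0 < 1 - t by rewrite subr_gt0 lt_neqAle tn1.
  rewrite {2}/phi; case: ifPn => [/set_mem[x0 Kx]|_]; last first.
    rewrite gt0_muley ?lte_fin// addye ?leey// /phi.
    by case: ifPn => _; rewrite // gt0_muley ?lte_fin.
  rewrite {2}/phi; case: ifPn => [/set_mem[y0 Ky]|_]; last first.
    by rewrite gt0_muley ?lte_fin// -EFinM addey// leey.
  rewrite /phi mem_set; first by rewrite -!EFinM -EFinD lee_fin !mxE.
  split; first by rewrite !mxE addr_gt0// mulr_gt0.
  have := convex_cone_ray cK t01 x0 y0 Kx Ky; congr K.
  by rewrite !mxE; congr (_ *: _); rewrite linearD !linearZ.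
- move=> z; rewrite /phi /cone !indicE mem_setE in_itv/= andbT.
  case: ifPn => [/set_mem[z0 Kz]|zD].
    by rewrite z0 mem_set// mul1r mulr1.
  rewrite /=; congr EFin; case: (ltP 0 (z 0 0)) => z0; last by rewrite !mul0r.
  rewrite memNset ?mulr0// => Kz; move/negP: zD; apply.
  by apply/mem_set.
Qed.

(** On its support the density has logarithm minus the height, so the entropy is the mean height,
    [n.+1]! / n[! = n.+1]. *)
Lemma entropy_cone n (K : set 'rV[R]_n) M : measurable K ->
  has_momx (\1_K : _ -> R) M -> 0 < M 0 0 -> entropy (cone K) = n.+1%:R.
Proof.
move=> mK hM M0; have [mC hC] := cone_has_momx mK hM.
have [e00 e0l _ _] := cone_momxE M.
have mC' := measurable_fun_lebesgue mC.
rewrite /entropy (integral_funE measurable0 (measure0 _) _ mC' (conj mC hC))// e00.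
have hs : has_integral (mu n.+1) (fun z => - (cone K z * z 0 0)) (- (n.+1`!%:R * M 0 0)).
  have := has_integralZ (-1) (hC 0 (lift 0 0)); rewrite e0l mulN1r.
  by congr has_integral; apply/funext => z; rewrite mulN1r /homog cons_row0 cons_rowS mul1r.
under eq_Rintegral do rewrite ln_cone.
rewrite Rintegral_lebesgue; [rewrite hs.2|exact: has_integral_measurable hs|exact: hs.1].
rewrite opprK factS natrM; have f0 : n`!%:R != 0 :> R by rewrite pnatr_eq0 -lt0n fact_gt0.
by rewrite -mulrA mulfK// mulf_neq0// gt_eqF.
Qed.

Lemma powR_le_inj (a b p : R) : 0 < p -> 0 <= a -> 0 <= b -> a `^ p <= b `^ p -> a <= b.
Proof.
move=> p0 a0 b0; apply: contraTT; rewrite -!ltNge => ba.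
by apply: gt0_ltr_powR => //; rewrite nnegrE.
Qed.

(** The cone has entropy [n.+1], and its factor [expR (- (2 * n.+1%:R))] is exactly the
    [2 (n + 1)]-th power of [expR (-1)]. After cancellation [\det (cone_momx M) <= cone_momx M 0 0
    ^+ n.+4] remains, and expanding both sides gives the constant of the simplex. *)
Lemma L_body_le_simplex_constant n (K : set 'rV[R]_n) : (1 <= n)%N -> convex_body K ->
  (forall f : 'rV[R]_n.+1 -> R, integrable_log_concave f -> Lhat f <= expR (-1)) ->
  L_body K <= simplex_constant n `^ (2 * n%:R)^-1.
Proof.
move=> n1 [cK vK iK] H.
have mK := compact_row_measurable cK.
have [B B0 KB] := bounded_cube (compact_bounded cK).
have [M hM] := bounded_has_momx mK KB.
have M0 := has_momx_mass_gt0 mK iK hM.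
have dM : 0 <= \det M by apply: has_momx_psd hM _ => x; exact: indic_ge0.
rewrite (L_bodyE mK hM M0).
have hC := cone_has_momx mK hM; have [e00 _ _ _] := cone_momxE M.
have f0 : 0 < n`!%:R :> R by rewrite ltr0n fact_gt0.
have C0 : 0 < cone_momx M 0 0 by rewrite e00 mulr_gt0.
have mC' := measurable_fun_lebesgue hC.1.
have ilc : integrable_log_concave (cone K).
  split; first exact: cone_log_concave.
  - by apply/integrable_lebesgue; [exact: hC.1|exact: (has_momx_mass hC).1].
  - by rewrite (integral_funE measurable0 (measure0 _) _ mC' hC).
have := H _ ilc; rewrite (LhatE measurable0 (measure0 _) _ mC' hC)//; last exact: cone_ge0.
rewrite (entropy_cone mK hM M0) det_cone_momx e00 => h.
have q0 : 0 < (2 * n.+1%:R : R)^-1 by rewrite invr_gt0 mulr_gt0.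
have e1 : expR (-1) = expR (- (2 * n.+1%:R)) `^ (2 * n.+1%:R)^-1 :> R.
  by rewrite -expRM mulNr divff// mulf_neq0// pnatr_eq0.
rewrite e1 in h; move/powR_le_inj : h => /(_ q0).
set c := expR _; have c0 : 0 < c by exact: expR_gt0.
have n2 : 0 < n.+2%:R :> R by rewrite ltr0n.
have g0 : 0 < n.+2`!%:R :> R by rewrite ltr0n fact_gt0.
have Z0 : 0 <= n`!%:R * M 0 0 / n.+2%:R * (n.+2`!%:R ^+ n.+1 * \det M).
  by rewrite mulr_ge0 ?divr_ge0 ?mulr_ge0 ?exprn_ge0// ltW.
have P0 : 0 < (n`!%:R * M 0 0) ^+ n.+4 by rewrite exprn_gt0// mulr_gt0.
have A0 : 0 <= c * (n`!%:R * M 0 0 / n.+2%:R * (n.+2`!%:R ^+ n.+1 * \det M)) /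
    (n`!%:R * M 0 0) ^+ n.+4.
  by rewrite divr_ge0 ?(ltW P0)// mulr_ge0// ltW.
move=> /(_ A0 (ltW c0)); rewrite -mulrA ger_pMr// ler_pdivrMr// mul1r => h.
apply: ge0_ler_powR; rewrite ?nnegrE ?invr_ge0 ?mulr_ge0//.
  by rewrite invr_ge0 exprn_ge0// ltW.
rewrite ler_pdivrMr ?exprn_gt0//.
have M3 : 0 < n`!%:R * M 0 0 by rewrite mulr_gt0.
have h2 : n.+2`!%:R ^+ n.+1 * \det M <= (n`!%:R * M 0 0) ^+ n.+3 * n.+2%:R.
  rewrite -(ler_pM2l (divr_gt0 M3 n2)) (le_trans h)// le_eqVlt; apply/orP; left; apply/eqP.
  by rewrite [in LHS]exprS; field; rewrite gt_eqF.
rewrite -(ler_pM2l (exprn_gt0 n.+1 g0)) (le_trans h2)// le_eqVlt; apply/orP; left; apply/eqP.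
rewrite /simplex_constant !factS !natrM exprMn [(n.+2%:R * _) ^+ _]exprMn.
rewrite [(n.+1%:R * _) ^+ _]exprMn (_ : n`!%:R ^+ n.+3 = n`!%:R ^+ n.+1 * n`!%:R ^+ 2); last by rewrite -exprD addn2.
rewrite [n.+2%:R ^+ n.+1]exprS.
by field; rewrite ?expf_neq0 ?gt_eqF// ltr0n.
Qed.

End cone_density.

(** * Boundaries of convex sets *)

Section convex_topology.
Context {R : realType}.
Local Notation mu := (borel_lebesgue R).

(** If some coefficient after the first is nonzero, every slice at fixed first coordinate is a
    hyperplane one dimension lower; otherwise each line in the first direction meets the set in a
    single point. *)
Lemma hyperplane_null n (a : 'I_n -> R) b i0 : a i0 != 0 ->
  mu n [set x | \sum_i x 0 i * a i = b] = 0%E.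
Proof.
have mH k (a' : 'I_k -> R) b' : measurable [set x : 'rV[R]_k | \sum_i x 0 i * a' i = b'].
  apply: (@measurable_sectionT _ _ _ _ (fun x : 'rV[R]_k => \sum_i x 0 i * a' i) [set b']) => //.
  by apply: measurable_sum => i; apply: measurable_funM => //; exact: measurable_coord.
elim: n a b i0 => [a b []//|n IH a b i0 ai0].
rewrite -[X in mu _ X]setIT -integral_indic; [|exact: measurableT|exact: mH].
have consE s v : (\sum_i cons_row (s, v) 0 i * a i = b) <->
    (\sum_i v 0 i * a (lift 0 i) = b - s * a 0).
  rewrite big_ord_recl cons_row0; under eq_bigr do rewrite cons_rowS.
  by split=> [<-|->]; [rewrite [s * _ + _]addrC addrK|rewrite addrC subrK].
have [[i ai]|na] := pselect (exists i, a (lift 0 i) != 0).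
  rewrite ge0_integral_row1; last 2 first.
  - by apply/measurable_EFinP; apply: measurable_indic; exact: mH.
  - by move=> x; rewrite lee_fin indic_ge0.
  apply: integral0_eq => s _.
  rewrite -(IH (fun i => a (lift 0 i)) (b - s * a 0) i ai) -[X in mu _ X]setIT -integral_indic; [|exact: measurableT|exact: mH].
  by apply: eq_integral => v _; congr (_%:E); apply: indic_eq; exact: consE.
have a0 : a 0 != 0.
  by have [k E|E] := unliftP 0 i0; [case: na; exists k; rewrite -E|rewrite -E].
rewrite ge0_integral_row2; last 2 first.
- by apply/measurable_EFinP; apply: measurable_indic; exact: mH.
- by move=> x; rewrite lee_fin indic_ge0.
apply: integral0_eq => v _.
rewrite -(lebesgue_measure_set1 (b / a 0)) -[X in lebesgue_measure X]setIT -integral_indic//.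
apply: eq_integral => s _; congr (_%:E); apply: indic_eq; rewrite /= (consE s v).
rewrite big1 => [|i _]; last first.
  have [->|ai] := eqVneq (a (lift 0 i)) 0; first by rewrite mulr0.
  by case: na; exists i.
split => [/esym/eqP|->]; last by rewrite divfK// subrr.
by rewrite subr_eq0 => /eqP ->; rewrite mulfK.
Qed.

Lemma ler_norm_sumM n (d a : 'I_n -> R) r : (forall i, `|d i| <= r) ->
  `|\sum_i d i * a i| <= r * \sum_i `|a i|.
Proof.
move=> dr; rewrite (le_trans (ler_norm_sum _ _ _))// mulr_sumr ler_sum// => i _.
by rewrite normrM ler_wpM2r.
Qed.

(** Independent differences with [x0] are collected one at a time. If the process stops with [k < n]
    of them, all differences lie in their span, and a nonzero column of the cokernel is normal to
    it. *)
Lemma independent_or_hyperplane n (C : set 'rV[R]_n) x0 :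
  (exists2 A : 'M[R]_n, A \in unitmx & forall i, C (x0 + row i A)) \/
  (exists2 u : 'cV[R]_n, u != 0 & forall x, C x -> (x - x0) *m u = 0).
Proof.
suff H k : (k <= n)%N -> (exists2 A : 'M[R]_(k, n), row_free A & forall i, C (x0 + row i A)) \/
    (exists2 u : 'cV[R]_n, u != 0 & forall x, C x -> (x - x0) *m u = 0).
  by case: (H n (leqnn n)) => [[A]|]; [rewrite row_free_unit; left; exists A|right].
elim: k => [_|k IH kn].
  by left; exists 0; [rewrite /row_free mxrank0|case].
case: (IH (ltnW kn)) => [[A fA CA]|]; last by right.
have [sA|] := pselect (forall x, C x -> (x - x0 <= A)%MS).
  right; have : cokermx A != 0.
    by rewrite -mxrank_eq0 mxrank_coker (eqP fA) subn_eq0 -ltnNge.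
  move=> /matrix0Pn[i [j ij]]; exists (col j (cokermx A)).
    by apply/matrix0Pn; exists i, 0; rewrite mxE.
  by move=> x /sA; rewrite submxE => /eqP e; rewrite colE mulmxA e mul0mx.
move=> /existsNP[x /not_implyP[Cx /negP xA]].
left; exists (col_mx (x - x0) A : 'M[R]_(1 + k, n)); last first.
  move=> i; have [j ->|j ->] := @split_ordP 1 k i.
    by rewrite (etrans (@rowKu _ 1 k n j (x - x0) A) (row_id j _)) addrC subrK.
  by rewrite (@rowKd _ 1 k n j (x - x0) A).
rewrite /row_free eqn_leq rank_leq_row/= -{1}(eqP fA).
have : (col_mx (x - x0) A <= col_mx (x - x0) A)%MS by [].
rewrite col_mx_sub => /andP[xs As].
have : (A < col_mx (x - x0) A)%MS.
  by rewrite ltmxE As/=; apply: contra xA => /(submx_trans xs).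
by rewrite ltmxErank => /andP[].
Qed.

(** The weight missing from 1 rests on [p]; since it is positive, [1 - t a] stays positive when a
    point is split off. *)
Lemma convex_combination_lt n (K : set 'rV[R]_n) (p : 'rV[R]_n) (I : Type) (r : seq I)
    (t : I -> R) (d : I -> 'rV[R]_n) : convex_set K -> K p ->
  (forall i, K (p + d i)) -> (forall i, 0 <= t i) -> \sum_(i <- r) t i < 1 ->
  K (p + \sum_(i <- r) t i *: d i).
Proof.
move=> /convex_rowP cK Kp Kd; elim: r t => [t _ _|a r IH t t0].
  by rewrite big_nil addr0.
rewrite !big_cons => t1.
have s0 : 0 <= \sum_(i <- r) t i by rewrite sumr_ge0.
have ta : t a < 1 by rewrite (le_lt_trans _ t1)// lerDl.
have ta' : 0 < 1 - t a by rewrite subr_gt0.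
have -> : p + (t a *: d a + \sum_(i <- r) t i *: d i) =
    t a *: (p + d a) + (1 - t a) *: (p + \sum_(i <- r) (t i / (1 - t a)) *: d i).
  rewrite !scalerDr addrACA -scalerDl [t a + _]addrC subrK scale1r; congr (_ + (_ + _)).
  rewrite scaler_sumr; apply: eq_bigr => i _.
  by rewrite scalerA mulrC divfK// gt_eqF.
apply: cK => //; first by rewrite t0 ltW.
apply: IH => [i|]; first by rewrite divr_ge0// ltW.
by rewrite -mulr_suml ltr_pdivrMr// mul1r ltrBrDl.
Qed.

Lemma convex_interior_of_unit n (K : set 'rV[R]_n) p (A : 'M[R]_n) :
  convex_set K -> K p -> A \in unitmx -> (forall i, K (p + row i A)) -> K° !=set0.
Proof.
move=> cK Kp uA KA.
pose S := \sum_i \sum_j `|invmx A i j|.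
have S0 : 0 <= S by rewrite sumr_ge0// => i _; rewrite sumr_ge0.
(* The centre has all coordinates [tau] in the basis of rows of [A]. As [S] bounds the inverse
   matrix, the cube of radius [tau / (S + 1)] keeps them between 0 and [2 * tau], with sum at most
   [n / (n + 1) < 1]. *)
pose tau : R := (2 * n.+1%:R)^-1; have tau0 : 0 < tau by rewrite invr_gt0 mulr_gt0.
have S1 : 0 < S + 1 by rewrite ltr_wpDl.
exists (p + const_mx tau *m A); apply: (@cube_interior _ _ _ _ (tau / (S + 1))).
  by rewrite divr_gt0.
move=> x xr; pose t := (x - p) *m invmx A.
have -> : x = p + \sum_i t 0 i *: row i A.
  by rewrite -mulmx_sum_row mulmxKV// addrC subrK.
have tE i : `|t 0 i - tau| <= tau.
  have -> : t 0 i - tau = ((x - (p + const_mx tau *m A)) *m invmx A) 0 i.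
    by rewrite opprD addrA mulmxBl mulmxK// !mxE.
  rewrite mxE (le_trans (ler_norm_sumM _ (r := tau / (S + 1)) _))//.
    by move=> j; move: (xr j); rewrite !mxE.
  rewrite mulrAC ler_pdivrMr// ler_wpM2l// ?(ltW tau0)//.
  rewrite (@le_trans _ _ S)// ?lerDl// /S ler_sum// => j _.
  by rewrite (bigD1 i)//= lerDl sumr_ge0.
have t0 i : 0 <= t 0 i by have := tE i; rewrite ler_norml => /andP[]; lra.
have t2 i : t 0 i <= 2 * tau by have := tE i; rewrite ler_norml => /andP[_]; lra.
apply: convex_combination_lt => //.
rewrite (@le_lt_trans _ _ (\sum_(i < n) 2 * tau))//; first exact: ler_sum.
rewrite sumr_const card_ord -[_ *+ n]mulr_natr /tau invfM mulrA divff// mul1r mulrC.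
by rewrite ltr_pdivrMr// mul1r ltr_nat.
Qed.

Lemma closure_row n (C : set 'rV[R]_n) x r : closure C x -> 0 < r ->
  exists2 c, C c & forall i, `|x 0 i - c 0 i| < r.
Proof.
move=> cx r0; have [c [Cc xc]] := cx _ (nbhsx_ballx x r r0).
by exists c => //; apply/row_ballP.
Qed.

Lemma closure_rowP n (C : set 'rV[R]_n) (x : 'rV[R]_n) :
  (forall r, 0 < r -> exists2 c, C c & forall i, `|x 0 i - c 0 i| < r) -> closure C x.
Proof.
move=> H B /nbhs_ballP[r /= r0 rB]; have [c Cc xc] := H r r0.
by exists c; split => //; apply: rB; apply/row_ballP.
Qed.

Lemma convex_closure n (C : set 'rV[R]_n) : convex_set C -> convex_set (closure C).
Proof.
move=> /convex_rowP cC; apply/convex_rowP => x y t t01 Cx Cy; apply: closure_rowP => r r0.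
have [c1 C1 x1] := closure_row Cx r0; have [c2 C2 y2] := closure_row Cy r0.
exists (t *: c1 + (1 - t) *: c2); first exact: cC.
move=> i; rewrite !mxE; have /andP[t0 t1] := t01.
have -> : t * x 0 i + (1 - t) * y 0 i - (t * c1 0 i + (1 - t) * c2 0 i) =
  t * (x 0 i - c1 0 i) + (1 - t) * (y 0 i - c2 0 i) by ring.
rewrite (le_lt_trans (ler_normD _ _))// !normrM (ger0_norm t0) (@ger0_norm _ (1 - t)) ?subr_ge0//.
have := x1 i; have := y2 i; set a := `|_|; set b := `|_| => ar br.
have [->|tn] := eqVneq t 0; first by rewrite mul0r add0r subr0 mul1r.
have -> : r = t * r + (1 - t) * r by ring.
rewrite ltr_leD//; first by rewrite ltr_pM2l// lt_def tn.
by rewrite ler_wpM2l ?subr_ge0// ltW.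
Qed.

(** The limit point [x] is replaced by a nearby [c] in [C]; a point [q] near the combination is then
    a combination of [c] with a point [p'] that still lies in the cube around [p]. *)
Lemma closure_ray_interior n (C : set 'rV[R]_n) p x e : convex_set C -> C° p ->
  closure C x -> 0 < e <= 1 -> C° (e *: p + (1 - e) *: x).
Proof.
move=> /convex_rowP cC /interior_cube[r r0 rC] Cx /andP[e0 e1].
(* The deviation of [q] and that of [c] each contribute at most [e * r / 2], and solving for [p']
   divides by [e]. *)
have d0 : 0 < e * r / 2 by rewrite divr_gt0// mulr_gt0.
have [c Cc xc] := closure_row Cx d0.
apply: (cube_interior d0) => q qd.
pose p' := e^-1 *: (q - (1 - e) *: c).
have -> : q = e *: p' + (1 - e) *: c by rewrite scalerA divff ?gt_eqF// scale1r subrK.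
apply: cC; rewrite ?e1 ?ltW//; apply: rC => i; rewrite !mxE.
have -> : e^-1 * (q 0 i - (1 - e) * c 0 i) - p 0 i =
    e^-1 * (q 0 i - (e * p 0 i + (1 - e) * x 0 i) + (1 - e) * (x 0 i - c 0 i)).
  by field; rewrite gt_eqF.
rewrite normrM gtr0_norm ?invr_gt0// ler_pdivrMl// (le_trans (ler_normD _ _))//.
have := qd i; rewrite !mxE => q1.
have x1 : `|(1 - e) * (x 0 i - c 0 i)| <= e * r / 2.
  rewrite normrM ger0_norm ?subr_ge0// (le_trans _ (ltW (xc i)))//.
  by rewrite ler_piMl// lerBlDr lerDl ltW.
by rewrite (le_trans (lerD q1 x1))// -splitr.
Qed.

(** This is the limit as [c] tends to 1, made explicit by Bernoulli's inequality. *)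
Lemma le_of_scale_le (a b : R) n : 0 <= a ->
  (forall c, 0 < c < 1 -> c ^+ n * a <= b) -> a <= b.
Proof.
move=> a0 H; apply/ler_addgt0Pl => d d0.
have bern (e : R) k : 0 <= e <= 1 -> 1 - k%:R * e <= (1 - e) ^+ k.
  move=> /andP[e0 e1]; elim: k => [|k IH]; first by rewrite mul0r subr0 expr0.
  rewrite exprS (le_trans _ (ler_wpM2l _ IH)) ?subr_ge0//.
  rewrite -natr1 -subr_ge0 (_ : _ - _ = k%:R * e ^+ 2); last by ring.
  by rewrite mulr_ge0 ?sqr_ge0.
(* With [c = 1 - D^-1] the loss [n%:R * D^-1 * a] is at most [d]; the summand 2 keeps [c] strictly
   between 0 and 1. *)
pose D := 2 + n%:R * a / d.
have D0 : 0 < D by rewrite ltr_wpDr// divr_ge0 ?mulr_ge0// ltW.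
have D1 : 1 < D by rewrite (@lt_le_trans _ _ 2) ?ltr1n// lerDl divr_ge0 ?mulr_ge0// ltW.
have i0 : 0 < D^-1 by rewrite invr_gt0.
have i1 : D^-1 < 1 by rewrite invf_lt1.
have h := H (1 - D^-1); have : 0 < 1 - D^-1 < 1 by lra.
move=> /h{}h; have := bern D^-1 n; rewrite (ltW i0) (ltW i1) => /(_ isT) h2.
have h3 : (1 - n%:R * D^-1) * a <= b by rewrite (le_trans _ h)// ler_wpM2r.
have h4 : n%:R * D^-1 * a <= d.
  rewrite mulrAC ler_pdivrMr// mulrDr mulrCA mulfV ?gt_eqF// mulr1.
  by rewrite lerDr mulr_ge0// ltW.
by move: h3; rewrite mulrBl mul1r; lra.
Qed.

(* Shrinking the closure towards an interior point moves it into the interior, so the boundary has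
   measure at most [1 - c ^+ n] times that of the closure for every [c < 1]; without interior point,
   the set lies in a hyperplane. *)
Lemma convex_boundary_null n (C : set 'rV[R]_n) : convex_set C ->
  mu n (closure C `\` C°) = 0%E.
Proof.
move=> cC.
have mB : measurable (closure C `\` C°).
  by apply: measurableD; [apply: closed_row_measurable; exact: closed_closure|
    apply: open_row_measurable; exact: open_interior].
have [[p pC]|nC] := pselect (C° !=set0); last first.
  have [->|/set0P[x0 Cx0]] := eqVneq C set0.
    by rewrite closure0 set0D measure0.
  case: (independent_or_hyperplane C x0) => [[A uA CA]|[u u0 Cu]].
    by case: nC; exact: convex_interior_of_unit Cx0 uA CA.
  have /matrix0Pn[i [j ij]] := u0.
  have mH : measurable [set x : 'rV[R]_n | \sum_i x 0 i * u i j = (x0 *m u) 0 j].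
    apply: (@measurable_sectionT _ _ _ _ (fun x : 'rV[R]_n => \sum_i x 0 i * u i j) [set _]) => //.
    by apply: measurable_sum => k; apply: measurable_funM => //; exact: measurable_coord.
  apply/eqP; rewrite eq_le measure_ge0 andbT.
  rewrite -[leRHS](@hyperplane_null n (fun k => u k j) ((x0 *m u) 0 j) i ij).
  apply: le_measure; rewrite ?inE// => x [Cx _] /=.
  apply/eqP; rewrite -subr_eq0 -normr_le0; apply/ler_addgt0Pl => e e0; rewrite addr0.
  pose S := \sum_i `|u i j|; have S0 : 0 <= S by rewrite sumr_ge0.
  have S1 : 0 < S + 1 by rewrite ltr_wpDl.
  have [c Cc xc] := closure_row Cx (divr_gt0 e0 S1).
  have -> : \sum_i x 0 i * u i j - (x0 *m u) 0 j = \sum_i (x 0 i - c 0 i) * u i j.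
    have /matrixP/(_ 0 j) := Cu _ Cc; rewrite mulmxBl !mxE => /eqP; rewrite subr_eq0 => /eqP <-.
    by rewrite -sumrB; apply: eq_bigr => k _; rewrite mulrBl.
  rewrite (le_trans (ler_norm_sumM _ (fun k => ltW (xc k))))//.
  by rewrite mulrAC ler_pdivrMr// ler_wpM2l ?(ltW e0)// lerDl.
(* Cutting with cubes makes the measures finite, so that they can be subtracted; centring the cubes
   at [p] makes them stable under shrinking towards [p]. *)
pose D k : set 'rV[R]_n := closure C `&` cube p k%:R.
have mD k : measurable (D k).
  by apply: measurableI; [apply: closed_row_measurable; exact: closed_closure|exact: measurable_cube].
pose E k : set 'rV[R]_n := C° `&` cube p k%:R.
have mE k : measurable (E k).
  by apply: measurableI; [apply: open_row_measurable; exact: open_interior|exact: measurable_cube].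
have -> : closure C `\` C° = \bigcup_k (D k `\` E k).
  apply/seteqP; split=> [x [Cx nx]|x [k _ [[Cx xk] nE]]]; last first.
    by split => // iC; apply: nE.
  have [k kx] : exists k : nat, cube p k%:R x.
    exists (Num.truncn `|x - p|).+1 => i.
    rewrite (le_trans _ (ltW (truncnS_gt _)))//.
    by have := ler_coord_norm (x - p) i; rewrite !mxE.
  by exists k => //; split => // -[].
apply/eqP; rewrite eq_le measure_ge0 andbT.
apply: (le_trans (measure_sigma_subadditive _ _ (F := fun k => D k `\` E k) _ _)) => //.
- by move=> k; exact: measurableD.
- by apply: bigcup_measurable => k _; exact: measurableD.
rewrite eseries0// => k _ _.
have fin : (mu n (D k) < +oo)%E.
  rewrite (@le_lt_trans _ _ (mu n (cube p k%:R)))//.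
    by rewrite le_measure ?inE//; [exact: measurable_cube|exact: subIsetr].
  by rewrite cube_measure// ltry.
have ED : E k `<=` D k.
  by move=> x [Cx xk]; split; [apply: subset_closure; exact: interior_subset|exact: xk].
have finE : mu n (E k) \is a fin_num.
  by rewrite ge0_fin_numE ?measure_ge0// (le_lt_trans _ fin)// le_measure ?inE.
have finD : mu n (D k) \is a fin_num by rewrite ge0_fin_numE ?measure_ge0.
transitivity (mu n (D k) - mu n (E k))%E.
  by rewrite measureD//; congr (_ - mu n _)%E; exact: setIidr.
rewrite -(fineK finE) -(fineK finD) -EFinB; congr (_%:E).
apply/eqP; rewrite subr_eq0 eq_le; apply/andP; split; last first.
  by rewrite fine_le// le_measure ?inE.
apply: (@le_of_scale_le _ _ n); first by rewrite fine_ge0 ?measure_ge0.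
move=> c /andP[c0 c1].
rewrite -lee_fin EFinM !fineK//.
have mEp : measurable_fun setT (fun x : 'rV[R]_n => (\1_(E k) (x + p))%:E : \bar R).
  by apply/measurable_EFinP/measurable_indic_comp => //; exact: measurable_shift.
have -> : mu n (E k) = (\int[mu n]_x (\1_(E k) (x + p))%:E)%E.
  rewrite (ge0_integral_shift p (F := fun x => (\1_(E k) x)%:E)) ?integral_indic ?setIT//.
  by apply/measurable_EFinP; exact: measurable_indic.
rewrite -(ge0_integral_scale c0 mEp); last by move=> x; rewrite lee_fin indic_ge0.
rewrite lee_pmul2l ?lte_fin ?exprn_gt0//.
have -> : mu n (D k) = (\int[mu n]_x (\1_(D k) (x + p))%:E)%E.
  rewrite (ge0_integral_shift p (F := fun x => (\1_(D k) x)%:E)) ?integral_indic ?setIT//.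
  by apply/measurable_EFinP; exact: measurable_indic.
apply: ge0_le_integral => //.
- by apply/measurable_EFinP/measurable_indic_comp => //; exact: measurable_shift.
- apply/measurable_EFinP/measurable_indic_comp => //.
  apply: (measurableT_comp (measurable_shift p)); exact: measurable_scale_row.
move=> x _; rewrite lee_fin !indicE.
have [/set_mem[Cx xk]|_] := boolP (x + p \in D k); last by rewrite ler0n.
rewrite mem_set//; split.
  have -> : c *: x + p = (1 - c) *: p + (1 - (1 - c)) *: (x + p).
    by apply/rowP => i; rewrite !mxE; ring.
  by apply: closure_ray_interior => //; apply/andP; split; lra.
move=> i; have := xk i; rewrite !mxE !addrK; apply: le_trans.
by rewrite normrM (gtr0_norm c0) ler_piMl// ltW.
Qed.

End convex_topology.

(** * Log-concave functions *)

Section log_concave_functions.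
Context {R : realType}.
Local Notation mu := (borel_lebesgue R).

(** Log-concavity without extended reals. The clause on positivity is the convexity of the support,
    outside of which [ln] takes the default value 0. *)
Definition ln_concave n (f : 'rV[R]_n -> R) := forall x y t, 0 <= t <= 1 ->
  0 < f x -> 0 < f y -> 0 < f (t *: x + (1 - t) *: y) /\
  t * ln (f x) + (1 - t) * ln (f y) <= ln (f (t *: x + (1 - t) *: y)).

Lemma log_concave_ge0 n (f : 'rV[R]_n -> R) : log_concave f -> forall x, 0 <= f x.
Proof. by move=> [phi [_ _ fE]] x; rewrite -lee_fin fE expeR_ge0. Qed.

Lemma log_concave_ln n (f : 'rV[R]_n -> R) : log_concave f -> ln_concave f.
Proof.
move=> [phi [phiN cphi fE]] x y t t01 fx fy.
have H z : 0 < f z -> phi z = (- ln (f z))%:E.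
  have := fE z; have := phiN z; case: (phi z) => [r _ [->]| _ [->]|]//=.
  - by rewrite expRK opprK.
  - by rewrite ltxx.
have := cphi x y t t01; rewrite (H _ fx) (H _ fy) -!EFinM -EFinD.
have := fE (t *: x + (1 - t) *: y); have := phiN (t *: x + (1 - t) *: y).
case: (phi _) => [r _ [->]| _ _|]//=; rewrite lee_fin expR_gt0 expRK.
by rewrite !mulrN -opprD lerNr.
Qed.

Lemma ln_concave_min n (f : 'rV[R]_n -> R) : (forall x, 0 <= f x) -> ln_concave f ->
  forall x y t, 0 <= t <= 1 -> Num.min (f x) (f y) <= f (t *: x + (1 - t) *: y).
Proof.
move=> f0 fc x y t t01; have [fx|fx] := ltP 0 (f x); last first.
  by rewrite ge_min (le_trans fx).
have [fy|fy] := ltP 0 (f y); last by rewrite ge_min (le_trans fy) ?orbT.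
have [fz zl] := fc _ _ _ t01 fx fy; have /andP[t0 t1] := t01.
have m0 : 0 < Num.min (f x) (f y) by rewrite lt_min fx.
rewrite -ler_ln ?posrE// (le_trans _ zl)//.
have -> : ln (Num.min (f x) (f y)) =
  t * ln (Num.min (f x) (f y)) + (1 - t) * ln (Num.min (f x) (f y)) by ring.
by rewrite lerD// ler_wpM2l ?subr_ge0// ler_ln ?posrE// ge_min lexx ?orbT.
Qed.

Lemma convex_superlevel n (f : 'rV[R]_n -> R) q : (forall x, 0 <= f x) -> ln_concave f ->
  convex_set [set x | q < f x].
Proof.
move=> f0 fc; apply/convex_rowP => x y t t01 /= qx qy.
by rewrite (lt_le_trans _ (ln_concave_min f0 fc _ _ t01))// lt_min qx.
Qed.

(** An enumeration of the rationals; natural numbers that encode no rational are sent to 0. *)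
Definition level (k : nat) : R := ratr (odflt 0 (unpickle k : option rat)).

Lemma level_dense (a b : R) : a < b -> exists2 k, a < level k & level k < b.
Proof.
move=> /rat_in_itvoo[q]; rewrite in_itv/= => /andP[aq qb].
by exists (pickle q); rewrite /level pickleK.
Qed.

Section borel_version.
Variables (n : nat) (f : 'rV[R]_n -> R).
Hypotheses (f0 : forall x, 0 <= f x) (fc : ln_concave f).

Let L k := [set x | level k < f x].

Definition level_boundary : set 'rV[R]_n := \bigcup_k (closure (L k) `\` (L k)°).

Let mLi k : measurable ((L k)° : set 'rV[R]_n).
Proof. by apply: open_row_measurable; exact: open_interior. Qed.

Let mb k : measurable (closure (L k) `\` (L k)° : set 'rV[R]_n).
Proof.
by apply: measurableD => //; apply: closed_row_measurable; exact: closed_closure.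
Qed.

Lemma measurable_level_boundary : measurable level_boundary.
Proof. by apply: bigcup_measurable => k _; exact: mb. Qed.

Lemma level_boundary_null : mu n level_boundary = 0%E.
Proof.
apply/eqP; rewrite eq_le measure_ge0 andbT.
apply: (le_trans (measure_sigma_subadditive _ _
  (F := fun k => closure (L k) `\` (L k)°) _ _)) => //.
  exact: measurable_level_boundary.
by rewrite eseries0// => k _ _; apply: convex_boundary_null; exact: convex_superlevel.
Qed.

Lemma level_interior k x : ~ level_boundary x -> level k < f x -> (L k)° x.
Proof.
by move=> nN xk; apply: contrapT => nx; apply: nN; exists k => //; split => //;
  exact: subset_closure.
Qed.

(* A log-concave function need not be Borel, but off the boundaries of its rational superlevel sets it
   agrees with a Borel function. *)
Definition borel_version (x : 'rV[R]_n) : R := f x * \1_(~` level_boundary) x.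

Lemma borel_versionE x : ~ level_boundary x -> f x = borel_version x.
Proof. by move=> Nx; rewrite /borel_version indicE mem_set ?mulr1. Qed.

Lemma borel_version_ge0 x : 0 <= borel_version x.
Proof. by rewrite mulr_ge0 ?indic_ge0. Qed.

Lemma borel_version_cases x : borel_version x = f x \/ borel_version x = 0.
Proof. by rewrite /borel_version indicE; case: (_ \in _); rewrite ?mulr1 ?mulr0; [left|right]. Qed.

Lemma borel_version_le x : borel_version x <= f x.
Proof. by case: (borel_version_cases x) => ->. Qed.

(** Off [level_boundary] a superlevel set at a rational level coincides with its interior, and a
    superlevel set at any threshold [t >= 0] is the union of those at rational levels above [t]. *)
Lemma measurable_borel_version : measurable_fun setT borel_version.
Proof.
move=> mD; apply: (measurability _ (RGenOInfty.measurableE R)) => //.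
move=> /= _ [_ [t ->] <-]; rewrite setTI preimage_itvoy.
have [t0|t0] := ltP t 0.
  rewrite (_ : [set _ | _] = setT)//; apply/seteqP; split => // x _ /=.
  by rewrite (lt_le_trans t0)// borel_version_ge0.
rewrite (_ : [set _ | _] =
    \bigcup_k (if t < level k then (L k)° `\` level_boundary else set0)).
  apply: bigcup_measurable => k _; case: ifP => // _.
  by apply: measurableD => //; exact: measurable_level_boundary.
apply/seteqP; split=> [x /=|x [k _]].
  rewrite /borel_version indicE; have [/set_mem/= Nx|_] := boolP (x \in _); last first.
    by rewrite mulr0 ltNge t0.
  rewrite mulr1 => /level_dense[k tk kx]; exists k => //; rewrite tk; split => //.
  exact: level_interior.
case: ifP => // tk [xk Nx] /=; rewrite -borel_versionE//.
by rewrite (lt_trans tk)//; exact: (interior_subset xk).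
Qed.

End borel_version.

(** For the l1 norm, [expR (- (b * norm1 x))] is a product over the coordinates. *)
Definition norm1 n (x : 'rV[R]_n) : R := \sum_i `|x 0 i|.

Lemma norm1_ge0 n (x : 'rV[R]_n) : 0 <= norm1 x.
Proof. by rewrite sumr_ge0. Qed.

Lemma measurable_norm1 n : measurable_fun setT (@norm1 n).
Proof.
by apply: measurable_sum => i; apply: measurableT_comp => //; exact: measurable_coord.
Qed.

Lemma integral_expRN_abs (b : R) : 0 < b ->
  (\int[@lebesgue_measure R]_s (expR (- (b * `|s|)))%:E < +oo)%E.
Proof.
move=> b0; pose F s : \bar R := (\1_(`[0, +oo[%classic) s * expR (- s))%:E.
have mF : measurable_fun setT F.
  apply/measurable_EFinP; apply: measurable_funM; first exact: measurable_indic.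
  by apply: measurableT_comp => //; exact: measurableT_comp.
have F0 s : (0 <= F s)%E by rewrite lee_fin mulr_ge0 ?indic_ge0 ?expR_ge0.
have iF : (\int[@lebesgue_measure R]_s F s = 1%:E)%E.
  have := @integral_gamma_c R 0; rewrite fact0 => <-.
  by apply: eq_integral => s _; rewrite expr0 mul1r.
have fin (a : R) : a != 0 -> (\int[@lebesgue_measure R]_s F (a * s)%R < +oo)%E.
  move=> a0; have := ge0_integral_affine1 0 a0 mF F0; rewrite iF.
  under eq_integral do rewrite addr0.
  case: (\int[_]_s _)%E => [r _||]; rewrite ?ltry// ?ltNyr//.
  by rewrite gt0_muley// lte_fin normr_gt0.
have mFa (a : R) : measurable_fun setT (fun s => F (a * s)%R).
  by apply: (measurableT_comp mF); exact: measurable_funM.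
apply: (@le_lt_trans _ _ (\int[@lebesgue_measure R]_s (F (b * s)%R + F (- b * s)%R))%E).
  apply: ge0_le_integral => //.
  - apply/measurable_EFinP; apply: measurableT_comp => //; apply: measurableT_comp => //.
    by apply: measurable_funM => //; exact: measurableT_comp.
  - by apply: emeasurable_funD; exact: mFa.
  move=> s _; rewrite -EFinD lee_fin !indicE !mem_setE !in_itv/= !andbT.
  rewrite mulNr oppr_ge0 pmulr_rge0// pmulr_rle0//.
  have [s0|s0] := leP 0 s.
    by rewrite (ger0_norm s0) mul1r lerDl mulr_ge0 ?ler0n ?expR_ge0.
  by rewrite (ltW s0) mul0r add0r mul1r ltr0_norm// mulrN.
rewrite ge0_integralD//; last 2 first.
- exact: mFa.
- exact: mFa.
by apply: lte_add_pinfty; apply: fin; rewrite ?oppr_eq0 gt_eqF.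
Qed.

Lemma expRN_norm1_integrable n (b : R) : 0 < b ->
  (mu n).-integrable setT (EFin \o (fun x => expR (- (b * norm1 x)))).
Proof.
move=> b0; have me : measurable_fun setT (fun s : R => expR (- (b * `|s|))).
  apply: measurableT_comp => //; apply: measurableT_comp => //.
  by apply: measurable_funM => //; exact: measurableT_comp.
apply/integrableP; split.
  apply/measurable_EFinP; apply: measurableT_comp => //; apply: measurableT_comp => //.
  by apply: measurable_funM => //; exact: measurable_norm1.
rewrite (_ : (fun x => _) = (fun x : 'rV[R]_n => (\prod_i expR (- (b * `|x 0 i|)))%:E)); last first.
  apply/funext => x /=; rewrite ger0_norm ?expR_ge0// -expR_sum; congr (expR _)%:E.
  by rewrite /norm1 mulr_sumr sumrN.
rewrite (ge0_integral_prod (fun=> me)) => [|i s]; last exact: expR_ge0.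
suff /andP[] : (0 <= \big[mule/1]_(i < n)
    \int[@lebesgue_measure R]_s (expR (- (b * `|s|)))%:E < +oo)%E by [].
elim/big_ind: _ => [|x y /andP[x0 xy] /andP[y0 yy]|i _].
- by rewrite lee01 ltry.
- by rewrite mule_ge0// lte_mul_pinfty// ge0_fin_numE.
by rewrite integral_expRN_abs// andbT integral_ge0// => s _; rewrite lee_fin expR_ge0.
Qed.

Lemma dominated_has_integral n (F : 'rV[R]_n -> R) (C b : R) : 0 < b ->
  measurable_fun setT F -> (forall x, `|F x| <= C * expR (- (b * norm1 x))) ->
  has_integral (mu n) F (\int[mu n]_x F x).
Proof.
move=> b0 mF Fle; apply: integrable_has_integral.
have iE := (has_integralZ C (integrable_has_integral (expRN_norm1_integrable n b0))).1.
apply: le_integrable iE => //; first exact/measurable_EFinP.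
by move=> x _; rewrite lee_fin (le_trans (Fle x))// ler_norm.
Qed.

End log_concave_functions.

(** * Exponential decay of log-concave densities *)

Section decay.
Context {R : realType}.
Local Notation mu := (borel_lebesgue R).

Lemma has_integral_le d (X : measurableType d) (m : {measure set X -> \bar R})
    (F G : X -> R) u v : has_integral m F u -> has_integral m G v ->
  (forall x, F x <= G x) -> u <= v.
Proof.
move=> hF hG FG; rewrite -subr_ge0.
by apply: (has_integral_ge0 (has_integralB hG hF)) => x; rewrite subr_ge0.
Qed.

Lemma has_integral_indicM d (X : measurableType d) (m : {measure set X -> \bar R})
    (F : X -> R) v A : has_integral m F v -> measurable A ->
  has_integral m (fun x => F x * \1_A x) (\int[m]_x (F x * \1_A x)).
Proof.
move=> hF mA; have mF := has_integral_measurable hF.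
apply: integrable_has_integral; apply: le_integrable hF.1 => //.
  by apply/measurable_EFinP; apply: measurable_funM => //; exact: measurable_indic.
move=> x _; rewrite lee_fin normrM indicE [X in _ * X]ger0_norm// ler_piMr//.
by case: (_ \in _).
Qed.

Lemma norm1D n (x y : 'rV[R]_n) : norm1 (x + y) <= norm1 x + norm1 y.
Proof.
by rewrite /norm1 -big_split/= ler_sum// => i _; rewrite mxE ler_normD.
Qed.

Lemma norm1Z n (a : R) (x : 'rV[R]_n) : norm1 (a *: x) = `|a| * norm1 x.
Proof. by rewrite /norm1 mulr_sumr; apply: eq_bigr => i _; rewrite mxE normrM. Qed.

Lemma ler_coord_norm1 n (x : 'rV[R]_n) i : `|x 0 i| <= norm1 x.
Proof. by rewrite /norm1 (bigD1 i)//= lerDl sumr_ge0. Qed.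

(** Half of the decay rate absorbs the logarithms and a quarter the polynomial in [N]. The exponents
    are those of the limit argument: its error terms contain the cube of [ln w], and second moments
    contain two coordinates. *)
Lemma growth_bound (A b : R) : 1 <= A -> 0 < b -> exists C, forall w N,
  0 <= N -> 0 <= w -> w <= A * expR (- (b * N)) ->
  w * (1 + `|ln w|) ^+ 3 * (1 + N) ^+ 2 <= C * expR (- (b / 4 * N)).
Proof.
move=> A1 b0; have A0 : 0 < A by rewrite (lt_le_trans ltr01).
pose D := 1 + 8 / b; have D0 : 0 < D by rewrite ltr_wpDr// divr_ge0// ltW.
exists (216 * A * expR (ln A / 2) * D ^+ 2) => w N N0 w0 wA.
have [w1|] := ltP 0 w; last first.
  move=> wn; have -> : w = 0 by apply/eqP; rewrite eq_le wn.
  by rewrite !mul0r !mulr_ge0 ?expR_ge0 ?exprn_ge0// ltW.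
(* The constant is [6 ^+ 3], from [1 + u <= 6 * (1 + u / 6) <= 6 * expR (u / 6)]. *)
have e1 : (1 + `|ln w|) ^+ 3 <= 216 * expR (`|ln w| / 2).
  have -> : 216 * expR (`|ln w| / 2) = (6 * expR (`|ln w| / 6)) ^+ 3.
    by rewrite exprMn -expRM_natl; congr (_ * expR _); [ring|field].
  rewrite lerXn2r ?nnegrE ?addr_ge0 ?mulr_ge0 ?expR_ge0//.
  rewrite (@le_trans _ _ (6 * (1 + `|ln w| / 6)))//; last first.
    by rewrite ler_wpM2l// expR_ge1Dx.
  by have := normr_ge0 (ln w); lra.
have e2 : (1 + N) ^+ 2 <= D ^+ 2 * expR (b / 4 * N).
  have -> : D ^+ 2 * expR (b / 4 * N) = (D * expR (b / 8 * N)) ^+ 2.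
    by rewrite exprMn -expRM_natl; congr (_ * expR _); field.
  rewrite lerXn2r ?nnegrE ?addr_ge0 ?mulr_ge0 ?expR_ge0 ?(ltW D0)//.
  rewrite (@le_trans _ _ (D * (1 + b / 8 * N)))//; last first.
    by rewrite ler_wpM2l ?(ltW D0)// expR_ge1Dx.
  have -> : D * (1 + b / 8 * N) = 1 + 8 / b + N + b / 8 * N.
    by rewrite /D; field; rewrite gt_eqF.
  have : 0 <= 8 / b by rewrite divr_ge0// ltW.
  have : 0 <= b / 8 * N by rewrite mulr_ge0// divr_ge0// ltW.
  lra.
have lA : ln w <= ln A - b * N.
  by rewrite -[leRHS]expRK ler_ln ?posrE ?expR_gt0// expRD lnK ?posrE.
have e3 : w * expR (`|ln w| / 2) <= A * (expR (ln A / 2) * expR (- (b / 2 * N))).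
  rewrite -{1}(@lnK _ w) ?posrE// -!expRD.
  have lA' : ln w / 2 <= ln A / 2 - b / 2 * N by lra.
  apply: (@le_trans _ _ (A * expR (ln w / 2))); last first.
    by rewrite ler_wpM2l ?(ltW A0)// ler_expR.
  have [l0|l0] := leP 0 (ln w).
    rewrite (ger0_norm l0) expRD ler_wpM2r ?expR_ge0// lnK ?posrE// (le_trans wA)//.
    by rewrite ler_piMr ?(ltW A0)// -expR0 ler_expR oppr_le0 mulr_ge0// ltW.
  rewrite (ltr0_norm l0); have -> : ln w + - ln w / 2 = ln w / 2 by lra.
  by rewrite ler_peMl ?expR_ge0.
have -> : 216 * A * expR (ln A / 2) * D ^+ 2 * expR (- (b / 4 * N)) =
    216 * (A * (expR (ln A / 2) * expR (- (b / 2 * N)))) * (D ^+ 2 * expR (b / 4 * N)).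
  have -> : expR (- (b / 4 * N)) = expR (- (b / 2 * N)) * expR (b / 4 * N).
    by rewrite -expRD; congr expR; lra.
  by ring.
apply: ler_pM => //.
- by rewrite mulr_ge0// exprn_ge0// addr_ge0.
- by rewrite exprn_ge0// addr_ge0.
rewrite (@le_trans _ _ (w * (216 * expR (`|ln w| / 2))))//.
  by rewrite ler_wpM2l.
by rewrite mulrCA ler_wpM2l.
Qed.

Section exponential_decay.
Variables (n : nat) (f : 'rV[R]_n -> R) (m0 : R).
Hypotheses (f0 : forall x, 0 <= f x) (fc : ln_concave f).
Hypotheses (hm : has_integral (mu n) (borel_version f) m0) (m0_gt0 : 0 < m0).
Local Notation h := (borel_version f).
Local Notation N := (level_boundary f).
Let h0 x : 0 <= h x := borel_version_ge0 f0 x.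

(** If every superlevel set at a positive rational level had empty interior, [borel_version f] would
    vanish everywhere, against its positive integral. *)
Lemma superlevel_cube : exists t c r,
  [/\ 0 < t, 0 < r & forall y, cube c r y -> t < f y].
Proof.
have [[k [k0 [c /interior_cube[r r0 rc]]]]|nk] :=
    pselect (exists k, 0 < level k :> R /\ [set x | level k < f x]° !=set0).
  by exists (level k), c, r; split => // y /rc.
have hz x : h x = 0.
  rewrite /borel_version indicE; have [/set_mem/= Nx|_] := boolP (x \in _); last first.
    by rewrite mulr0.
  rewrite mulr1; apply/eqP; rewrite eq_le f0 andbT leNgt; apply/negP => fx.
  have [k k0 kx] := level_dense fx; apply: nk; exists k; split => //.
  by exists x; exact: level_interior Nx kx.
have [_ e] := hm; move: m0_gt0; rewrite -e /Rintegral.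
by rewrite integral0_eq ?ltxx// => x _; rewrite hz.
Qed.

Section cube_bound.
Variables (t r : R) (c : 'rV[R]_n).
Hypotheses (t0 : 0 < t) (r0 : 0 < r) (tc : forall y, cube c r y -> t < f y).
Let Q (x : 'rV[R]_n) : set 'rV[R]_n := cube (2^-1 *: (x + c)) (r / 2).

(* [Q x] consists of the midpoints of [x] and the points of a cube on which [f > t]; by log-concavity
   [f x] is controlled by the average of [f] over [Q x]. *)
Lemma midpoint_bound x z : Q x z -> Num.sqrt (t * f x) <= f z.
Proof.
move=> Qz; have [fx|fx] := ltP 0 (f x); last first.
  have -> : f x = 0 by apply/eqP; rewrite eq_le fx f0.
  by rewrite mulr0 sqrtr0.
pose y := 2%:R *: z - x.
have yc : t < f y.
  apply: tc => i; have := Qz i; rewrite !mxE => zi.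
  have -> : 2%:R * z 0 i - x 0 i - c 0 i = 2%:R * (z 0 i - 2^-1 * (x 0 i + c 0 i)) by field.
  by rewrite normrM ger0_norm// mulrC -ler_pdivlMr.
have fy : 0 < f y by exact: lt_trans yc.
have zE : z = 2^-1 *: x + (1 - 2^-1) *: y by apply/rowP => i; rewrite !mxE; field.
have t01 : 0 <= (2^-1 : R) <= 1 by rewrite invr_ge0 ler0n invf_le1 ?ler1n.
have [] := fc t01 fx fy; rewrite -zE => fz zl.
rewrite -[leRHS](ger0_norm (f0 z)) -sqrtr_sqr ler_wsqrtr//.
rewrite (@le_trans _ _ (f y * f x))//; first by rewrite ler_wpM2r// ltW.
rewrite -ler_ln ?posrE ?mulr_gt0 ?exprn_gt0// lnM ?posrE// lnXn//.
by rewrite mulr2n; lra.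
Qed.

Lemma cube_average_bound x :
  Num.sqrt (t * f x) * r ^+ n <= \int[mu n]_z (h z * \1_(Q x) z).
Proof.
have mQ : measurable (Q x) by exact: measurable_cube.
have mN := measurable_level_boundary f.
have N0 := level_boundary_null f0 fc.
have hQ : has_integral (mu n) (\1_(Q x `\` N) : _ -> R) (r ^+ n).
  apply: ge0_has_integral; [|exact: indic_ge0|].
    by apply: measurable_indic; exact: measurableD.
  rewrite integral_indic ?setIT//; last exact: measurableD.
  transitivity (mu n (Q x)).
    have e : mu n (Q x) = (mu n (Q x `\` N) + mu n (Q x `&` N))%E by exact: measureDI.
    rewrite e [X in (_ + X)%E](_ : _ = 0%E) ?adde0//; apply/eqP.
    rewrite eq_le measure_ge0 andbT -[leRHS]N0 le_measure ?inE//; exact: measurableI.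
  by rewrite cube_measure ?divr_ge0 ?ltW// mulrC divfK.
apply: has_integral_le (has_integralZ _ hQ) (has_integral_indicM hm mQ) _ => z.
rewrite ![\1_ _ z]indicE; have [/set_mem[Qz Nz]|_] := boolP (z \in Q x `\` N).
  by rewrite mem_set// !mulr1 -borel_versionE//; exact: midpoint_bound.
by rewrite mulr0 mulr_ge0.
Qed.

Let le_of_average x a : 0 <= a -> \int[mu n]_z (h z * \1_(Q x) z) <= a ->
  f x <= (a / r ^+ n) ^+ 2 / t.
Proof.
move=> a0 ha; have rn : 0 < r ^+ n by rewrite exprn_gt0.
rewrite ler_pdivlMr// mulrC -(@sqr_sqrtr _ (t * f x)); last by rewrite mulr_ge0// ltW.
rewrite lerXn2r ?nnegrE ?sqrtr_ge0 ?divr_ge0 ?(ltW rn)//.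
by rewrite ler_pdivlMr// (le_trans (cube_average_bound x)).
Qed.

Lemma log_concave_bounded x : f x <= (m0 / r ^+ n) ^+ 2 / t.
Proof.
apply: le_of_average; first exact: ltW.
have mQ : measurable (Q x) by exact: measurable_cube.
apply: has_integral_le (has_integral_indicM hm mQ) hm _ => z.
by rewrite ler_piMr// indicE; case: (_ \in _).
Qed.

(** Otherwise the mass inside every cube would stay below [m0 - e], which monotone convergence along
    growing cubes excludes. *)
Lemma integral_outside_cube (e : R) : 0 < e ->
  exists k : nat, \int[mu n]_x (h x * \1_(~` cube 0 k%:R) x) <= e.
Proof.
move=> e0; apply: contrapT => nk.
have mh := has_integral_measurable hm.
have mC k : measurable (cube 0 k%:R : set 'rV[R]_n) by exact: measurable_cube.
pose g (k : nat) (x : 'rV[R]_n) : \bar R := (h x * \1_(cube 0 k%:R) x)%:E.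
have mg k : measurable_fun setT (g k).
  by apply/measurable_EFinP; apply: measurable_funM => //; exact: measurable_indic.
have g0 k x : setT x -> (0 <= g k x)%E by rewrite lee_fin mulr_ge0 ?indic_ge0.
have ndg x : setT x -> nondecreasing_seq (g ^~ x).
  move=> _ i j ij; rewrite lee_fin ler_wpM2l// !indicE ler_nat.
  have [/set_mem xi|//] := boolP (x \in cube 0 i%:R).
  by rewrite mem_set// => l; rewrite (le_trans (xi l))// ler_nat.
have gk k : (\int[mu n]_x g k x <= (m0 - e)%:E)%E.
  have [u hk] : exists u, has_integral (mu n) (fun x => h x * \1_(cube 0 k%:R) x) u.
    by eexists; apply: (has_integral_indicM hm); exact: mC.
  rewrite (has_integral_ereal hk) lee_fin.
  have [v hk'] : exists v, has_integral (mu n) (fun x => h x * \1_(~` cube 0 k%:R) x) v.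
    by eexists; apply: (has_integral_indicM hm); exact: measurableC.
  have hs := has_integralD hk hk'.
  have : u + v <= m0.
    apply: has_integral_le hs hm _ => x; rewrite -mulrDr ler_piMr// !indicE in_setC.
    by case: (_ \in _); rewrite ?addr0 ?add0r.
  have : e < v.
    by rewrite -hk'.2 ltNge; apply/negP => hle; apply: nk; exists k.
  by lra.
have lg x : limn (g ^~ x) = (h x)%:E.
  apply/cvg_lim => //; apply: cvg_near_cst.
  exists (Num.truncn (norm1 x)).+1 => // k /= xk; apply/eqP; rewrite /g indicE mem_set ?mulr1//.
  move=> i; rewrite mxE subr0 (le_trans (ler_coord_norm1 x i))// ltW//.
  by rewrite (lt_le_trans (truncnS_gt _))// ler_nat.
have cv := cvg_monotone_convergence measurableT mg g0 ndg (mu := mu n).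
have : (\int[mu n]_x limn (g ^~ x) <= (m0 - e)%:E)%E.
  by rewrite -(cvg_lim _ cv)//; apply: lime_le; [exact: cvgP cv|exact: nearW].
under eq_integral do rewrite lg.
rewrite (has_integral_ereal hm) lee_fin; lra.
Qed.

(** For [x] far away the cube [Q x] lies in the tail of the density, so its average is small and
    [f x] with it. The target is a fixed factor below [t]: one unit of [ln f], from which concavity
    makes a linear decrease. *)
Lemma log_concave_small : exists rho, forall x, rho < norm1 x -> f x <= t * expR (-1).
Proof.
have rn : 0 < r ^+ n by rewrite exprn_gt0.
(* Chosen so that [(e / r ^+ n) ^+ 2 / t] equals [t * expR (-1)]. *)
pose e := r ^+ n * (t * expR (- 2^-1)).
have e0 : 0 < e by rewrite !mulr_gt0 ?expR_gt0.
have [k kP] := integral_outside_cube e0.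
(* If a coordinate of [x] exceeds [rho], the same coordinate of each point of [Q x] exceeds [k]; the
   factor [n] forces such a coordinate. *)
pose rho := 2 * k%:R + r + norm1 c; exists (n%:R * rho) => x xr.
have [i xi] : exists i, rho < `|x 0 i|.
  apply: contrapT => /forallNP nx; move: xr; apply/negP; rewrite -leNgt.
  rewrite mulr_natl -[X in _ *+ X]card_ord -sumr_const ler_sum// => i _.
  by rewrite leNgt; apply/negP; exact: nx.
have : \int[mu n]_z (h z * \1_(Q x) z) <= e.
  rewrite (le_trans _ kP)//.
  have mQ : measurable (Q x) by exact: measurable_cube.
  have mC : measurable (~` cube 0 k%:R : set 'rV[R]_n).
    by apply: measurableC; exact: measurable_cube.
  apply: has_integral_le (has_integral_indicM hm mQ) (has_integral_indicM hm mC) _ => z.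
  rewrite ler_wpM2l// !indicE; have [/set_mem Qz|_] := boolP (z \in Q x); last by rewrite ler0n.
  rewrite mem_set// => /(_ i); have := Qz i; rewrite !mxE subr0 => zi zk.
  have := ler_coord_norm1 c i; move: xi; rewrite /rho.
  have : `|x 0 i| <= 2 * (`|z 0 i - 2^-1 * (x 0 i + c 0 i)| + `|z 0 i|) + `|c 0 i|.
    have xE : x 0 i = 2 * (- (z 0 i - 2^-1 * (x 0 i + c 0 i)) + z 0 i) + - c 0 i by field.
    rewrite {1}xE (le_trans (ler_normD _ _))// normrN lerD2r normrM ger0_norm// ler_wpM2l//.
    by rewrite (le_trans (ler_normD _ _))// normrN.
  lra.
move=> /(le_of_average (ltW e0)); have -> : e / r ^+ n = t * expR (- 2^-1) by rewrite /e mulrC mulKf ?gt_eqF.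
have -> : expR (-1) = expR (- 2^-1) * expR (- 2^-1) :> R by rewrite -expRD; congr expR; field.
move=> /le_trans -> //; rewrite le_eqVlt; apply/orP; left; apply/eqP.
by move: (expR _) => E; field; rewrite gt_eqF.
Qed.

End cube_bound.

(** Along a ray from [c], where [f c > t], the function has dropped below [t * expR (-1)] at
    distance [rho1]. By concavity [ln f] keeps decreasing at this rate beyond, and nearer to [c] the
    uniform bound suffices. *)
Lemma log_concave_decay : exists A b, 0 < b /\ forall x, f x <= A * expR (- (b * norm1 x)).
Proof.
have [t [c [r [t0 r0 tc]]]] := superlevel_cube.
have [rho rhoP] := log_concave_small t0 r0 tc.
have fb := log_concave_bounded t0 r0 tc; set A0 := _ / t in fb.
have A00 : 0 <= A0 := le_trans (f0 0) (fb 0); clearbody A0.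
pose rho1 := `|rho| + norm1 c + 1.
have rho10 : 0 < rho1 by rewrite ltr_wpDl// addr_ge0// norm1_ge0.
have cf : t < f c by apply: tc => i; rewrite subrr normr0 ltW.
suff H x : f x <= (t + A0 * expR 1) * expR (- (norm1 (x - c) / rho1)).
  exists ((t + A0 * expR 1) * expR (norm1 c / rho1)), rho1^-1; split; first by rewrite invr_gt0.
  move=> x; rewrite (le_trans (H x))// -[leRHS]mulrA ler_wpM2l//.
    by rewrite addr_ge0 ?mulr_ge0 ?expR_ge0 ?(ltW t0).
  rewrite -expRD ler_expR -subr_ge0.
  have -> : norm1 c / rho1 - rho1^-1 * norm1 x - - (norm1 (x - c) / rho1) =
      (norm1 (x - c) + norm1 c - norm1 x) / rho1 by field; rewrite gt_eqF.
  apply: divr_ge0; last exact: ltW.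
  by have := norm1D (x - c) c; rewrite subrK subr_ge0.
have [xn|xf] := leP (norm1 (x - c)) rho1.
  rewrite (le_trans (fb x))// mulrDl (@le_trans _ _ (A0 * expR 1 * expR (- (norm1 (x - c) / rho1))))//.
    rewrite -mulrA -expRD ler_peMr// -[leLHS]expR0 ler_expR subr_ge0 ler_pdivrMr// mul1r.
    exact: xn.
  by rewrite lerDr mulr_ge0 ?expR_ge0// ltW.
rewrite mulrDl (@le_trans _ _ (t * expR (- (norm1 (x - c) / rho1))))//; last first.
  by rewrite lerDl !mulr_ge0 ?expR_ge0.
have [fx|fx] := ltP 0 (f x); last by rewrite (le_trans fx)// mulr_ge0 ?expR_ge0// ltW.
(* The point [y] below is the one on the segment from [c] to [x] at l1 distance [rho1] from [c]. *)
have d0 : 0 < norm1 (x - c) by exact: lt_trans xf.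
pose l := rho1 / norm1 (x - c).
have l0 : 0 < l by rewrite divr_gt0.
have l1 : l <= 1 by rewrite ler_pdivrMr// mul1r ltW.
pose y := l *: x + (1 - l) *: c.
have l01 : 0 <= l <= 1 by rewrite (ltW l0).
have [fy yl] := fc l01 fx (lt_trans t0 cf).
have yr : rho < norm1 y.
  have : norm1 (l *: (x - c)) <= norm1 y + norm1 (- c).
    rewrite (le_trans _ (norm1D _ _))// /y.
    by rewrite (_ : l *: (x - c) = l *: x + (1 - l) *: c - c)//; apply/rowP => i; rewrite !mxE; ring.
  rewrite norm1Z (gtr0_norm l0) divfK ?gt_eqF// -scaleN1r norm1Z normrN1 mul1r /rho1.
  by have := ler_norm rho; lra.
have := rhoP _ yr; rewrite -ler_ln ?posrE ?mulr_gt0 ?expR_gt0// lnM ?posrE ?expR_gt0// expRK.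
move=> ly; have lc : ln t <= ln (f c) by rewrite ler_ln ?posrE ?(ltW cf)// (lt_trans t0).
have lx : l * (ln (f x) - ln t) <= -1.
  have : (1 - l) * ln t <= (1 - l) * ln (f c) by rewrite ler_wpM2l// subr_ge0.
  by rewrite -/y in yl; rewrite mulrBr; lra.
rewrite -ler_ln ?posrE ?mulr_gt0 ?expR_gt0// lnM ?posrE ?expR_gt0// expRK.
rewrite -lerBlDl -(ler_pM2l l0) (le_trans lx)// mulrN mulrA divfK ?gt_eqF// divff ?gt_eqF//.
Qed.

Lemma log_concave_growth : exists C b, 0 < b /\ forall x,
  h x * (1 + `|ln (h x)|) ^+ 3 * (1 + norm1 x) ^+ 2 <= C * expR (- (b * norm1 x)).
Proof.
have [A [b [b0 fA]]] := log_concave_decay.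
have A1 : 1 <= `|A| + 1 by rewrite lerDr.
have [C CP] := growth_bound A1 b0.
exists C, (b / 4); split; first by rewrite divr_gt0.
move=> x; apply: CP; [exact: norm1_ge0|exact: h0|].
rewrite (le_trans (borel_version_le f0 x))// (le_trans (fA x))// ler_wpM2r ?expR_ge0//.
by rewrite (le_trans (ler_norm A))// lerDl.
Qed.

End exponential_decay.

End decay.

(** * The convex body over a log-concave density *)

Section centered_simplex.
Context {R : realType}.
Local Notation mu := (borel_lebesgue R).

(** The standard simplex moved to barycenter 0: its first moments vanish, which removes the mixed
    moments of the body, and it contains 0, so its dilates increase with the factor. *)
Definition centered_simplex m : set 'rV[R]_m :=
  [set y | std_simplex m (y + const_mx m.+1%:R^-1)].
Arguments centered_simplex m _ : clear implicits.

Lemma measurable_centered_simplex m : measurable (centered_simplex m).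
Proof.
apply: (@measurable_sectionT _ _ _ _ (fun y : 'rV[R]_m => y + const_mx m.+1%:R^-1)
  (std_simplex m)); [exact: measurable_shift|exact: measurable_std_simplex].
Qed.

Lemma centered_simplex_convex m : convex_set (centered_simplex m).
Proof.
apply/convex_rowP => x y t /andP[t0 t1] [x0 xs] [y0 ys].
have e i : (t *: x + (1 - t) *: y + const_mx m.+1%:R^-1) 0 i =
    t * (x + const_mx m.+1%:R^-1 : 'rV[R]_m) 0 i +
    (1 - t) * (y + const_mx m.+1%:R^-1 : 'rV[R]_m) 0 i by rewrite !mxE; ring.
split=> [i|]; first by rewrite e addr_ge0// mulr_ge0 ?subr_ge0.
under eq_bigr do rewrite e; rewrite big_split/= -!mulr_sumr.
apply: (@le_trans _ _ (t * 1 + (1 - t) * 1)); first by rewrite lerD// ler_wpM2l ?subr_ge0.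
by have -> : t * 1 + (1 - t) * 1 = 1 by ring.
Qed.

Lemma centered_simplex0 m : centered_simplex m 0.
Proof.
split=> [i|]; first by rewrite !mxE add0r.
under eq_bigr do rewrite !mxE add0r.
rewrite sumr_const card_ord -[_ *+ _]mulr_natl.
by rewrite ler_pdivrMr// mul1r ler_nat.
Qed.

Lemma centered_simplex_bound m y i : centered_simplex m y -> `|y 0 i| <= 1.
Proof.
move=> [y0 ys]; have := y0 i; rewrite !mxE => yi0.
have i0 : 0 <= m.+1%:R^-1 :> R by [].
have i1 : m.+1%:R^-1 <= 1 :> R by rewrite invf_le1// ler1n.
have : (y + const_mx m.+1%:R^-1) 0 i <= 1.
  by rewrite (le_trans _ ys)// (bigD1 i)//= lerDl sumr_ge0.
rewrite !mxE; move: i0 i1 yi0; move: (m.+1%:R^-1) => a i0 i1 yi0 yi1.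
by rewrite ler_norml; apply/andP; split; lra.
Qed.

Lemma centered_simplex_momx m : exists M, [/\ has_momx (\1_(centered_simplex m) : _ -> R) M,
  0 < M 0 0, forall j, M 0 (lift 0 j) = 0 & \det M = M 0 0 ^+ m.+3 * simplex_constant m].
Proof.
have w x : \1_(centered_simplex m) (x *m 1%:M + const_mx (- m.+1%:R^-1)) =
    \1_(std_simplex m) x :> R.
  apply: indic_eq; rewrite /centered_simplex/= mulmx1 -addrA.
  by rewrite (_ : _ + const_mx _ = 0) ?addr0//; apply/rowP => i; rewrite !mxE addrC subrr.
have mT := @measurable_centered_simplex m.
have mI : measurable_fun setT (\1_(centered_simplex m) : _ -> R) by exact: measurable_indic.
have hS := @std_simplex_has_momx R m.
have hM := has_momx_affine (unitmx1 _ _) mI hS w.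
have m00 := mass_momx_affine (unitmx1 _ _) hS hM w.
eexists; split; [exact: hM| | |].
- by rewrite m00 det1 normr1 mul1r std_simplex_momx00 invr_gt0 ltr0n fact_gt0.
- move=> k; have [_ <-] := hM.2 0 (lift 0 k).
  have h1 := has_integralB (hS.2 0 (lift 0 k)) (has_integralZ m.+1%:R^-1 (hS.2 0 0)).
  have [_ ->] : has_integral (mu m) (fun x => \1_(centered_simplex m) x *
      (homog x 0 0 * homog x 0 (lift 0 k))) (`|\det (1%:M : 'M[R]_m)| * 0).
    apply: (affine_has_integral (b := const_mx (- m.+1%:R^-1)) (unitmx1 _ _)).
      by apply: measurable_funM => //; apply: measurable_funM; exact: measurable_homog.
    move: h1; rewrite !mxE !eqxx lift0F !addn0 addn1 /= factS natrM invfM.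
    rewrite !mul1r subrr.
    congr has_integral; apply/funext => x.
    by rewrite w /homog !cons_row0 !cons_rowS mulmx1 !mxE; ring.
  by rewrite mulr0.
- by rewrite det_momx_affine det_std_simplex_momx m00 det1 normr1 expr1n !mul1r expr1n mul1r.
Qed.

End centered_simplex.
Arguments centered_simplex {R} m _.

Section body.
Context {R : realType}.
Local Notation mu := (borel_lebesgue R).
Variables n m : nat.

Local Notation T := (@centered_simplex R m).

(* The fibre of [body w] over [x] is [height (w x)] times the simplex; its volume is proportional to
   [height_pow m (w x)], which tends to [w x] as [m] grows. *)
Definition height (w : R) : R := 1 + ln w / m%:R.
Definition height_pow k (w : R) : R := if expR (- m%:R) < w then height w ^+ k else 0.

Definition body (w : 'rV[R]_n -> R) : set 'rV[R]_(n + m) :=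
  [set z | expR (- m%:R) < w (lsubmx z) /\ T ((height (w (lsubmx z)))^-1 *: rsubmx z)].

Hypothesis m_gt0 : (0 < m)%N.
Let mR : 0 < m%:R :> R. Proof. by rewrite ltr0n. Qed.

Lemma height_gt0 w : expR (- m%:R) < w -> 0 < height w.
Proof.
move=> hw; have w0 : 0 < w by exact: lt_trans (expR_gt0 _) hw.
rewrite /height -ltrBlDl sub0r ltr_pdivlMr// mulN1r.
by rewrite -[ltLHS]expRK ltr_ln ?posrE ?expR_gt0.
Qed.

Lemma height_pow_ge0 k w : 0 <= height_pow k w.
Proof. by rewrite /height_pow; case: ifPn => // /height_gt0 h; rewrite exprn_ge0// ltW. Qed.

Lemma measurable_height_pow k (w : 'rV[R]_n -> R) : measurable_fun setT w ->
  measurable_fun setT (fun x => height_pow k (w x)).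
Proof.
move=> mw; apply: measurable_fun_if => //.
- exact: measurable_fun_ltr.
- apply: (measurable_funS measurableT) => //; apply: measurable_funX.
  apply: measurable_funD => //; apply: measurable_funM => //.
  by apply: measurableT_comp.
Qed.

(** The averaged point lies in the simplex scaled by the averaged height. By concavity of [ln f] the
    height over the averaged base point is at least as large, and the simplex is star-shaped about
    0. *)
Lemma body_convex (f : 'rV[R]_n -> R) : (forall x, 0 <= f x) -> ln_concave f ->
  convex_set (body f).
Proof.
move=> f0 fc; apply/convex_rowP => z1 z2 t t01 [x1 y1] [x2 y2].
have [t0 t1] := andP t01.
rewrite /body/=.
have -> : lsubmx (t *: z1 + (1 - t) *: z2) = t *: lsubmx z1 + (1 - t) *: lsubmx z2.
  by apply/rowP => i; rewrite !mxE.
have -> : rsubmx (t *: z1 + (1 - t) *: z2) = t *: rsubmx z1 + (1 - t) *: rsubmx z2.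
  by apply/rowP => i; rewrite !mxE.
move: x1 y1 x2 y2; move: (lsubmx z1) (rsubmx z1) (lsubmx z2) (rsubmx z2) => x1 y1 x2 y2 h1 T1 h2 T2.
have hx := (convex_rowP _).1 (convex_superlevel (q := expR (- m%:R)) f0 fc) _ _ _ t01 h1 h2.
split => //; have s1 := height_gt0 h1; have s2 := height_gt0 h2; have s0 := height_gt0 hx.
have Ts := convex_cone_ray (@centered_simplex_convex R m) t01 s1 s2 T1 T2.
set s' := t * _ + _ in Ts.
have s'0 : 0 < s'.
  rewrite /s'; have [->|tn] := eqVneq t 0; first by rewrite mul0r add0r subr0 mul1r.
  by rewrite ltr_wpDr ?mulr_ge0 ?subr_ge0 ?(ltW s2)// mulr_gt0// lt_def tn.
have s's : s' <= height (f (t *: x1 + (1 - t) *: x2)).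
  have e0 := expR_gt0 (- m%:R : R).
  have [_ hl] := fc _ _ _ t01 (lt_trans e0 h1) (lt_trans e0 h2).
  rewrite /s' /height.
  have -> : t * (1 + ln (f x1) / m%:R) + (1 - t) * (1 + ln (f x2) / m%:R) =
    1 + (t * ln (f x1) + (1 - t) * ln (f x2)) / m%:R by ring.
  by rewrite lerD2l ler_wpM2r ?invr_ge0.
set s := height _ in s0 s's *; set y := _ + _ in Ts *.
have -> : s^-1 *: y = (s' / s) *: (s'^-1 *: y) + (1 - s' / s) *: 0.
  by rewrite scaler0 addr0 scalerA mulrAC mulfV ?gt_eqF// mul1r.
apply: (convex_rowP _).1 => //.
- exact: centered_simplex_convex.
- by apply/andP; split; [rewrite divr_ge0// ltW|rewrite ler_pdivrMr// mul1r].
- exact: centered_simplex0.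
Qed.

Lemma body_mono (f h : 'rV[R]_n -> R) : (forall x, h x = f x \/ h x = 0) ->
  body h `<=` body f.
Proof.
move=> hf z [hz]; case: (hf (lsubmx z)) => e; rewrite /body/= -?e//.
by move: hz; rewrite e ltNge expR_ge0.
Qed.

(** The bound [ln f > - m] confines the base through the decay of [f], and the upper bound of [f]
    limits the heights. *)
Lemma body_bounded (f : 'rV[R]_n -> R) A b : 0 < b ->
  (forall x, f x <= A * expR (- (b * norm1 x))) -> exists2 B, 0 < B & body f `<=` cube 0 B.
Proof.
move=> b0 fA; pose A' := `|A| + 1.
have A'0 : 0 < A' by rewrite ltr_wpDl.
have fA' x : f x <= A' * expR (- (b * norm1 x)).
  rewrite (le_trans (fA x))// ler_wpM2r ?expR_ge0// (le_trans (ler_norm A))//.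
  by rewrite lerDl.
pose B1 := (`|ln A'| + m%:R) / b; pose B2 := 1 + `|ln A'| / m%:R.
have B10 : 0 <= B1 by rewrite divr_ge0 ?addr_ge0// ltW.
have B20 : 0 <= B2 by rewrite addr_ge0// divr_ge0.
exists (B1 + B2 + 1); first by rewrite ltr_wpDl// addr_ge0.
move=> z [hz Tz] i; rewrite mxE subr0.
have z0 : 0 < f (lsubmx z) by exact: lt_trans (expR_gt0 _) hz.
have lf : ln (f (lsubmx z)) <= ln A' - b * norm1 (lsubmx z).
  by rewrite -[leRHS]expRK ler_ln ?posrE ?expR_gt0// expRD lnK ?posrE.
have lm : - m%:R < ln (f (lsubmx z)).
  by rewrite -[ltLHS]expRK ltr_ln ?posrE ?expR_gt0.
have Al := ler_norm (ln A').
have nz := norm1_ge0 (lsubmx z).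
have [j ->|j ->] := split_ordP i.
  have := ler_coord_norm1 (lsubmx z) j; rewrite mxE => /le_trans -> //.
  rewrite (@le_trans _ _ B1)//; last by lra.
  rewrite /B1 ler_pdivlMr// mulrC; lra.
have s0 := height_gt0 hz; have := centered_simplex_bound j Tz; rewrite !mxE.
rewrite normrM ger0_norm ?invr_ge0 ?(ltW s0)// ler_pdivrMl// mulr1 => /le_trans -> //.
rewrite (@le_trans _ _ B2)//; last by lra.
rewrite /B2 /height lerD2l ler_wpM2r ?invr_ge0//.
by rewrite (le_trans lf)// (le_trans _ Al)// gerBl mulr_ge0// ltW.
Qed.

Lemma measurable_lsubmx : measurable_fun setT (@lsubmx R 1 n m).
Proof.
apply: measurable_fun_rowP => i; rewrite (_ : _ \o _ = coord_row (lshift m i)).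
  exact: measurable_coord_row.
by apply/funext => z; rewrite /coord_row/= mxE.
Qed.

Lemma measurable_rsubmx_row : measurable_fun setT (@rsubmx R 1 n m).
Proof.
apply: measurable_fun_rowP => i; rewrite (_ : _ \o _ = coord_row (rshift n i)).
  exact: measurable_coord_row.
by apply/funext => z; rewrite /coord_row/= mxE.
Qed.

Lemma measurable_body (w : 'rV[R]_n -> R) : measurable_fun setT w -> measurable (body w).
Proof.
move=> mw; have mwl : measurable_fun setT (fun z => w (@lsubmx R 1 n m z)).
  exact: measurableT_comp measurable_lsubmx.
rewrite (_ : body w = (fun z => w (lsubmx z)) @^-1` `]expR (- m%:R), +oo[%classic `&`
   (fun z => (height (w (lsubmx z)))^-1 *: rsubmx z) @^-1` T).
  apply: measurableI; apply: measurable_sectionT => //.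
    apply: measurable_scale_row; last exact: measurable_rsubmx_row.
    apply: (measurableT_comp measurable_inv); apply: measurable_funD => //.
    by apply: measurable_funM => //; apply: measurableT_comp.
  exact: measurable_centered_simplex.
by apply/seteqP; split=> z /=; rewrite in_itv/= andbT.
Qed.

Lemma homogeneous_integral (p : 'rV[R]_m -> R) k v s : 0 < s ->
  measurable_fun setT p -> (forall a y, 0 < a -> p (a *: y) = a ^+ k * p y) ->
  has_integral (mu m) (fun y => \1_T y * p y) v ->
  has_integral (mu m) (fun y => \1_T (s^-1 *: y) * p y) (s ^+ (m + k) * v).
Proof.
move=> s0 mp hp hv; have uS : (s%:M : 'M[R]_m) \in unitmx.
  by rewrite unitmxE det_scalar unitfE expf_neq0// gt_eqF.
have -> : s ^+ (m + k) * v = `|\det (s%:M : 'M[R]_m)| * (s ^+ k * v).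
  by rewrite det_scalar ger0_norm ?exprn_ge0 ?ltW// exprD mulrA.
apply: (affine_has_integral (b := 0) uS).
  apply: measurable_funM => //; apply: measurable_indic_comp.
    exact: measurable_scale_row.
  exact: measurable_centered_simplex.
move: (has_integralZ (s ^+ k) hv); congr has_integral; apply/funext => y.
rewrite mul_mx_scalar addr0 scalerA mulVf ?gt_eqF// scale1r hp//; ring.
Qed.

(** Scaling a fibre contributes the power [m] of the height through the volume and the power [k]
    through the homogeneity of [p]. *)
Lemma body_fibre_integral (w q : 'rV[R]_n -> R) (p : 'rV[R]_m -> R) k v x :
  measurable_fun setT p -> (forall a y, 0 < a -> p (a *: y) = a ^+ k * p y) ->
  has_integral (mu m) (fun y => \1_T y * p y) v ->
  (\int[mu m]_y (\1_(body w) (row_mx x y) * (q x * p y))%:E =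
   (height_pow (m + k) (w x) * (q x * v))%:E)%E.
Proof.
move=> mp hp hv; rewrite /height_pow; case: ifPn => hw; last first.
  rewrite mul0r; apply: integral0_eq => y _.
  rewrite indicE memNset ?mul0r// => -[]; rewrite row_mxKl => h.
  by rewrite h in hw.
have := has_integral_ereal (has_integralZ (q x) (homogeneous_integral (height_gt0 hw) mp hp hv)).
rewrite mulrCA => <-; apply: eq_integral => y _; congr (_%:E).
rewrite mulrCA; congr (_ * (_ * _)); apply: indic_eq.
by rewrite /body/= row_mxKl row_mxKr; split=> [[]|].
Qed.

End body.
Arguments body {R n} m _ _.

Section body_moments.
Context {R : realType}.
Local Notation mu := (borel_lebesgue R).

Lemma has_integral_ae n (F G : 'rV[R]_n -> R) N v : measurable N -> mu n N = 0%E ->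
  (forall x, ~ N x -> F x = G x) -> measurable_fun setT G ->
  has_integral (mu n) F v -> has_integral (mu n) G v.
Proof.
move=> mN N0 FG mG [iF <-].
have mF : measurable_fun setT (EFin \o F) by case/integrableP : iF.
have e (p : \bar R -> \bar R) : ae_eq (mu n) setT (p \o (EFin \o F)) (p \o (EFin \o G)).
  exists N; split => // x /= /not_implyP[_ h].
  by apply: contrapT => Nx; apply: h; rewrite /= FG.
have mG' : measurable_fun setT (EFin \o G) by exact/measurable_EFinP.
split; last by congr fine; symmetry; apply: ae_eq_integral => //; exact: (e id).
have /integrableP[_ lF] := iF; apply/integrableP; split => //.
rewrite (le_lt_trans _ lF)// le_eqVlt; apply/orP; left; apply/eqP; symmetry.
by apply: ae_eq_integral => //; [exact: measurableT_comp|exact: measurableT_comp|exact: (e abse)].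
Qed.

Lemma has_momx_ae n (w1 w2 : 'rV[R]_n -> R) N M : measurable N -> mu n N = 0%E ->
  (forall x, ~ N x -> w1 x = w2 x) -> measurable_fun setT w2 ->
  has_momx w1 M -> has_momx w2 M.
Proof.
move=> mN N0 w12 mw [_ hM]; split=> // i j; apply: (@has_integral_ae _ _ _ N) (hM i j) => //.
  by move=> x Nx; rewrite w12.
by apply: measurable_funM => //; apply: measurable_funM; exact: measurable_homog.
Qed.

(** The fibres may have infinite measure, but the integral over a null base of a function with
    infinite values is still 0. *)
Lemma cylinder_null n m (N : set 'rV[R]_n) : measurable N -> mu n N = 0%E ->
  mu (n + m) [set z | N (lsubmx z)] = 0%E.
Proof.
move=> mN N0.
have mC : measurable [set z : 'rV[R]_(n + m) | N (lsubmx z)].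
  by apply: (@measurable_sectionT _ _ _ _ (@lsubmx R 1 n m) N) => //; exact: measurable_lsubmx.
have e x : (\int[mu m]_y (\1_[set z : 'rV[R]_(n + m) | N (lsubmx z)] (row_mx x y))%:E =
    (\1_N x)%:E * mu m setT)%E.
  rewrite -integral_cst//; apply: eq_integral => y _; congr (_%:E).
  by apply: indic_eq; rewrite /= row_mxKl.
rewrite -[X in mu _ X]setIT -integral_indic//.
rewrite ge0_integral_row_mx//; last by apply/measurable_EFinP; exact: measurable_indic.
rewrite (eq_integral _ _ (fun x _ => e x)).
rewrite -(@null_set_integral _ _ _ (mu n) N (fun x => (\1_N x)%:E * mu m setT)%E)//; last first.
  apply: (@measurable_funS _ _ _ _ setT) => //; apply: emeasurable_funM => //.
  by apply/measurable_EFinP; exact: measurable_indic.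
rewrite [RHS]integral_mkcond; apply: eq_integral => x _.
by rewrite /patch; case: ifPn => // xN; rewrite indicE (negbTE xN) mul0e.
Qed.

Variables n m : nat.

Lemma homog_row_mxl (x : 'rV[R]_n) (y : 'rV[R]_m) (i : 'I_n.+1) :
  homog (row_mx x y) 0 (lshift m i : 'I_(n + m).+1) = homog x 0 i.
Proof. by rewrite /homog cons_row_mx; exact: row_mxEl. Qed.

Lemma homog_row_mxr (x : 'rV[R]_n) (y : 'rV[R]_m) (j : 'I_m) :
  homog (row_mx x y) 0 (rshift n.+1 j : 'I_(n + m).+1) = y 0 j.
Proof. by rewrite /homog cons_row_mx; exact: row_mxEr. Qed.

Hypothesis m_gt0 : (0 < m)%N.

Definition inner_mx (M : 'M[R]_m.+1) : 'M[R]_m := \matrix_(i, j) M (lift 0 i) (lift 0 j).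

(** Each entry factors into a function of the base and a homogeneous function on the fibre. Mixed
    entries contain a first moment of the simplex and vanish, which makes the matrix block diagonal;
    the lower block has two more powers of the height. *)
Lemma body_has_momx (h : 'rV[R]_n -> R) MT U I2 B : measurable_fun setT h ->
  body m h `<=` cube 0 B -> has_momx (\1_(centered_simplex m) : _ -> R) MT ->
  (forall j, MT 0 (lift 0 j) = 0) -> has_momx (fun x => height_pow m m (h x)) U ->
  has_integral (mu n) (fun x => height_pow m (m + 2) (h x)) I2 ->
  has_momx (\1_(body m h) : _ -> R)
    (block_mx (MT 0 0 *: U) 0 0 (I2 *: inner_mx MT) : 'M[R]_(n.+1 + m)).
Proof.
move=> mh bB hT T0 hU hI; have mb := @measurable_body R n m h mh.
have [M hM] := bounded_has_momx mb bB.
suff <- : M = (block_mx (MT 0 0 *: U) 0 0 (I2 *: inner_mx MT) : 'M[R]_(n.+1 + m)) by [].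
have entry (i j : 'I_(n + m).+1) (q : 'rV[R]_n -> R) (p : 'rV[R]_m -> R) k v : measurable_fun setT p ->
    (forall a y, 0 < a -> p (a *: y) = a ^+ k * p y) ->
    has_integral (mu m) (fun y => \1_(centered_simplex m) y * p y) v ->
    (forall x y, homog (row_mx x y) 0 i * homog (row_mx x y) 0 j = q x * p y) ->
    M i j = \int[mu n]_x (height_pow m (m + k) (h x) * (q x * v)).
  move=> mp hp hv e; have [iF <-] := hM.2 i j.
  apply: Rintegral_row_mx iF _.
    apply: measurable_funM; first exact: measurable_indic.
    by apply: measurable_funM; exact: measurable_homog.
  move=> x; rewrite -(body_fibre_integral m_gt0 h q x mp hp hv).
  by apply: eq_integral => y _; rewrite e.
have hmass : has_integral (mu m) (fun y => \1_(centered_simplex m) y * 1) (MT 0 0).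
  by move: (has_momx_mass hT); congr has_integral; apply/funext => y; rewrite mulr1.
have hfst j : has_integral (mu m) (fun y => \1_(centered_simplex m) y * y 0 j) 0.
  move: (hT.2 0 (lift 0 j)); rewrite T0; congr has_integral; apply/funext => y.
  by rewrite /homog cons_row0 cons_rowS mul1r.
have hsnd j l : has_integral (mu m) (fun y => \1_(centered_simplex m) y * (y 0 j * y 0 l))
    (MT (lift 0 j) (lift 0 l)).
  move: (hT.2 (lift 0 j) (lift 0 l)); congr has_integral; apply/funext => y.
  by rewrite /homog !cons_rowS.
have cross i j : M (lshift m i : 'I_(n.+1 + m)) (rshift n.+1 j : 'I_(n.+1 + m)) = 0.
  rewrite (entry _ _ (fun x => homog x 0 i) (fun y => y 0 j) 1%N 0).
  - by rewrite /Rintegral integral0_eq// => x _; rewrite !mulr0.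
  - exact: measurable_coord.
  - by move=> a y _; rewrite mxE expr1.
  - exact: hfst.
  - by move=> x y; rewrite homog_row_mxl homog_row_mxr.
apply/matrixP => i j.
have [i' ->|i' ->] := @split_ordP n.+1 m i; have [j' ->|j' ->] := @split_ordP n.+1 m j.
- rewrite (@block_mxEul _ n.+1 m n.+1 m) mxE.
  rewrite (entry _ _ (fun x => homog x 0 i' * homog x 0 j') (fun=> 1) 0%N (MT 0 0)) ?addn0.
  + have [_ <-] := has_integralZ (MT 0 0) (hU.2 i' j').
    by congr fine; apply: eq_integral => x _; congr (_%:E); ring.
  + exact: measurable_cst.
  + by move=> a y _; rewrite expr0 mulr1.
  + exact: hmass.
  + by move=> x y; rewrite !homog_row_mxl mulr1.
- by rewrite (@block_mxEur _ n.+1 m n.+1 m) mxE cross.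
- by rewrite (@block_mxEdl _ n.+1 m n.+1 m) mxE (has_momx_sym _ _ hM) cross.
- rewrite (@block_mxEdr _ n.+1 m n.+1 m) !mxE.
  rewrite (entry _ _ (fun=> 1) (fun y => y 0 i' * y 0 j') 2%N (MT (lift 0 i') (lift 0 j'))).
  + have [_] := has_integralZ (MT (lift 0 i') (lift 0 j')) hI; rewrite [RHS]mulrC => <-.
    by congr fine; apply: eq_integral => x _; congr (_%:E); rewrite mul1r mulrC.
  + by apply: measurable_funM; exact: measurable_coord.
  + by move=> a y _; rewrite !mxE; ring.
  + exact: hsnd.
  + by move=> x y; rewrite !homog_row_mxr mul1r.
Qed.

(** A nonempty interior comes from positive measure: were the interior empty, the closure would be
    part of the null boundary. *)
Lemma body_convex_body (f : 'rV[R]_n -> R) A b : (forall x, 0 <= f x) -> ln_concave f ->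
  0 < b -> (forall x, f x <= A * expR (- (b * norm1 x))) ->
  (0 < mu (n + m) (closure (body m f)))%E ->
  convex_body (closure (body m f)) /\
  mu (n + m) (closure (body m f) `\` (body m f)°) = 0%E.
Proof.
move=> f0 fc b0 fA mpos; have cC := body_convex m_gt0 f0 fc.
have null := convex_boundary_null cC; split => //.
have [B B0 CB] := body_bounded m_gt0 b0 fA.
split; last 1 first.
- have [[z zC]|nC] := pselect ((body m f)° !=set0).
    by exists z; apply: interiorS zC; exact: subset_closure.
  have C0 : (body m f)° = set0 by apply/eqP; apply: contra_notT nC => /set0P.
  by move: null; rewrite C0 setD0 => e; rewrite e ltxx in mpos.
- apply: bounded_closed_compact; last exact: closed_closure.
  apply: (@cube_bounded _ _ _ (B + 1)) => z /closure_row/(_ ltr01)[c /CB cB zc] i.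
  have := cB i; have := zc i; rewrite !mxE !subr0 => zci ci.
  have -> : z 0 i = c 0 i + (z 0 i - c 0 i) by rewrite addrC subrK.
  by rewrite (le_trans (ler_normD _ _))// lerD// ltW.
- exact: convex_closure.
Qed.

(** The closure of [body m f] differs from [body m] of the Borel version only inside its boundary
    and the cylinder over [level_boundary f], so the moments agree. In the resulting inequality the
    mass of the simplex has the power [(n + m).+3] on both sides and cancels. *)
Lemma body_inequality (f : 'rV[R]_n -> R) A b U I2 :
  (forall K : set 'rV[R]_(n + m), convex_body K ->
    L_body K <= simplex_constant (n + m) `^ (2 * (n + m)%:R)^-1) ->
  (forall x, 0 <= f x) -> ln_concave f ->
  0 < b -> (forall x, f x <= A * expR (- (b * norm1 x))) ->
  has_momx (fun x => height_pow m m (borel_version f x)) U ->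
  has_integral (mu n) (fun x => height_pow m (m + 2) (borel_version f x)) I2 ->
  0 < U 0 0 ->
  simplex_constant m * (\det U * I2 ^+ m) <= simplex_constant (n + m) * U 0 0 ^+ (n + m).+3.
Proof.
move=> H f0 fc b0 fA hU hI U0.
pose h := borel_version f; have mh : measurable_fun setT h by exact: measurable_borel_version.
have [B B0 CB] := body_bounded m_gt0 b0 fA.
have hC : body m h `<=` body m f by apply: body_mono; exact: borel_version_cases.
have [MT [hT MT0 MTl dMT]] := @centered_simplex_momx R m.
have hM := body_has_momx mh (subset_trans hC CB) hT MTl hU hI.
set M := (X in has_momx _ X) in hM.
have M00 : M 0 0 = MT 0 0 * U 0 0.
  have e : (0 : 'I_(n.+1 + m)) = lshift m 0 by exact: val_inj.
  by rewrite [M 0 0](_ : _ = M (lshift m 0) (lshift m 0)) ?[LHS](@block_mxEul _ n.+1 m n.+1 m) ?mxE// -e.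
have Mpos : 0 < M 0 0 by rewrite M00 mulr_gt0.
have mb := @measurable_body R n m h mh.
have mK : measurable (closure (body m f)).
  by apply: closed_row_measurable; exact: closed_closure.
have Kpos : (0 < mu (n + m) (closure (body m f)))%E.
  rewrite (@lt_le_trans _ _ (mu (n + m) (body m h)))//.
    by rewrite (has_momx_massE mb hM) lte_fin.
  by rewrite le_measure ?inE//; apply: subset_trans hC _; exact: subset_closure.
have [cK bnull] := body_convex_body f0 fc b0 fA Kpos.
pose N2 := [set z : 'rV[R]_(n + m) | level_boundary f (lsubmx z)].
have mN2 : measurable N2.
  apply: (@measurable_sectionT _ _ _ _ (@lsubmx R 1 n m) (level_boundary f)).
    exact: measurable_lsubmx.
  exact: measurable_level_boundary.
have N20 : mu (n + m) N2 = 0%E.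
  apply: cylinder_null; first exact: measurable_level_boundary.
  exact: level_boundary_null.
have mN1 : measurable (closure (body m f) `\` (body m f)°).
  by apply: measurableD => //; apply: open_row_measurable; exact: open_interior.
have hK : has_momx (\1_(closure (body m f)) : _ -> R) M.
  apply: (@has_momx_ae _ _ _ (N2 `|` (closure (body m f) `\` (body m f)°))) hM.
  - exact: measurableU.
  - by rewrite measureU0.
  - move=> z /not_orP[zN2 zN1]; apply: indic_eq; split=> [/hC|zK]; first exact: subset_closure.
    have zC : body m f z.
      by apply: interior_subset; apply: contrapT => nz; exact: zN1.
    have e := borel_versionE zN2.
    by move: zC; rewrite /body/= e.
  - exact: measurable_indic.
have dM : 0 <= \det M by apply: has_momx_psd hM _ => z; exact: indic_ge0.
have nm : 0 < (2 * (n + m)%:R : R)^-1.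
  by rewrite invr_gt0 mulr_gt0// ltr0n addn_gt0 m_gt0 orbT.
have := H _ cK; rewrite (L_bodyE mK hK Mpos) => /(powR_le_inj nm).
have dM' : 0 <= \det M / M 0 0 ^+ (n + m).+3 by rewrite divr_ge0// exprn_ge0// ltW.
move=> /(_ dM' (ltW (simplex_constant_gt0 _))).
rewrite ler_pdivrMr ?exprn_gt0// M00 exprMn.
have -> : \det M = MT 0 0 ^+ n.+1 * \det U * (I2 ^+ m * \det (inner_mx MT)).
  by rewrite /M (@det_ublock _ n.+1 m) !detZ.
have dI : \det (inner_mx MT) = MT 0 0 ^+ m.+2 * simplex_constant m.
  have r0 : \row_j MT 0 (lift 0 j) = 0 by apply/rowP => j; rewrite !mxE MTl.
  have := momx_block (fun i j => has_momx_sym i j hT); rewrite r0 trmx0 => eM.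
  have := congr1 (fun X : 'M[R]_(1 + m) => \det X) eM.
  rewrite (@det_ublock _ 1 m) det_scalar1 dMT => e.
  by apply: (mulfI (lt0r_neq0 MT0)); apply: etrans (esym e) _; rewrite [in LHS]exprS -mulrA.
rewrite dI => hle.
have P0 : 0 < MT 0 0 ^+ (n + m).+3 by rewrite exprn_gt0.
rewrite -(ler_pM2l P0) (le_trans _ (le_trans hle _))//.
  rewrite le_eqVlt; apply/orP; left; apply/eqP.
  have -> : MT 0 0 ^+ (n + m).+3 = MT 0 0 ^+ n.+1 * MT 0 0 ^+ m.+2.
    by rewrite -exprD addSn !addnS.
  by ring.
by rewrite mulrCA.
Qed.

End body_moments.

(** * The limit of large codimension *)

Section height_estimates.
Context {R : realType}.

(** From [1 + x <= expR x] at [x = ln w / m], raised to the power [m]. *)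
Lemma height_pow_le m (w : R) : (0 < m)%N -> 0 <= w -> height_pow m m w <= w.
Proof.
move=> m0 w0; rewrite /height_pow; case: ifPn => // hw.
have mR : 0 < m%:R :> R by rewrite ltr0n.
have w1 : 0 < w := lt_trans (expR_gt0 _) hw.
have h0 := height_gt0 m0 hw.
rewrite (@le_trans _ _ (expR (ln w / m%:R) ^+ m))//.
  by rewrite lerXn2r ?nnegrE ?expR_ge0 ?(ltW h0)// expR_ge1Dx.
by rewrite -expRM_natl mulrC divfK ?gt_eqF// lnK ?posrE.
Qed.

(* [1 + x <= expR x] at [x = 1 / s - 1], where [s = height m w]. *)
Lemma height_pow_ge m (w : R) : (2 <= m)%N -> 0 <= w ->
  w * (1 - 2 * ln w ^+ 2 / m%:R) <= height_pow m m w.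
Proof.
move=> m2 w0; have m0 : (0 < m)%N by exact: leq_trans m2.
have mR : 0 < m%:R :> R by rewrite ltr0n.
have mR2 : 2 <= m%:R :> R by rewrite ler_nat.
have [w1|wn] := ltP 0 w; last first.
  have -> : w = 0 by apply/eqP; rewrite eq_le wn.
  by rewrite mul0r height_pow_ge0.
(* Below [- m / 2] the left-hand side is nonpositive, because [m >= 2]; above, [m + c >= m / 2]
   turns the exponent [c ^+ 2 / (m + c)] into the stated [2 * c ^+ 2 / m]. *)
set c := ln w; have [cm|cm] := ltP c (- (m%:R / 2)).
  rewrite (le_trans _ (height_pow_ge0 m0 m w))// mulr_ge0_le0// subr_le0.
  rewrite ler_pdivlMr// mul1r expr2.
  have : (m%:R / 2) * (m%:R / 2) <= c * c.
    by rewrite -(mulrNN c) ler_pM ?divr_ge0//; lra.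
  have : 2 * m%:R <= m%:R * m%:R :> R by rewrite ler_wpM2r// ltW.
  lra.
have hw : expR (- m%:R) < w by rewrite -[ltRHS]lnK ?posrE// ltr_expR -/c; lra.
have h0 := height_gt0 m0 hw; rewrite /height_pow hw.
set s := height m w in h0 *; have sE : s = 1 + c / m%:R by [].
have sm : m%:R / 2 <= m%:R + c by lra.
have smc : 0 < m%:R + c by lra.
have e1 : expR (1 - s^-1) <= s.
  have := expR_ge1Dx (s^-1 - 1); rewrite addrC subrK => h1.
  by rewrite -opprB expRN -[leRHS]invrK lef_pV2 ?posrE ?expR_gt0 ?invr_gt0.
apply: (@le_trans _ _ (expR (1 - s^-1) ^+ m)); last first.
  by rewrite lerXn2r ?nnegrE ?expR_ge0 ?(ltW h0).
have -> : expR (1 - s^-1) ^+ m = w * expR (- (c ^+ 2 / (m%:R + c))).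
  rewrite -expRM_natl -{1}[w](@lnK R) ?posrE// -/c -expRD; congr expR.
  by rewrite sE; field; rewrite ?gt_eqF//= !gt_eqF//.
rewrite ler_wpM2l// (le_trans _ (expR_ge1Dx _))// lerD2l lerN2.
rewrite ler_pdivrMr// mulrAC ler_pdivlMr//.
have c20 : 0 <= c ^+ 2 by rewrite sqr_ge0.
have : c ^+ 2 * (m%:R / 2) <= c ^+ 2 * (m%:R + c) by rewrite ler_wpM2l.
lra.
Qed.

Lemma height_pow_dist m (w : R) : (2 <= m)%N -> 0 <= w ->
  `|height_pow m m w - w| <= 2 / m%:R * (w * ln w ^+ 2).
Proof.
move=> m2 w0; have m0 : (0 < m)%N by exact: leq_trans m2.
have h1 := height_pow_le m0 w0; have h2 := height_pow_ge m2 w0.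
rewrite distrC ger0_norm ?subr_ge0// lerBlDr -lerBlDl (le_trans _ h2)//.
by rewrite le_eqVlt; apply/orP; left; apply/eqP; ring.
Qed.

(** Two more powers of the height change the integral only to order [1 / m]; raised to the power
    [m], as in the determinant of the body, this change survives as an exponential. *)
Lemma height_pow_add2 m (w : R) : (0 < m)%N ->
  height_pow m (m + 2) w = height_pow m m w +
    m%:R^-1 * (height_pow m m w * (2 * ln w + ln w ^+ 2 / m%:R)).
Proof.
move=> m0; rewrite /height_pow; case: ifPn => _; last by rewrite !(mul0r, mulr0) addr0.
by rewrite exprD; set s := _ ^+ m; rewrite /height; ring.
Qed.

End height_estimates.

Section convergence.
Context {R : realType}.

(** The sequences run over [m = k.+2] because the estimates on heights require [m >= 2]. *)
Lemma cvg_of_inv_bound (a : nat -> R) l K : (forall k, `|a k - l| <= K / k.+2%:R) ->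
  a @ \oo --> l.
Proof.
move=> H; apply/cvgrPdist_le => e e0.
have K0 : 0 <= K.
  by have := le_trans (normr_ge0 _) (H 0%N); rewrite pmulr_lge0// invr_gt0.
exists (Num.truncn (K / e)) => // k /= Kk; rewrite distrC (le_trans (H k))//.
rewrite ler_pdivrMr// mulrC -ler_pdivrMr//.
rewrite ltW// (lt_le_trans (truncnS_gt _))// ler_nat.
by rewrite (leq_ltn_trans Kk).
Qed.

Lemma cvg_det n (A : nat -> 'M[R]_n) (B : 'M[R]_n) :
  (forall i j, A k i j @[k --> \oo] --> B i j) -> \det (A k) @[k --> \oo] --> \det B.
Proof.
move=> AB; rewrite /determinant.
apply: cvg_big => [|s _]; first exact: add_continuous.
apply: cvgM; first exact: cvg_cst.
by apply: cvg_big => [|i _]; [exact: mul_continuous|exact: AB].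
Qed.

Lemma simplex_constantS d : simplex_constant d.+1 =
  simplex_constant d * ((d.+1%:R / d.+2%:R) ^+ 2 * (d.+1%:R / d.+3%:R) ^+ d.+1) :> R.
Proof.
rewrite /simplex_constant factS natrM !exprMn !exprVn.
rewrite [d.+2%:R ^+ d.+2]exprS [d.+2%:R ^+ d.+1]exprS.
by field; rewrite !expf_neq0 ?pnatr_eq0//= andbT -natrD pnatr_eq0.
Qed.

(** One more dimension costs at most [(1 - 2 / (d + 3)) ^+ d.+1], hence at most
    [e^(-2 (d + 1) / (d + 3))], and this factor is largest at the first dimension [d = m]. *)
Lemma simplex_constant_decay n m : simplex_constant (n + m) <=
  simplex_constant m * expR (- (2 * n%:R * (m.+1%:R / m.+3%:R))) :> R.
Proof.
elim: n => [|n IH]; first by rewrite add0n mulr0 mul0r oppr0 expR0 mulr1.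
rewrite addSn simplex_constantS.
have -> : expR (- (2 * n.+1%:R * (m.+1%:R / m.+3%:R))) =
    expR (- (2 * n%:R * (m.+1%:R / m.+3%:R))) * expR (- (2 * (m.+1%:R / m.+3%:R))) :> R.
  by rewrite -expRD -[n.+1%:R]natr1; congr expR; ring.
rewrite mulrA; apply: ler_pM => //.
  by rewrite ltW// simplex_constant_gt0.
set d := (n + m)%N; have d3 : 0 < d.+3%:R :> R by rewrite ltr0n.
have d1 : (d.+1%:R / d.+2%:R) ^+ 2 <= 1 :> R.
  by rewrite exprn_ile1 ?divr_ge0// ler_pdivrMr// mul1r ler_nat.
rewrite (@le_trans _ _ ((d.+1%:R / d.+3%:R) ^+ d.+1))//.
  by rewrite ler_piMl// exprn_ge0// divr_ge0.
rewrite (@le_trans _ _ (expR (- (2 / d.+3%:R)) ^+ d.+1))//.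
  rewrite lerXn2r ?nnegrE ?expR_ge0 ?divr_ge0// (le_trans _ (expR_ge1Dx _))//.
  rewrite le_eqVlt; apply/orP; left; apply/eqP.
  by field; rewrite -?natrD pnatr_eq0.
rewrite -expRM_natl ler_expR mulrN lerN2.
have -> : d.+1%:R * (2 / d.+3%:R) = 2 * (d.+1%:R / d.+3%:R) :> R by ring.
rewrite ler_wpM2l// ler_pdivrMr// mulrAC ler_pdivlMr// -!natrM ler_nat.
by rewrite /d; lia.
Qed.

End convergence.

Section functional_inequality.
Context {R : realType}.
Local Notation mu := (borel_lebesgue R).

Lemma has_integral_dist d (X : measurableType d) (m : {measure set X -> \bar R})
    (F F' G : X -> R) u u' v c : has_integral m F u -> has_integral m F' u' ->
  has_integral m G v -> (forall x, `|F x - F' x| <= c * G x) -> `|u - u'| <= c * v.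
Proof.
move=> hF hF' hG H; rewrite ler_norml; apply/andP; split.
  have hN : has_integral m (fun x => - c * G x) (- (c * v)).
    by rewrite -mulNr; exact: has_integralZ.
  apply: has_integral_le hN (has_integralB hF hF') _ => x.
  by have := H x; rewrite ler_norml mulNr => /andP[].
apply: has_integral_le (has_integralB hF hF') (has_integralZ c hG) _ => x.
by have := H x; rewrite ler_norml => /andP[].
Qed.

Lemma homog_norm1 n (x : 'rV[R]_n) i : `|homog x 0 i| <= 1 + norm1 x.
Proof.
rewrite /homog; have [k ->|->] := unliftP 0 i.
  by rewrite cons_rowS (le_trans (ler_coord_norm1 x k))// lerDr.
by rewrite cons_row0 normr1 lerDl norm1_ge0.
Qed.

Section growth.
Variables (n : nat) (h : 'rV[R]_n -> R) (C b : R).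
Hypotheses (mh : measurable_fun setT h) (h0 : forall x, 0 <= h x) (b0 : 0 < b).

(** A single integrable majorant for all moments and for all errors of order [1 / m]. *)
Let G x := h x * (1 + `|ln (h x)|) ^+ 3 * (1 + norm1 x) ^+ 2.

Hypothesis hG : forall x, G x <= C * expR (- (b * norm1 x)).

Let mln : measurable_fun setT (fun x => ln (h x)).
Proof. by apply: measurableT_comp mh. Qed.

Let has_integral_dominated (F : 'rV[R]_n -> R) : measurable_fun setT F ->
  (forall x, `|F x| <= G x) -> has_integral (mu n) F (\int[mu n]_x F x).
Proof.
move=> mF FG; apply: dominated_has_integral b0 mF _ => x.
exact: le_trans (FG x) (hG x).
Qed.

Let hW : has_integral (mu n) G (\int[mu n]_x G x).
Proof.
apply: has_integral_dominated => [|x]; last first.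
  by rewrite ger0_norm// !mulr_ge0 ?exprn_ge0 ?addr_ge0 ?norm1_ge0.
apply: measurable_funM; first apply: measurable_funM => //.
  apply: measurable_funX; apply: measurable_funD => //.
  exact: measurableT_comp.
by apply: measurable_funX; apply: measurable_funD => //; exact: measurable_norm1.
Qed.

Let W := \int[mu n]_x G x.

Let growth_le j a x : (j <= 3)%N -> 0 <= a -> a <= (1 + norm1 x) ^+ 2 ->
  h x * `|ln (h x)| ^+ j * a <= G x.
Proof.
move=> j3 a0 aN; rewrite /G; apply: ler_pM => //.
  by rewrite mulr_ge0 ?exprn_ge0.
rewrite ler_wpM2l// (@le_trans _ _ ((1 + `|ln (h x)|) ^+ j))//.
  by rewrite lerXn2r ?nnegrE ?addr_ge0// lerDr.
by rewrite ler_weXn2l// lerDl.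
Qed.

Let norm1_ge1 (x : 'rV[R]_n) : 1 <= (1 + norm1 x) ^+ 2.
Proof. by rewrite exprn_ege1// lerDl norm1_ge0. Qed.

Let growth_le1 j x : (j <= 3)%N -> h x * `|ln (h x)| ^+ j <= G x.
Proof. by move=> j3; rewrite -[leLHS]mulr1 growth_le. Qed.

Let homog2 (x : 'rV[R]_n) i j : `|homog x 0 i * homog x 0 j| <= (1 + norm1 x) ^+ 2.
Proof. by rewrite normrM expr2 ler_pM ?homog_norm1. Qed.

Let mhomog2 i j : measurable_fun setT (fun x : 'rV[R]_n => homog x 0 i * homog x 0 j).
Proof. by apply: measurable_funM; exact: measurable_homog. Qed.

Definition density_momx : 'M[R]_n.+1 :=
  \matrix_(i, j) \int[mu n]_x (h x * (homog x 0 i * homog x 0 j)).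

Lemma density_has_momx : has_momx h density_momx.
Proof.
split => // i j; rewrite mxE; apply: has_integral_dominated => [|x].
  exact: measurable_funM.
rewrite normrM ger0_norm//; have := @growth_le 0 _ x isT (normr_ge0 _) (homog2 x i j).
by rewrite expr0 mulr1.
Qed.

Definition density_ln : R := \int[mu n]_x (h x * ln (h x)).

Lemma density_ln_has_integral : has_integral (mu n) (fun x => h x * ln (h x)) density_ln.
Proof.
apply: has_integral_dominated => [|x]; first exact: measurable_funM.
by rewrite normrM ger0_norm// -[`|ln _|]expr1 growth_le1.
Qed.

Section fixed_dimension.
Variable m : nat.
Hypothesis m2 : (2 <= m)%N.
Let m0 : (0 < m)%N. Proof. exact: leq_trans m2. Qed.
Let mR : 0 < m%:R :> R. Proof. by rewrite ltr0n. Qed.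
Let mR1 : 1 <= m%:R :> R. Proof. by rewrite ler1n. Qed.
Let hp x := height_pow m m (h x).

Let mhp : measurable_fun setT hp.
Proof. exact: measurable_height_pow. Qed.

Let hp0 x : 0 <= hp x. Proof. exact: height_pow_ge0. Qed.
Let hple x : hp x <= h x. Proof. exact: height_pow_le. Qed.

Definition height_momx : 'M[R]_n.+1 :=
  \matrix_(i, j) \int[mu n]_x (height_pow m m (h x) * (homog x 0 i * homog x 0 j)).

Lemma height_has_momx : has_momx (fun x => height_pow m m (h x)) height_momx.
Proof.
split => // i j; rewrite mxE; apply: has_integral_dominated => [|x].
  exact: measurable_funM.
rewrite normrM (ger0_norm (hp0 x)) (@le_trans _ _ (h x * `|homog x 0 i * homog x 0 j|))//.
  by rewrite ler_wpM2r.
have := @growth_le 0 _ x isT (normr_ge0 _) (homog2 x i j).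
by rewrite expr0 mulr1.
Qed.

Lemma height_momx_dist i j : `|height_momx i j - density_momx i j| <= 2 * W / m%:R.
Proof.
rewrite mulrAC; apply: has_integral_dist (height_has_momx.2 i j) (density_has_momx.2 i j) hW _.
move=> x; rewrite -mulrBl normrM.
rewrite (@le_trans _ _ (2 / m%:R * (h x * ln (h x) ^+ 2) * `|homog x 0 i * homog x 0 j|))//.
  by rewrite ler_wpM2r// height_pow_dist.
rewrite -mulrA ler_wpM2l ?divr_ge0 ?(ltW mR)//.
by rewrite -[ln (h x) ^+ 2]real_normK ?num_real// growth_le.
Qed.

Let J x := hp x * (2 * ln (h x) + ln (h x) ^+ 2 / m%:R).

(** [m] times the change of the integral of [height_pow m m] when the power is raised by 2. *)
Definition height_ln : R := \int[mu n]_x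
  (height_pow m m (h x) * (2 * ln (h x) + ln (h x) ^+ 2 / m%:R)).

Let hJ : has_integral (mu n) J height_ln.
Proof.
apply: has_integral_dominated => [|x].
  apply: measurable_funM => //; apply: measurable_funD; first exact: measurable_funM.
  by apply: measurable_funM => //; exact: measurable_funX.
rewrite normrM (ger0_norm (hp0 x)).
rewrite (@le_trans _ _ (h x * (1 + `|ln (h x)|) ^+ 2))//.
  apply: ler_pM => //; rewrite (le_trans (ler_normD _ _))//.
  rewrite !normrM -expr2 normfV (@ger0_norm _ 2)// (@ger0_norm _ m%:R) ?(ltW mR)//.
  have : `|ln (h x)| ^+ 2 / m%:R <= `|ln (h x)| ^+ 2.
    by rewrite ler_pdivrMr// ler_peMr// exprn_ge0.
  rewrite sqrrD expr1n; lra.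
rewrite /G -[leLHS]mulr1; apply: ler_pM => //.
  by rewrite mulr_ge0 ?exprn_ge0 ?addr_ge0.
by rewrite ler_wpM2l// ler_weXn2l// lerDl.
Qed.

Lemma height_ln_dist : `|height_ln - 2 * density_ln| <= 5 * W / m%:R.
Proof.
rewrite mulrAC; apply: has_integral_dist hJ (has_integralZ 2 density_ln_has_integral) hW _ => x.
set c := ln (h x).
(* Replacing the power of the height by [h] costs [4 / m] and the quadratic term [1 / m], whence the
   constant 5. *)
have -> : J x - 2 * (h x * c) = (hp x - h x) * (2 * c) + hp x * (c ^+ 2 / m%:R).
  by rewrite /J -/c; ring.
have d1 : `|(hp x - h x) * (2 * c)| <= 4 / m%:R * (h x * `|c| ^+ 3).
  have -> : 4 / m%:R * (h x * `|c| ^+ 3) = 2 / m%:R * (h x * c ^+ 2) * (2 * `|c|).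
    by rewrite -[c ^+ 2]real_normK ?num_real//; ring.
  rewrite normrM [`|2 * c|]normrM (@ger0_norm _ 2)//.
  by rewrite ler_wpM2r ?mulr_ge0// height_pow_dist.
have d2 : `|hp x * (c ^+ 2 / m%:R)| <= 1 / m%:R * (h x * `|c| ^+ 2).
  rewrite ger0_norm; last by rewrite mulr_ge0// divr_ge0 ?sqr_ge0// ltW.
  rewrite real_normK ?num_real//.
  have -> : 1 / m%:R * (h x * c ^+ 2) = h x * (c ^+ 2 / m%:R) by ring.
  by rewrite ler_wpM2r// divr_ge0 ?sqr_ge0// ltW.
have -> : 5 / m%:R * G x = 4 / m%:R * G x + 1 / m%:R * G x by ring.
rewrite (le_trans (ler_normD _ _))// lerD//.
  by rewrite (le_trans d1)// ler_wpM2l ?growth_le1// divr_ge0// ltW.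
by rewrite (le_trans d2)// ler_wpM2l ?growth_le1// divr_ge0// ltW.
Qed.

Lemma height_pow2_has_integral : has_integral (mu n)
  (fun x => height_pow m (m + 2) (h x)) (height_momx 0 0 + m%:R^-1 * height_ln).
Proof.
move: (has_integralD (has_momx_mass height_has_momx) (has_integralZ m%:R^-1 hJ)).
by congr has_integral; apply/funext => x; rewrite height_pow_add2.
Qed.

End fixed_dimension.

Lemma cvg_height_momx i j : height_momx k.+2 i j @[k --> \oo] --> density_momx i j.
Proof. by apply: (@cvg_of_inv_bound _ _ _ (2 * W)) => k; exact: height_momx_dist. Qed.

Lemma cvg_height_ln : height_ln k.+2 @[k --> \oo] --> 2 * density_ln.
Proof. by apply: (@cvg_of_inv_bound _ _ _ (5 * W)) => k; exact: height_ln_dist. Qed.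

(* [(1 + z) ^+ m >= expR (m z / (1 + z))] for [1 + z = I2 / U00], where [m z / (1 + z)] is
   [height_ln m / I2]. *)
Lemma height_momx_bound m : (2 <= m)%N ->
  0 < height_momx m 0 0 -> 0 < height_momx m 0 0 + m%:R^-1 * height_ln m ->
  simplex_constant m * (\det (height_momx m) *
    (height_momx m 0 0 + m%:R^-1 * height_ln m) ^+ m) <=
    simplex_constant (n + m) * height_momx m 0 0 ^+ (n + m).+3 ->
  \det (height_momx m) *
    expR (height_ln m / (height_momx m 0 0 + m%:R^-1 * height_ln m)) <=
  expR (- (2 * n%:R * (m.+1%:R / m.+3%:R))) * height_momx m 0 0 ^+ n.+3.
Proof.
move=> m2; have m0 : (0 < m)%N by exact: leq_trans m2.
have mR : 0 < m%:R :> R by rewrite ltr0n.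
have dU : 0 <= \det (height_momx m).
  by apply: has_momx_psd (height_has_momx m2) _ => x; exact: height_pow_ge0.
set U := height_momx m 0 0; set J := height_ln m; set I := U + _ => U0 I0 H.
have c0 : 0 < simplex_constant m :> R by exact: simplex_constant_gt0.
have e1 : expR (J / I) * U ^+ m <= I ^+ m.
  rewrite -ler_pdivlMr ?exprn_gt0// -expr_div_n.
  have -> : J / I = m%:R * (1 - U / I).
    by rewrite mulrBr mulr1; apply: (mulIf (lt0r_neq0 I0)); rewrite mulrBl mulrA !divfK ?gt_eqF// /I; field; rewrite gt_eqF.
  rewrite expRM_natl lerXn2r ?nnegrE ?expR_ge0 ?divr_ge0 ?(ltW U0) ?(ltW I0)//.
  rewrite -opprB expRN -[leRHS]invrK lef_pV2 ?posrE ?expR_gt0 ?invr_gt0 ?divr_gt0// invf_div.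
  by have := expR_ge1Dx (U / I - 1); rewrite addrC subrK.
rewrite -(ler_pM2l c0) -(ler_pM2r (exprn_gt0 m U0)).
apply: (@le_trans _ _ (simplex_constant m * (\det (height_momx m) * I ^+ m))).
  by rewrite -[leLHS]mulrA -[X in _ * X]mulrA ler_pM2l// ler_wpM2l.
apply: (le_trans H).
have -> : U ^+ (n + m).+3 = U ^+ n.+3 * U ^+ m by rewrite -exprD !addSn.
have assoc (p q E c c' : R) : c' <= c * E -> 0 <= p * q -> c' * (p * q) <= c * (E * p) * q.
  by move=> cE pq; rewrite (_ : c * (E * p) * q = c * E * (p * q)); [rewrite ler_wpM2r|ring].
apply: assoc; first exact: simplex_constant_decay.
by apply: mulr_ge0; apply: exprn_ge0; exact: ltW.
Qed.

(** The bound at finite [m] passes to the limit: the perturbed mass tends to the same limit as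
    [height_momx m 0 0], so the exponent tends to [2 * density_ln / density_momx 0 0], and the
    factor from the simplices tends to [expR (- (2 * n%:R))]. *)
Lemma density_momx_bound : 0 < density_momx 0 0 ->
  (forall m, (2 <= m)%N -> 0 < height_momx m 0 0 ->
    simplex_constant m * (\det (height_momx m) *
      (height_momx m 0 0 + m%:R^-1 * height_ln m) ^+ m) <=
    simplex_constant (n + m) * height_momx m 0 0 ^+ (n + m).+3) ->
  \det density_momx * expR (2 * density_ln / density_momx 0 0) <=
  expR (- (2 * n%:R)) * density_momx 0 0 ^+ n.+3.
Proof.
move=> M0 H.
have cU : height_momx k.+2 0 0 @[k --> \oo] --> density_momx 0 0 by exact: cvg_height_momx.
have cV : (k.+2%:R^-1 : R) @[k --> \oo] --> (0 : R).
  apply: (@cvg_of_inv_bound _ _ _ 1) => k; rewrite subr0 ger0_norm ?mul1r//.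
have cI : height_momx k.+2 0 0 + k.+2%:R^-1 * height_ln k.+2 @[k --> \oo] --> density_momx 0 0.
  by rewrite -[X in _ --> X]addr0 -(mul0r (2 * density_ln)); apply: cvgD => //; apply: cvgM => //; exact: cvg_height_ln.
have cE : expR (- (2 * n%:R * (k.+3%:R / k.+4.+1%:R))) @[k --> \oo] --> expR (- (2 * n%:R) : R).
  apply: continuous_cvg; first exact: continuous_expR.
  apply: cvgN; apply: (@cvg_of_inv_bound _ _ _ (4 * n%:R)) => k.
  have -> : 2 * n%:R * (k.+3%:R / k.+4.+1%:R) - 2 * n%:R = - (4 * n%:R / k.+4.+1%:R) :> R.
    by field; rewrite -?natrD pnatr_eq0.
  rewrite normrN ger0_norm ?divr_ge0 ?mulr_ge0// ler_wpM2l ?mulr_ge0//.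
  by rewrite lef_pV2 ?posrE// ler_nat; lia.
have cL : \det (height_momx k.+2) * expR (height_ln k.+2 /
    (height_momx k.+2 0 0 + k.+2%:R^-1 * height_ln k.+2)) @[k --> \oo] -->
    \det density_momx * expR (2 * density_ln / density_momx 0 0).
  apply: cvgM.
    by apply: (@cvg_det _ _ (fun k => height_momx k.+2)) => i j; exact: cvg_height_momx.
  apply: continuous_cvg; first exact: continuous_expR.
  apply: cvgM; first exact: cvg_height_ln.
  by apply: cvgV; [rewrite gt_eqF|exact: cI].
have cR : expR (- (2 * n%:R * (k.+3%:R / k.+4.+1%:R))) * height_momx k.+2 0 0 ^+ n.+3
    @[k --> \oo] --> expR (- (2 * n%:R)) * density_momx 0 0 ^+ n.+3.
  apply: cvgM; first exact: cE.
  apply: (@continuous_cvg _ _ _ _ _ (fun k => height_momx k.+2 0 0) (fun x : R => x ^+ n.+3)).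
    exact: exprn_continuous.
  exact: cU.
(* The masses are positive in the limit, hence eventually, which is all that the comparison of
   limits asks for. *)
apply: ler_cvg_to cL cR _; near=> k; apply: height_momx_bound => //.
- by near: k; exact: (cvgr_gt _ cU).
- by near: k; exact: (cvgr_gt _ cI).
- by apply: H => //; near: k; exact: (cvgr_gt _ cU).
Unshelve. all: by end_near. Qed.

End growth.

(** The convex body is built from [f] itself, whose log-concavity gives convexity, and the moments
    from its Borel version. The limit inequality is the [2 n]-th power of the claim, its exponent
    being minus twice the entropy. *)
Lemma Lhat_le n (f : 'rV[R]_n -> R) : (1 <= n)%N ->
  (forall m, (1 <= m)%N -> forall K : set 'rV[R]_(n + m), convex_body K ->
    L_body K <= simplex_constant (n + m) `^ (2 * (n + m)%:R)^-1) ->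
  integrable_log_concave f -> Lhat f <= expR (-1).
Proof.
move=> n1 H [lc iF I0]; have f0 := log_concave_ge0 lc; have fc := log_concave_ln lc.
pose h := borel_version f; pose N := level_boundary f.
have mN : measurable N by exact: measurable_level_boundary.
have N0 : mu n N = 0%E by exact: level_boundary_null.
have fh x : ~ N x -> f x = h x by exact: borel_versionE.
have mh : measurable_fun setT h by exact: measurable_borel_version.
have h0 x : 0 <= h x by exact: borel_version_ge0.
have mf : measurable_fun setT (f : caratheodory_type ((mu n)^*)%mu -> R).
  by apply/measurable_EFinP; exact: (measurable_int (lebesgue R n)).
have ih : (mu n).-integrable setT (EFin \o h).
  apply/integrable_lebesgue => //; apply: le_integrable iF; first exact: measurableT.
    by apply/measurable_EFinP; exact: measurable_fun_lebesgue.
  by move=> x _; rewrite lee_fin !ger0_norm// borel_version_le.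
have hm := integrable_has_integral ih; set m0 := (X in has_integral _ _ X) in hm.
have m0_gt0 : 0 < m0 by rewrite -(Rintegral_lebesgue_ae mN N0 fh mf hm).
have [A [b [b0 fA]]] := log_concave_decay f0 fc hm m0_gt0.
have [C [b' [b'0 hG]]] := log_concave_growth f0 fc hm m0_gt0.
have hM := density_has_momx mh h0 b'0 hG.
have hE := density_ln_has_integral mh h0 b'0 hG.
have M00 : density_momx h 0 0 = m0.
  have [_ <-] := has_momx_mass hM; by have [_ <-] := hm.
have M0 : 0 < density_momx h 0 0 by rewrite M00.
have bound := density_momx_bound mh h0 b'0 hG M0.
have {}bound : \det (density_momx h) * expR (2 * density_ln h / density_momx h 0 0) <=
    expR (- (2 * n%:R)) * density_momx h 0 0 ^+ n.+3.
  apply: bound => m m2 U0; have m_gt0 : (0 < m)%N by exact: leq_trans m2.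
  apply: (body_inequality m_gt0 (H m m_gt0) f0 fc b0 fA).
  - exact: (height_has_momx mh h0 b'0 hG m2).
  - exact: (height_pow2_has_integral mh h0 b'0 hG m2).
  - exact: U0.
rewrite (LhatE mN N0 fh mf hM M0 h0).
have -> : - (2 * entropy f) = 2 * density_ln h / density_momx h 0 0.
  rewrite /entropy (integral_funE mN N0 fh mf hM).
  rewrite (@Rintegral_lebesgue_ae _ _ _ (fun x => h x * ln (h x)) N _ mN N0 _ _ hE).
  - by rewrite mulNr mulrN opprK mulrA.
  - by move=> x Nx; rewrite fh.
  - apply: measurable_funM; first exact: mf.
    by apply: measurableT_comp mf.
have nR : 0 < n%:R :> R by rewrite ltr0n.
have -> : expR (-1) = expR (- (2 * n%:R)) `^ (2 * n%:R)^-1 :> R.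
  by rewrite -expRM mulNr divff// mulf_neq0// gt_eqF.
have dM : 0 <= \det (density_momx h) by exact: has_momx_psd hM h0.
have P0 : 0 < density_momx h 0 0 ^+ n.+3 by rewrite exprn_gt0.
apply: ge0_ler_powR; rewrite ?nnegrE ?invr_ge0 ?mulr_ge0 ?expR_ge0//.
  by rewrite invr_ge0 ltW.
by rewrite ler_pdivrMr// mulrC.
Qed.

End functional_inequality.

Theorem proposition5p2 (R : realType) (Delta : forall d, set 'rV[R]_d)
    (hDelta : forall d, (1 <= d)%N ->
       regular_simplex (Delta d) /\ bar_body (Delta d) = 0)
    (n : nat) (hn : (1 <= n)%N) :
  ((forall m, (1 <= m)%N -> forall K : set 'rV[R]_(n + m), convex_body K ->
       L_body K <= L_body (Delta (n + m)%N)) ->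
   forall f : 'rV[R]_n -> R, integrable_log_concave f ->
     Lhat f <= Lhat (@f0 R n))
  /\ Lhat (@f0 R n) = expR (-1)
  /\ ((forall f : 'rV[R]_n.+1 -> R, integrable_log_concave f ->
         Lhat f <= expR (-1)) ->
      forall K : set 'rV[R]_n, convex_body K -> L_body K <= L_body (Delta n))
  /\ L_body (Delta n) =
       (n`!)%:R `^ (n%:R)^-1 /
       ((n.+1)%:R `^ (n.+1%:R / (2 * n%:R)) * Num.sqrt (n.+2)%:R).
Proof.
(* The constant of a regular simplex depends only on the dimension, so [Delta d] gives way to an
   explicit number. *)
have LD d : (1 <= d)%N -> L_body (Delta d) = simplex_constant d `^ (2 * d%:R)^-1.
  by move=> d1; apply: L_regular_simplex; case: (hDelta _ d1).
split; [|split; [|split]].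
- move=> H f hf; rewrite (Lhat_f0 hn); apply: Lhat_le hf => // m m1 K cK.
  by rewrite -LD ?H// addn_gt0 hn.
- exact: Lhat_f0.
- by move=> H K cK; rewrite LD//; exact: L_body_le_simplex_constant.
- by rewrite LD// simplex_constantE.
Qed.
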